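(* Let $M$ be either $B_n^+$ or $B_n^{+*}$ ($n\ge2$). For each $k\ge0$ let $\mu_{n,k}$ be the uniform probability distribution on the finite set $M(k)=\{x\in M:|x|=k\}$, viewed as a probability measure on $\overline M$. Then $(\mu_{n,k})_{k\ge0}$ converges weakly, as $k\to\infty$, to the uniform measure at infinity $\nu_{q_n}$.
   Context: $M$ is either (a) the positive braid monoid $B_n^+$, generated by $\Sigma=\{\sigma_1,\dots,\sigma_{n-1}\}$ with relations $\sigma_i\sigma_j=\sigma_j\sigma_i$ for $|i-j|\ge2$, $\sigma_i\sigma_j\sigma_i=\sigma_j\sigma_i\sigma_j$ for $|i-j|=1$; or (b) the dual braid monoid $B_n^{+*}$, generated by $\Sigma=\{\sigma_{i,j}:1\le i<j\le n\}$ ($\sigma_{j,i}=\sigma_{i,j}$) with relations $\sigma_{i,j}\sigma_{j,k}=\sigma_{j,k}\sigma_{k,i}=\sigma_{k,i}\sigma_{i,j}$ for $i<j<k$ and $\sigma_{i,j}\sigma_{k,\ell}=\sigma_{k,\ell}\sigma_{i,j}$ whenever $i<j<k<\ell$ or $i<k<\ell<j$. Unit $\mathbf e$; $|x|$ word length; $x\le_l y$ iff $y=xz$. $M$ is a Garside monoid; $\Delta$ is the least upper bound of $\Sigma$ for $\le_l$, $\mathcal S_n$ the set of left divisors of $\Delta$. For $x\in\mathcal S_n$, $\mathsf R(x)=\{\sigma\in\Sigma:x\sigma\notin\mathcal S_n\}$, $\mathsf L(x)=\{\sigma\in\Sigma:\sigma\le_l x\}$, $x\to y$ iff $\mathsf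 L(y)\subseteq\mathsf R(x)$. Every $x\neq\mathbf e$ has a unique Garside normal form $(x_1,\dots,x_k)$ (non-unit simple braids, $x=x_1\cdots x_k$, $x_i\to x_{i+1}$); the normal form of $\mathbf e$ is $(\mathbf e)$. $q_n$ is the radius of convergence of $G_n(t)=\sum_{x\in M}t^{|x|}$. $\overline M$ is the compact space of sequences $(\xi_k)_{k\ge1}$ in $\mathcal S_n$ with $\xi_k\to\xi_{k+1}$ for all $k$, with product topology ($\mathcal S_n$ discrete); $M$ is identified with sequences eventually equal to $\mathbf e$ via $x\mapsto$ its normal form followed by infinitely many $\mathbf e$; $\partial M=\overline M\setminus M$. $\Uparrow x$ is the closure of $\{xz:z\in M\}$ in $\overline M$ and $\uparrow x=\Uparrow x\cap\partial M$. The uniform measure at infinity $\nu_{q_n}$ is the unique probability measure on $\overline M$ with $\nu_{q_n}(\uparrow x)=q_n^{|x|}$ for all $x\in M$ (it is supported by $\partial M$). *)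

(* Defs.v *)
From HB Require Import structures.
From mathcomp Require Import all_boot all_order all_algebra.
From mathcomp Require Import all_classical all_reals all_analysis.

Set Implicit Arguments.
Unset Strict Implicit.
Unset Printing Implicit Defensive.

Import Order.TTheory GRing.Theory Num.Theory.
Import numFieldTopology.Exports numFieldNormedType.Exports.
Local Open Scope classical_set_scope.

Section Congruence.
Variables (T : Type) (r : seq T -> seq T -> Prop).
Inductive cong : seq T -> seq T -> Prop :=
| cong_rel u v : r u v -> cong u v
| cong_refl u : cong u u
| cong_sym u v : cong u v -> cong v u
| cong_trans u v w : cong u v -> cong v w -> cong u w
| cong_ctx a u v b : cong u v -> cong (a ++ u ++ b) (a ++ v ++ b).
End Congruence.

Record pres := Pres {
  pgen : finType;
  prel : seq pgen -> seq pgen -> Prop;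
  prel_size : forall u v, prel u v -> size u = size v }.

Definition cls (P : pres) (w : seq (pgen P)) : set (seq (pgen P)) :=
  cong (@prel P) w.

Definition mon (P : pres) := {A : set (seq (pgen P)) | exists w, A = cls w}.
HB.instance Definition _ P := gen_eqMixin (mon P).
HB.instance Definition _ P := gen_choiceMixin (mon P).

Section Mon.
Variable P : pres.
Definition mkM (w : seq (pgen P)) : mon P := exist _ (cls w) (ex_intro _ w erefl).
Definition rep (x : mon P) : seq (pgen P) := proj1_sig (cid (proj2_sig x)).
Definition eM : mon P := mkM [::].
Definition mulM (x y : mon P) : mon P := mkM (rep x ++ rep y).
Definition len (x : mon P) : nat := size (rep x).
Definition genM (s : pgen P) : mon P := mkM [:: s].
Definition ldiv (x y : mon P) : Prop := exists z, y = mulM x z.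
End Mon.
HB.instance Definition _ P := isPointed.Build (mon P) (eM P).

Section Garside.
Variable P : pres.
Local Notation M := (mon P).

Definition Delta : M :=
  xget (eM P) (fun d => (forall s, ldiv (genM s) d) /\
                        (forall d', (forall s, ldiv (genM s) d') -> ldiv d d')).
Definition simple (x : M) : Prop := ldiv x Delta.
Definition Rset (x : M) : set (pgen P) := [set s | ~ simple (mulM x (genM s))].
Definition Lset (x : M) : set (pgen P) := [set s | ldiv (genM s) x].
Definition arrow (x y : M) : Prop := Lset y `<=` Rset x.

Definition Xsp := prod_topology (fun _ : nat => discrete_topology M).
Definition Mbar_set : set Xsp :=
  [set xi | (forall k, simple (xi k)) /\ (forall k, arrow (xi k) (xi k.+1))].
End Garside.

Section PointProof.
Variable P : pres.

Lemma cong_size (u v : seq (pgen P)) : cong (@prel P) u v -> size u = size v.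
Proof.
elim=> {u v} [u v /prel_size //|//|u v _ -> //|u v w _ -> _ -> //|a u v b _ e].
by rewrite !size_cat e.
Qed.

Lemma mkM_rep (x : mon P) : mkM (rep x) = x.
Proof.
rewrite /rep; case: x => A hA /=; case: (cid hA) => w /= e.
rewrite /mkM; move: hA; rewrite e => hA; congr exist; exact: Prop_irrelevance.
Qed.

Lemma rep_cls (x : mon P) : proj1_sig x = cls (rep x).
Proof. by rewrite /rep; case: x => A hA /=; case: (cid hA). Qed.

Lemma rep_mkM_cong (w : seq (pgen P)) : cong (@prel P) (rep (mkM w)) w.
Proof.
have := rep_cls (mkM w); rewrite /= => e.
have : cls w w by exact: cong_refl.
by rewrite e.
Qed.

Lemma rep_eM : rep (eM P) = [::].
Proof. by apply/size0nil; rewrite (cong_size (rep_mkM_cong [::])). Qed.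

Lemma simple_eM : simple (eM P).
Proof. by exists (Delta P); rewrite /mulM rep_eM /= mkM_rep. Qed.

Lemma mulM_genM_neq (s : pgen P) z : eM P <> mulM (genM s) z.
Proof.
move=> e.
have h1 := rep_mkM_cong (rep (genM s) ++ rep z).
rewrite -/(mulM _ _) -e rep_eM in h1.
have h2 := rep_mkM_cong [:: s].
rewrite -/(genM s) in h2.
move: (cong_size h1) (cong_size h2); rewrite size_cat => /esym.
by case: (rep (genM s)) => //.
Qed.

Lemma arrow_eM : arrow (eM P) (eM P).
Proof. by move=> s [z /mulM_genM_neq]. Qed.

Lemma Mbar_set_e : @Mbar_set P (fun _ => eM P).
Proof. by split=> k; [exact: simple_eM | exact: arrow_eM]. Qed.
End PointProof.


Definition Mbar (P : pres) : Type := set_type (@Mbar_set P).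
HB.instance Definition _ P := Topological.on (Mbar P).
Definition ebar (P : pres) : Mbar P := @exist _ (fun x => x \in @Mbar_set P) _ (mem_set (Mbar_set_e P)).
HB.instance Definition _ P := isPointed.Build (Mbar P) (ebar P).

Definition Borel (P : pres) := g_sigma_algebraType (@open (Mbar P)).

Section NormalForm.
Variable P : pres.
Local Notation M := (mon P).
Definition prodM (s : seq M) : M := foldr (@mulM P) (eM P) s.

Definition is_nf (x : M) (xi : Xsp P) : Prop :=
  @Mbar_set P xi /\
  exists m, (forall k, (k < m)%N -> xi k <> eM P) /\
            (forall k, (m <= k)%N -> xi k = eM P) /\
            x = prodM (mkseq xi m).

(* the identification of M with a subset of \overline{M} *)
Definition nf (x : M) : Mbar P := xget (ebar P) (fun xi : Mbar P => is_nf x (val xi)).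

Definition boundary : set (Mbar P) := ~` range nf.
Definition Uparrow (x : M) : set (Mbar P) :=
  closure [set nf (mulM x z) | z in [set: M]].
Definition uparrow (x : M) : set (Mbar P) := Uparrow x `&` boundary.

Definition Mk (k : nat) : set M := [set x | len x = k].
End NormalForm.

Definition enum_fin (T : choiceType) (A : set T) : seq T :=
  xget [::] (fun s : seq T => uniq s /\ forall x, x \in s <-> A x).

Section Measures.
Variables (R : realType) (P : pres).
Local Open Scope ereal_scope.

Definition mu_k (k : nat) : probability (Borel P) R :=
  let s := enum_fin (@Mk P k) in
  mnormalize (msum (fun i => (@dirac _ (Borel P) (nf (nth (eM P) s i)) R : measure (Borel P) R)) (size s))
             (@dirac _ (Borel P) (ebar P) R).
End Measures.

Section Limit.
Variables (R : realType) (P : pres).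
Local Open Scope ring_scope.

Definition cardM (k : nat) : nat := size (enum_fin (@Mk P k)).

(* q_n : radius of convergence of G(t) = \sum_{x in M} t^{|x|} = \sum_k #M(k) t^k *)
Definition qn : R :=
  sup [set r : R | 0 <= r /\ cvgn (series (fun k => (cardM k)%:R * r ^+ k))].

Definition is_unif_infty (nu : probability (Borel P) R) : Prop :=
  forall x : mon P, nu (uparrow x) = (qn ^+ len x)%:E.

Definition weak_cvg (mu : nat -> probability (Borel P) R)
    (nu : probability (Borel P) R) : Prop :=
  forall f : Mbar P -> R, continuous f -> (exists C : R, forall xi, `|f xi| <= C) ->
    (fun k => (\int[mu k]_x (f x)%:E)%E) @ \oo --> (\int[nu]_x (f x)%:E)%E.
End Limit.

(* (a) the positive braid monoid B_n^+ : generator i : 'I_n.-1 stands for sigma_{i+1} *)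
Definition braid_rel (n : nat) (u v : seq 'I_n.-1) : Prop :=
  exists i j : 'I_n.-1,
    ((i.+1 < j)%N /\ u = [:: i; j] /\ v = [:: j; i]) \/
    ((j = i.+1 :> nat) /\ u = [:: i; j; i] /\ v = [:: j; i; j]).

Lemma braid_rel_size n u v : @braid_rel n u v -> size u = size v.
Proof. by case=> i [j [[_ [-> ->]]|[_ [-> ->]]]]. Qed.

Definition braid_pres (n : nat) : pres := Pres (@braid_rel_size n).

(* (b) the dual braid monoid B_n^{+*} : generator (i, j) with i < j stands for
   sigma_{i+1, j+1} *)
Definition dgen (n : nat) := {p : 'I_n * 'I_n | (p.1 < p.2)%N}.

Definition dual_rel (n : nat) (u v : seq (dgen n)) : Prop :=
  (exists a b c : dgen n,
     (* a = sigma_{i,j}, b = sigma_{j,k}, c = sigma_{i,k} = sigma_{k,i}, i<j<k *)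
     (val a).1 = (val c).1 /\ (val a).2 = (val b).1 /\ (val b).2 = (val c).2 /\
     ((u = [:: a; b] /\ v = [:: b; c]) \/ (u = [:: b; c] /\ v = [:: c; a]))) \/
  (exists a b : dgen n,
     ((((val a).1 < (val a).2)%N && ((val a).2 < (val b).1)%N && ((val b).1 < (val b).2)%N) \/
      (((val a).1 < (val b).1)%N && ((val b).1 < (val b).2)%N && ((val b).2 < (val a).2)%N)) /\
     u = [:: a; b] /\ v = [:: b; a]).

Lemma dual_rel_size n u v : @dual_rel n u v -> size u = size v.
Proof.
case=> [[a [b [c [_ [_ [_ [[-> ->]|[-> ->]]]]]]]]|[a [b [_ [-> ->]]]]] //.
Qed.

Definition dual_pres (n : nat) : pres := Pres (@dual_rel_size n).

(* Main.v *)
(* Both monoids are presented by a finite Garside germ: the interval [1, delta]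
   of the symmetric group for the prefix order of a length function, namely the
   number of inversions for B_n^+ and n minus the number of cycles for the dual
   monoid, where this interval consists of the noncrossing permutations. Garside
   normal forms, hence the arrows of the statement, are read off the germ.

   Let E_s(k) count the elements of length k whose first normal form factor is s.
   The vector E satisfies a nonnegative linear recurrence along the arrows.  The
   nontrivial simple elements other than delta form a strongly connected graph
   through an atom with a loop, so E(k+1)/E(k) converges to some rho (the ratio
   oscillation contracts), whence #M(k)/#M(k+1) -> 1/rho = q_n and
   mu_{n,k}(Uparrow x) = #M(k-|x|)/#M(k) -> q_n^|x|.

   The clopen sets Uparrow x determine all cylinders by triangular inversion, so
   mu_{n,k} converges on cylinders. The limit is countably additive by compactness,
   which yields the uniform measure; continuous functions are uniform limits of
   cylinder functions, which yields weak convergence. *)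
Require Import Defs.
From HB Require Import structures.
From mathcomp Require Import all_boot all_order all_algebra all_fingroup.
From mathcomp Require Import all_classical all_reals all_analysis.
From mathcomp Require Import zify ring lra.

Set Implicit Arguments.
Unset Strict Implicit.
Unset Printing Implicit Defensive.


(** * Garside germs and the monoids they present *)

(** Nothing about the presented monoids is taken for granted: cancellation, divisibility by simple
    elements and normal forms all come from one greedy action of words on the germ, which splits a
    word into its largest simple prefix and a remainder. What is specific to each family is mainly
    the join of two atoms and strong connectivity. [δ] is kept out of the graph because only [δ]
    itself can precede it. The recurrence has delays, namely the length of the first factor, so
    positivity is propagated from windows of length |[δ]|, and a loop of weight one plays the part
    of primitivity of a matrix. When n = 2, [δ] is an atom, the graph is empty, and this case is
    treated apart. The uniform measure is specified on the sets [uparrow x], which are not clopen;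
    passing to the clopen [Uparrow x] requires that M be a null set. *)

Section PresentedMonoid.
Variable P : pres.
Local Notation M := (mon P).
Local Notation cg := (cong (@prel P)).
Implicit Types (u v w : seq (pgen P)) (x y z : M).

Lemma mkM_eq u v : mkM u = mkM v <-> cg u v.
Proof.
split=> [e|h].
  have h1 := rep_mkM_cong u; have h2 := rep_mkM_cong v.
  by rewrite -e in h2; apply: cong_trans h2; apply: cong_sym.
have e : cls u = cls v.
  rewrite /cls; apply/funext => w; apply/propext; split => hw.
    by apply: cong_trans hw; apply: cong_sym.
  exact: cong_trans hw.
rewrite /mkM; move: (ex_intro _ u _) (ex_intro _ v _); rewrite e => p q.
congr exist; exact: Prop_irrelevance.
Qed.

Lemma cong_cat u u' v v' : cg u u' -> cg v v' -> cg (u ++ v) (u' ++ v').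
Proof.
move=> h1 h2; apply: (cong_trans (v := u' ++ v)).
  by have := cong_ctx [::] v h1.
by have := cong_ctx u' [::] h2; rewrite !cats0.
Qed.

Lemma mulM_mkM u v : mulM (mkM u) (mkM v) = mkM (u ++ v).
Proof. by apply/mkM_eq; apply: cong_cat; apply: rep_mkM_cong. Qed.

Lemma mulMA : associative (@mulM P).
Proof.
move=> x y z; rewrite -(mkM_rep x) -(mkM_rep y) -(mkM_rep z).
by rewrite !mulM_mkM catA.
Qed.

Lemma mul1M : left_id (eM P) (@mulM P).
Proof. by move=> x; rewrite -(mkM_rep x) /eM mulM_mkM. Qed.

Lemma mulM1 : right_id (eM P) (@mulM P).
Proof. by move=> x; rewrite -(mkM_rep x) /eM mulM_mkM cats0. Qed.

Lemma mkM_cons s w : mkM (s :: w) = mulM (genM s) (mkM w).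
Proof. by rewrite /genM mulM_mkM. Qed.

Lemma len_mkM w : len (mkM w) = size w.
Proof. by rewrite /len; apply: cong_size; apply: rep_mkM_cong. Qed.

Lemma len_mulM x y : len (mulM x y) = (len x + len y)%N.
Proof. by rewrite -(mkM_rep x) -(mkM_rep y) mulM_mkM !len_mkM size_cat. Qed.

Lemma len_eM : len (eM P) = 0%N.
Proof. by rewrite /eM len_mkM. Qed.

Lemma len_eq0 x : len x = 0%N -> x = eM P.
Proof. by move=> /size0nil h; rewrite -(mkM_rep x) h. Qed.

Lemma ldiv_refl x : ldiv x x.
Proof. by exists (eM P); rewrite mulM1. Qed.

Lemma ldiv_trans x y z : ldiv x y -> ldiv y z -> ldiv x z.
Proof. by move=> [u ->] [v ->]; exists (mulM u v); rewrite mulMA. Qed.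

Lemma ldiv_mulr x y : ldiv x (mulM x y).
Proof. by exists y. Qed.

Lemma ldiv_mul2l z x y : ldiv x y -> ldiv (mulM z x) (mulM z y).
Proof. by move=> [u ->]; exists u; rewrite mulMA. Qed.

Lemma ldiv_len x y : ldiv x y -> (len x <= len y)%N.
Proof. by move=> [u ->]; rewrite len_mulM leq_addr. Qed.

Lemma ldiv_eq x y : ldiv x y -> len x = len y -> x = y.
Proof.
move=> [u ->]; rewrite len_mulM => h; suff -> : u = eM P by rewrite mulM1.
by apply: len_eq0; lia.
Qed.

Lemma ldiv_anti x y : ldiv x y -> ldiv y x -> x = y.
Proof.
move=> h1 h2; apply: ldiv_eq (h1) _.
by apply/eqP; rewrite eqn_leq !ldiv_len.
Qed.

End PresentedMonoid.

Section GermDefs.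
Variables (gT : finGroupType) (T : Type) (a : T -> gT) (l : gT -> nat).
Local Open Scope group_scope.

Definition gle (x y : gT) : bool := (l x + l (x^-1 * y) == l y)%N.
Definition gprod (w : seq T) : gT := foldr (fun s x => a s * x) 1 w.
Definition reduced (x : gT) (w : seq T) : Prop := gprod w = x /\ l x = size w.

Lemma gprod_cat u v : gprod (u ++ v) = gprod u * gprod v.
Proof. by elim: u => [|s u IH] /=; rewrite ?mul1g // IH mulgA. Qed.

Hypothesis lM : forall x y, (l (x * y) <= l x + l y)%N.

Lemma gle_mulV_gen x p z : gle x z -> gle p (x^-1 * z) ->
  l (x * p) = (l x + l p)%N /\ gle (x * p) z.
Proof.
move=> /eqP h1 /eqP h2.
have e : x * p * (p^-1 * (x^-1 * z)) = z by rewrite -mulgA !mulKVg.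
have h3 := lM x p; have h4 := lM (x * p) (p^-1 * (x^-1 * z)); rewrite e in h4.
have e' : (x * p)^-1 * z = p^-1 * (x^-1 * z) by rewrite invMg mulgA.
by rewrite /gle e'; split; [|apply/eqP]; lia.
Qed.

Lemma gle_sub_gen x y z : gle x y -> gle y z ->
  gle (x^-1 * y) (x^-1 * z) /\ gle x z.
Proof.
move=> /eqP h1 /eqP h2.
have e1 : (x^-1 * y)^-1 * (x^-1 * z) = y^-1 * z by rewrite invMg invgK -mulgA mulKVg.
have e2 : x^-1 * y * (y^-1 * z) = x^-1 * z by rewrite -mulgA mulKVg.
have h3 := lM (x^-1 * y) (y^-1 * z); rewrite e2 in h3.
have h4 := lM x (x^-1 * z); rewrite mulKVg in h4.
have e : (l z = l x + l (x^-1 * z))%N by lia.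
by split; rewrite /gle ?e1; apply/eqP; lia.
Qed.

Hypothesis l1 : l 1 = 0%N.
Hypothesis la : forall r, l (a r) = 1%N.

(** Stripping letters one by one from the left of [y] certifies at once that [w] is reduced and that
    its product lies below [y]. Germ axioms can then be checked by divisibility by atoms alone. *)
Fixpoint gchain (y : gT) (w : seq T) : bool :=
  if w is r :: w' then gle (a r) y && gchain ((a r)^-1 * y) w' else true.

Lemma gchainP y w : gchain y w -> reduced (gprod w) w /\ gle (gprod w) y.
Proof.
elim: w y => [|r w IH] y /=; first by rewrite /gle invg1 mul1g l1.
move=> /andP [ry /IH [[_ e] h]]; have [h1 h2] := gle_mulV_gen ry h.
by split=> //; split=> //=; rewrite h1 la e.
Qed.

End GermDefs.

(* A Garside germ: the interval [1, delta] of a group for the prefix order of a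
   length function, from which the presented monoid is recovered. *)
Record germ (P : pres) := Germ {
  ggT : finGroupType;
  gat : pgen P -> ggT;
  glen : ggT -> nat;
  gdel : ggT;
  glen1 : glen 1%g = 0%N;
  glen_eq0 : forall x, glen x = 0%N -> x = 1%g;
  glenM : forall x y, (glen (x * y)%g <= glen x + glen y)%N;
  glen_at : forall s, glen (gat s) = 1%N;
  gat_del : forall s, gle glen (gat s) gdel;
  g_atom : forall x, gle glen x gdel -> x <> 1%g -> exists s, gle glen (gat s) x;
  g_right : forall x y, gle glen x y -> gle glen y gdel -> gle glen (x^-1 * y)%g gdel;
  g_rel : forall u v, prel u v -> exists x,
    [/\ gle glen x gdel, reduced gat glen x u & reduced gat glen x v];
  g_join : forall s t, s <> t -> exists u v x,
    [/\ gle glen x gdel, reduced gat glen x (s :: u), reduced gat glen x (t :: v),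
        cong (@prel P) (s :: u) (t :: v) &
        forall y, gle glen y gdel -> gle glen (gat s) y -> gle glen (gat t) y ->
          gle glen x y];
  g_del : forall x, gle glen x gdel -> (forall s, gle glen (gat s) x) -> x = gdel
}.

(** * Lattice structure of a germ and its greedy action *)

Section GermTheory.
Variables (P : pres) (G : germ P).
Local Open Scope group_scope.
Local Notation gT := (ggT G).
Local Notation a := (@gat P G).
Local Notation l := (@glen P G).
Local Notation δ := (@gdel P G).
Local Notation cg := (cong (@prel P)).
Local Notation "x ⊑ y" := (gle l x y) (at level 70).
Local Notation S x := (x ⊑ δ).
Implicit Types (x y z : gT) (r : pgen P).

Lemma glenK x y : (l y <= l x + l (x^-1 * y))%N.
Proof. by rewrite -{1}(mulKVg x y); apply: glenM. Qed.

Lemma glenKK x p z : (l (x^-1 * z) <= l p + l ((x * p)^-1 * z))%N.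
Proof.
have e : x^-1 * z = p * ((x * p)^-1 * z) by rewrite invMg -!mulgA mulKVg.
by rewrite {1}e; apply: glenM.
Qed.

Lemma gleP x y : reflect (l y = l x + l (x^-1 * y))%N (x ⊑ y).
Proof. by rewrite /gle eq_sym; exact: eqP. Qed.

Lemma gle_mull x p : (x ⊑ x * p) = (l (x * p) == l x + l p)%N.
Proof. by rewrite /gle mulKg eq_sym. Qed.

Lemma gle1 x : 1 ⊑ x.
Proof. by apply/gleP; rewrite invg1 mul1g glen1. Qed.

Lemma gle_refl x : x ⊑ x.
Proof. by apply/gleP; rewrite mulVg glen1 addn0. Qed.

Lemma gle_trans y x z : x ⊑ y -> y ⊑ z -> x ⊑ z.
Proof. by move=> h1 h2; have [] := gle_sub_gen (@glenM P G) h1 h2. Qed.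

Lemma gle_anti x y : x ⊑ y -> y ⊑ x -> x = y.
Proof.
move=> /gleP h1 /gleP h2.
have /glen_eq0 e : l (x^-1 * y) = 0%N by lia.
by apply/esym; rewrite -(mulKVg x y) e mulg1.
Qed.

Lemma gle_len x y : x ⊑ y -> (l x <= l y)%N.
Proof. by move=> /gleP ->; apply: leq_addr. Qed.

Lemma gle_len_eq x y : x ⊑ y -> (l y <= l x)%N -> x = y.
Proof.
move=> /gleP h1 h2; have /glen_eq0 e : l (x^-1 * y) = 0%N by lia.
by apply/esym; rewrite -(mulKVg x y) e mulg1.
Qed.

Lemma gle_x1 x : x ⊑ 1 -> x = 1.
Proof. by move=> h; apply: gle_anti h (gle1 x). Qed.

Lemma gle_mul2l x p z : x ⊑ x * p -> x * p ⊑ z -> p ⊑ x^-1 * z.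
Proof.
rewrite gle_mull => /eqP h1 /gleP h2; apply/gleP.
have e : (x * p)^-1 * z = p^-1 * (x^-1 * z) by rewrite invMg mulgA.
by have := glenK x z; have := glenKK x p z; move: h2; rewrite h1 e; lia.
Qed.

Lemma gle_mulV x p z : x ⊑ z -> p ⊑ x^-1 * z -> x ⊑ x * p /\ x * p ⊑ z.
Proof.
move=> h1 h2; rewrite gle_mull.
by have [-> ->] := gle_mulV_gen (@glenM P G) h1 h2.
Qed.

Lemma gle_sub x y z : x ⊑ y -> y ⊑ z -> x^-1 * y ⊑ x^-1 * z.
Proof. by move=> h1 h2; have [] := gle_sub_gen (@glenM P G) h1 h2. Qed.

Lemma gle_mulmono x p q z : x ⊑ z -> p ⊑ q -> q ⊑ x^-1 * z -> x * p ⊑ x * q.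
Proof.
move=> h1 h2 h3; have [h4 h5] := gle_mulV h1 h3.
have := gle_mulV (x := x) (p := p) (z := x * q) h4.
by rewrite mulKg => /(_ h2) [].
Qed.

Lemma S1 : S 1. Proof. exact: gle1. Qed.
Lemma Sd : S δ. Proof. exact: gle_refl. Qed.
Lemma S_left x y : x ⊑ y -> S y -> S x. Proof. exact: gle_trans. Qed.
Lemma S_right x y : x ⊑ y -> S y -> S (x^-1 * y). Proof. exact: g_right. Qed.

Lemma gat_len r : l (a r) = 1%N. Proof. exact: glen_at. Qed.

Lemma gle_at_len r x : a r ⊑ x -> l x = (l ((a r)^-1 * x)).+1.
Proof. by move=> /gleP ->; rewrite gat_len. Qed.

Lemma gat_neq1 r : a r != 1.
Proof. by apply/eqP => e; have := gat_len r; rewrite e glen1. Qed.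

(** Induction on the length of a common upper bound [u]. Atoms [s] below [x] and [t] below [y] have
    a join [J]; dividing [u] by [s], by [t] and by [J] shortens it, which yields [A] from [x] and
    [J], [B] from [y] and [J], then the join of [A] and [B]. The bound [u] only serves existence:
    the result is least among all simple upper bounds. *)
Lemma join_ex x y u : S u -> x ⊑ u -> y ⊑ u ->
  exists2 j, x ⊑ j /\ y ⊑ j & forall v, S v -> x ⊑ v -> y ⊑ v -> j ⊑ v.
Proof.
have [n] := ubnP (l u); elim: n x y u => // n IH x y u hn Su xu yu.
have [x1|/eqP x1] := eqVneq x 1.
  by exists y => //; rewrite x1 gle1 gle_refl.
have [y1|/eqP y1] := eqVneq y 1.
  by exists x => //; rewrite y1 gle1 gle_refl.
have Sx := S_left xu Su; have Sy := S_left yu Su.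
have [s sx] := g_atom Sx x1; have [t ty] := g_atom Sy y1.
have [J [SJ [sJ tJ] Jlub]] : exists J, [/\ S J, a s ⊑ J /\ a t ⊑ J &
    forall v, S v -> a s ⊑ v -> a t ⊑ v -> J ⊑ v].
  have [<-|st] := pselect (s = t).
    by exists (a s); split=> //; [exact: gat_del|rewrite !gle_refl].
  have [w1 [w2 [J [SJ [e1 l1] [e2 l2] _ Jlub]]]] := g_join G st.
  exists J; split=> //.
  have h w r : gprod a (r :: w) = J -> l J = size (r :: w) -> a r ⊑ J.
    move=> /= <- h; rewrite gle_mull h gat_len add1n.
    have := glenM (a r) (gprod a w); rewrite h gat_len add1n ltnS.
    have le : (l (gprod a w) <= size w)%N.
      elim: w {h} => [|q w IHw] /=; first by rewrite glen1.
      by have := glenM (a q) (gprod a w); rewrite gat_len; lia.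
    by move=> ge; rewrite eqSS eqn_leq ge le.
  by split; [exact: h e1 l1|exact: h e2 l2].
have su := gle_trans sx xu; have tu := gle_trans ty yu.
have Ju := Jlub _ Su su tu.
have lift r z : a r ⊑ J -> a r ⊑ z -> z ⊑ u -> exists A, [/\ z ⊑ A, J ⊑ A, A ⊑ u &
    forall v, S v -> z ⊑ v -> J ⊑ v -> A ⊑ v] .
  move=> rJ rz zu; have ru := gle_trans rz zu.
  have [| | | |A [h1 h2] h3] := IH ((a r)^-1 * z) ((a r)^-1 * J) ((a r)^-1 * u).
  - by move: hn; rewrite (gle_at_len ru).
  - exact: S_right.
  - exact: gle_sub.
  - exact: gle_sub.
  have Au : A ⊑ (a r)^-1 * u by apply: h3; [exact: S_right|exact: gle_sub|exact: gle_sub].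
  exists (a r * A); split.
  - by rewrite -{1}(mulKVg (a r) z); apply: gle_mulmono ru h1 Au.
  - by rewrite -{1}(mulKVg (a r) J); apply: gle_mulmono ru h2 Au.
  - by have [] := gle_mulV ru Au.
  move=> v Sv zv Jv; have rv := gle_trans rz zv.
  have [] // := @gle_mulV (a r) A v rv.
  by apply: h3; [exact: S_right|exact: gle_sub|exact: gle_sub].
have [A [xA JA Au Alub]] := lift s x sJ sx xu.
have [B [yB JB Bu Blub]] := lift t y tJ ty yu.
have J0 : (0 < l J)%N by rewrite (gle_at_len sJ).
have [| | | |C [h1 h2] h3] := IH (J^-1 * A) (J^-1 * B) (J^-1 * u).
- by move/gleP: (Ju) => eu; clear -hn eu J0; lia.
- exact: S_right.
- exact: gle_sub.
- exact: gle_sub.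
have Cu : C ⊑ J^-1 * u by apply: h3; [exact: S_right|exact: gle_sub|exact: gle_sub].
exists (J * C).
  split.
    by apply: gle_trans xA _; rewrite -(mulKVg J A); apply: gle_mulmono Ju h1 Cu.
  by apply: gle_trans yB _; rewrite -(mulKVg J B); apply: gle_mulmono Ju h2 Cu.
move=> v Sv xv yv.
have Jv := Jlub v Sv (gle_trans sx xv) (gle_trans ty yv).
have [] // := @gle_mulV J C v Jv.
by apply: h3; [exact: S_right|apply: gle_sub => //; exact: Alub|apply: gle_sub => //; exact: Blub].
Qed.

Definition meet x y : gT := odflt 1 [pick m | [&& m ⊑ x, m ⊑ y &
  [forall p, (p ⊑ x) && (p ⊑ y) ==> (p ⊑ m)]]].

(** A common lower bound [m] of maximal length is the greatest one: its join with any other lower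
    bound is again a lower bound, hence not longer than [m]. *)
Lemma meetP x y : S x -> S y -> [/\ meet x y ⊑ x, meet x y ⊑ y &
  forall p, p ⊑ x -> p ⊑ y -> p ⊑ meet x y].
Proof.
move=> Sx Sy; rewrite /meet; case: pickP => /= [m /and3P [h1 h2 /forallP h3]|no].
  by split=> // p px py; have := h3 p; rewrite px py.
exfalso.
pose Q m := (m ⊑ x) && (m ⊑ y).
have Q1 : Q 1 by rewrite /Q !gle1.
case: (arg_maxnP l Q1) => m /andP [mx my] mmax.
move: (no m); rewrite mx my /= => /forallP; apply => p; apply/implyP => /andP [px py].
have [j [h1 h2] h3] := join_ex Sx mx px.
have jx := h3 _ Sx mx px; have jy := h3 _ Sy my py.
suff -> : m = j by [].
by apply: gle_len_eq => //; apply: mmax; rewrite /Q jx.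
Qed.

(** The right complement of [x] in [δ]: its prefixes are the [p] such that [x * p] is simple with
    additive length. Thus [al2 s u] is the largest simple prefix of the formal product of [s] and
    [u], and [om2 s u] is what remains of [u]. *)
Definition dl x : gT := x^-1 * δ.
Definition al2 (s u : gT) : gT := s * meet u (dl s).
Definition om2 (s u : gT) : gT := (meet u (dl s))^-1 * u.

Lemma S_dl x : S x -> S (dl x). Proof. by move=> h; apply: S_right h Sd. Qed.

Lemma dlP x p : S x -> p ⊑ dl x -> x ⊑ x * p /\ S (x * p).
Proof. exact: gle_mulV. Qed.

Lemma le_dl x p : x ⊑ x * p -> S (x * p) -> p ⊑ dl x.
Proof. exact: gle_mul2l. Qed.

Lemma al2_S (s u : gT) : S s -> S u -> S (al2 s u) /\ s ⊑ al2 s u.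
Proof.
move=> Ss Su; have [_ h _] := meetP Su (S_dl Ss).
by have [] := dlP Ss h.
Qed.

Lemma om2_S (s u : gT) : S s -> S u -> S (om2 s u).
Proof.
by move=> Ss Su; have [h _ _] := meetP Su (S_dl Ss); apply: S_right.
Qed.

Lemma meet1 x : S x -> meet 1 x = 1.
Proof. by move=> Sx; have [/gle_x1 -> _ _] := meetP S1 Sx. Qed.

Lemma al21 (s : gT) : S s -> al2 s 1 = s.
Proof. by move=> Ss; rewrite /al2 meet1 ?mulg1 //; apply: S_dl. Qed.

(* Associativity of the greedy action of simple elements. *)
Lemma meet_assoc (s t u : gT) : S s -> t ⊑ dl s -> S u ->
  meet (al2 t u) (dl s) = t * meet u (dl (s * t)) /\
  meet u (dl (s * t)) ⊑ meet u (dl t).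
Proof.
move=> Ss ts Su.
have St : S t by apply: S_left ts (S_dl Ss).
have [st Sst] := dlP Ss ts.
have dst : dl (s * t) = t^-1 * dl s by rewrite /dl invMg mulgA.
have [h1 h2 h3] := meetP Su (S_dl Sst).
have [k1 k2 k3] := meetP Su (S_dl St).
have [Sa ta] := al2_S St Su.
have [r1 r2 r3] := meetP Sa (S_dl Ss).
set p := meet u (dl (s * t)) in h1 h2 h3 *; set p' := meet u (dl t) in k1 k2 k3 *.
set r := meet _ _ in r1 r2 r3 *.
have [tp tps] : t ⊑ t * p /\ t * p ⊑ dl s by apply: gle_mulV => //; rewrite -dst.
have pt : p ⊑ dl t by apply: le_dl => //; apply: S_left tps (S_dl Ss).
have pp' : p ⊑ p' by apply: k3.
split=> //; apply: gle_anti; last first.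
  by apply: r3 => //; apply: gle_mulmono St pp' k2.
have tr : t ⊑ r by apply: r3.
have rp' : t^-1 * r ⊑ p'.
  by have := gle_sub tr r1; rewrite /al2 mulKg.
rewrite -(mulKVg t r); apply: gle_mulmono ts _ _; last by rewrite -dst.
apply: h3; first exact: gle_trans rp' k1.
by rewrite dst; apply: gle_sub.
Qed.

Lemma al2A (s t u : gT) : S s -> t ⊑ dl s -> S u -> al2 s (al2 t u) = al2 (s * t) u.
Proof. by move=> Ss ts Su; rewrite /al2 (meet_assoc Ss ts Su).1 mulgA. Qed.

(** What [u] loses to [s * t] it loses first to [t] and then to [s]; the two remainders compose
    without loss of length, so the product is also valid in the monoid. *)
Lemma om2A (s t u : gT) : S s -> t ⊑ dl s -> S u ->
  [/\ om2 s (al2 t u) * om2 t u = om2 (s * t) u,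
      om2 s (al2 t u) ⊑ om2 (s * t) u & S (om2 (s * t) u)].
Proof.
move=> Ss ts Su; have [e h] := meet_assoc Ss ts Su.
have St : S t by apply: S_left ts (S_dl Ss).
have [st Sst] := dlP Ss ts.
rewrite /om2 e /al2 invMg -!mulgA !mulKg.
have [h1 h2 h3] := meetP Su (S_dl Sst).
have [k1 k2 k3] := meetP Su (S_dl St).
split; first by rewrite !mulKVg.
  exact: gle_sub.
exact: S_right.
Qed.

Lemma reduced_cons r w x : reduced a l x (r :: w) ->
  a r ⊑ x /\ reduced a l ((a r)^-1 * x) w.
Proof.
move=> [/= e lx].
have le : (l (gprod a w) <= size w)%N.
  elim: w {e lx} => [|q w IHw] /=; first by rewrite glen1.
  by have := glenM (a q) (gprod a w); rewrite gat_len; lia.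
have := glenM (a r) (gprod a w); rewrite e gat_len => h.
have e' : (a r)^-1 * x = gprod a w by rewrite -e mulKg.
have lw : l (gprod a w) = size w by lia.
by split; [apply/gleP; rewrite e' gat_len lw lx | split; rewrite e'].
Qed.

Lemma reduced_consV r w x : a r ⊑ x -> reduced a l ((a r)^-1 * x) w ->
  reduced a l x (r :: w).
Proof.
move=> rx [e lx]; split; first by rewrite /= e mulKVg.
by rewrite (gle_at_len rx) lx.
Qed.

Lemma reduced_cat x y u v : reduced a l x u -> reduced a l y v -> x ⊑ x * y ->
  reduced a l (x * y) (u ++ v).
Proof.
move=> [e1 l1] [e2 l2]; rewrite gle_mull => /eqP h.
by split; rewrite ?gprod_cat ?e1 ?e2 // h l1 l2 size_cat.
Qed.

Lemma reduced_ex x : S x -> exists w, reduced a l x w.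
Proof.
have [n] := ubnP (l x); elim: n x => // n IH x hn Sx.
have [->|/eqP x1] := eqVneq x 1; first by exists [::]; split; rewrite ?glen1.
have [s sx] := g_atom Sx x1.
have [|w rw] := IH ((a s)^-1 * x) _ (S_right sx Sx).
  by move: hn; rewrite (gle_at_len sx).
by exists (s :: w); apply: reduced_consV.
Qed.

Lemma cong_cons r u v : cg u v -> cg (r :: u) (r :: v).
Proof. by move=> h; apply: (@cong_cat P [:: r] [:: r]) => //; apply: cong_refl. Qed.

(* Matsumoto's property. *)
Lemma reduced_cong x w w' : S x -> reduced a l x w -> reduced a l x w' -> cg w w'.
Proof.
have [n] := ubnP (size w); elim: n x w w' => // n IH x [|s w] [|t w'] /= hn Sx.
- by move=> _ _; apply: cong_refl.
- by move=> [_ e1] [_ e2]; move: e1 e2 => /= ->.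
- by move=> [_ e1] [_ e2]; move: e1 e2 => /= ->.
move=> r1 r2; have [sx s1] := reduced_cons r1; have [tx t1] := reduced_cons r2.
have [st|st] := pselect (s = t).
  rewrite -st in t1 *; apply: cong_cons; apply: IH s1 t1 => //; exact: S_right.
have [u [v [J [SJ ru rv uv Jlub]]]] := g_join G st.
have Jx := Jlub x Sx sx tx.
(* [z] spells what [x] has above [J]. Completed by [z], the two words of [J] start with [s] and [t],
   so the induction hypothesis links them to the given words. *)
have [z rz] := reduced_ex (S_right Jx Sx).
have Ju : reduced a l x ((s :: u) ++ z).
  by rewrite -(mulKVg J x); apply: reduced_cat => //; rewrite mulKVg.
have Jv : reduced a l x ((t :: v) ++ z).
  by rewrite -(mulKVg J x); apply: reduced_cat => //; rewrite mulKVg.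
have ssz : size w = size w' by have [_ q1] := r1; have [_ q2] := r2; move: q1; rewrite q2 => -[].
apply: (cong_trans (v := (s :: u) ++ z)).
  apply: cong_cons; apply: (IH ((a s)^-1 * x)) => //; first exact: S_right.
  by case: (reduced_cons Ju).
apply: (cong_trans (v := (t :: v) ++ z)).
  by apply: cong_cat => //; apply: cong_refl.
apply: cong_sym; apply: cong_cons; apply: (IH ((a t)^-1 * x)) => //; first lia.
  exact: S_right.
by case: (reduced_cons Jv).
Qed.

End GermTheory.

(** * Simple elements, greedy head and cancellation in the presented monoid *)

Section GarsideMonoid.
Variables (P : pres) (G : germ P).
Local Open Scope group_scope.
Local Notation gT := (ggT G).
Local Notation a := (@gat P G).
Local Notation l := (@glen P G).
Local Notation δ := (@gdel P G).
Local Notation M := (mon P).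
Local Notation cg := (cong (@prel P)).
Local Notation "x ⊑ y" := (gle l x y) (at level 70).
Local Notation S x := (x ⊑ δ).
Local Notation "x ∘ y" := (mulM x y) (at level 40, left associativity).
Local Notation red := (reduced a l).
Implicit Types (r : pgen P).

Lemma S_at r : S (a r). Proof. exact: gat_del. Qed.

Definition simp (s : gT) : M := mkM (xget [::] [set w | red s w]).

Lemma simpE s w : S s -> red s w -> simp s = mkM w.
Proof.
move=> Ss rw; apply/mkM_eq; apply: reduced_cong (Ss) _ (rw).
exact: (@xgetI _ [::] [set w | red s w] w).
Qed.

Lemma simpM s t : s ⊑ s * t -> S s -> S t -> S (s * t) ->
  simp (s * t) = simp s ∘ simp t.
Proof.
move=> h Ss St Sst; have [u ru] := reduced_ex Ss; have [v rv] := reduced_ex St.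
by rewrite (simpE Ss ru) (simpE St rv) mulM_mkM; apply: simpE => //; apply: reduced_cat.
Qed.

Lemma simp_split s t : s ⊑ t -> S t -> simp t = simp s ∘ simp (s^-1 * t).
Proof.
move=> st St; rewrite -simpM ?mulKVg //; [exact: S_left st St|exact: S_right].
Qed.

Lemma simp1 : simp 1 = eM P.
Proof. by apply: simpE; [exact: S1|split; rewrite ?glen1]. Qed.

Lemma red_at r : red (a r) [:: r].
Proof. by split; rewrite /= ?mulg1 ?gat_len. Qed.

Lemma simp_at r : simp (a r) = genM r.
Proof. by apply: simpE (S_at r) (red_at r). Qed.

Lemma len_simp s : S s -> len (simp s) = l s.
Proof.
by move=> Ss; have [w rw] := reduced_ex Ss; rewrite (simpE Ss rw) len_mkM; case: rw.
Qed.

(** Reading a word from the right, [alw] keeps the greedy head while [omw] collects what overflows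
    from it. They are defined on words and descend to the monoid by [cong_cat_inv]. *)
Definition alw (w : seq (pgen P)) : gT := foldr (fun r u => al2 (a r) u) 1 w.
Fixpoint omw (w : seq (pgen P)) : M :=
  if w is r :: w' then simp (om2 (a r) (alw w')) ∘ omw w' else eM P.

Lemma alw_S w : S (alw w).
Proof.
elim: w => [|r w IH] /=; first exact: S1.
by have [] := al2_S (S_at r) IH.
Qed.

(** By associativity of the greedy action, a reduced word acts as the single simple element that it
    spells. *)
Lemma alw_red s u v : S s -> red s u -> alw (u ++ v) = al2 s (alw v).
Proof.
elim: u s => [|r u IH] s Ss.
  move=> [/= <- _]; rewrite /al2 mul1g /=.
  have [h _ k] := meetP (alw_S v) (S_dl (@S1 _ G)).
  apply: gle_anti h; apply: k; first exact: gle_refl.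
  by rewrite /dl invg1 mul1g alw_S.
move=> rs; have [rx ru] := reduced_cons rs.
have Sx := S_right rx Ss.
rewrite /= (IH _ Sx ru) al2A ?S_at ?alw_S ?mulKVg //.
exact: gle_sub.
Qed.

Lemma omw_red s u v : S s -> red s u ->
  omw (u ++ v) = simp (om2 s (alw v)) ∘ omw v.
Proof.
elim: u s => [|r u IH] s Ss.
  move=> [/= <- _]; rewrite /om2.
  have [h _ k] := meetP (alw_S v) (S_dl (@S1 _ G)).
  have -> : meet (alw v) (dl 1) = alw v.
    apply: gle_anti h _; apply: k; first exact: gle_refl.
    by rewrite /dl invg1 mul1g alw_S.
  by rewrite mulVg simp1 mul1M.
move=> rs; have [rx ru] := reduced_cons rs.
have Sx := S_right rx Ss.
have h : (a r)^-1 * s ⊑ dl (a r) by apply: gle_sub.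
rewrite /= (IH _ Sx ru) (alw_red _ Sx ru) mulMA; congr (_ ∘ _).
have [e1 e2 e3] := om2A (S_at r) h (alw_S v).
rewrite mulKVg in e1 e2 e3.
by rewrite (simp_split e2 e3) -e1 mulKg.
Qed.

(** The two sides of a relation are reduced words of one simple element, so they act alike. The
    suffix [b] must vary in the induction because a word acts on whatever stands to its right. *)
Lemma cong_cat_inv u v b : cg u v -> alw (u ++ b) = alw (v ++ b) /\
  omw (u ++ b) = omw (v ++ b).
Proof.
move=> h; elim: h b => {u v} [u v /(g_rel G) [x [Sx ru rv]] b||u v _ IH b||p u v q _ IH b].
- by rewrite (alw_red _ Sx ru) (alw_red _ Sx rv) (omw_red _ Sx ru) (omw_red _ Sx rv).
- by [].
- by have [-> ->] := IH b.
- by move=> u v w _ IH1 _ IH2 b; have [-> ->] := IH1 b.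
rewrite -!catA; have [e1 e2] := IH (q ++ b).
elim: p => [|r p [IH1 IH2]] //=.
by rewrite IH1 IH2.
Qed.

Lemma cong_gprod u v : cg u v -> gprod a u = gprod a v.
Proof.
elim=> {u v} [u v /(g_rel G) [x [_ [-> _] [-> _]]]||u v _ ->|u v w _ -> _ ->|p u v q _ IH] //.
by rewrite !gprod_cat IH.
Qed.

Definition al (x : M) : gT := alw (rep x).
Definition om (x : M) : M := omw (rep x).
Definition gval (x : M) : gT := gprod a (rep x).

Lemma al_mkM w : al (mkM w) = alw w.
Proof. by have [] := cong_cat_inv [::] (rep_mkM_cong w); rewrite !cats0. Qed.

Lemma om_mkM w : om (mkM w) = omw w.
Proof. by have [] := cong_cat_inv [::] (rep_mkM_cong w); rewrite !cats0. Qed.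

Lemma gval_mkM w : gval (mkM w) = gprod a w.
Proof. exact: cong_gprod (rep_mkM_cong w). Qed.

Lemma gvalM x y : gval (x ∘ y) = gval x * gval y.
Proof. by rewrite -(mkM_rep x) -(mkM_rep y) mulM_mkM !gval_mkM gprod_cat. Qed.

Lemma gval_simp s : S s -> gval (simp s) = s.
Proof.
by move=> Ss; have [w rw] := reduced_ex Ss; rewrite (simpE Ss rw) gval_mkM; case: rw.
Qed.

Lemma simp_inj s t : S s -> S t -> simp s = simp t -> s = t.
Proof. by move=> Ss St e; rewrite -(gval_simp Ss) -(gval_simp St) e. Qed.

Lemma gval_len x : (l (gval x) <= len x)%N.
Proof.
rewrite -(mkM_rep x) gval_mkM len_mkM; elim: (rep x) => [|r w IH] /=.
  by rewrite glen1.
by have := glenM (a r) (gprod a w); rewrite gat_len; lia.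
Qed.

Lemma al_S x : S (al x). Proof. exact: alw_S. Qed.

Lemma al_simpM s x : S s -> al (simp s ∘ x) = al2 s (al x).
Proof.
move=> Ss; have [w rw] := reduced_ex Ss.
by rewrite (simpE Ss rw) -{1}(mkM_rep x) mulM_mkM al_mkM (alw_red _ Ss rw).
Qed.

Lemma om_simpM s x : S s -> om (simp s ∘ x) = simp (om2 s (al x)) ∘ om x.
Proof.
move=> Ss; have [w rw] := reduced_ex Ss.
by rewrite (simpE Ss rw) -{1}(mkM_rep x) mulM_mkM om_mkM (omw_red _ Ss rw).
Qed.

Lemma al_e : al (eM P) = 1. Proof. by rewrite al_mkM. Qed.
Lemma om_e : om (eM P) = eM P. Proof. by rewrite om_mkM. Qed.

Lemma al_simp s : S s -> al (simp s) = s.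
Proof. by move=> Ss; rewrite -[simp s]mulM1 al_simpM // al_e al21. Qed.

Lemma simp_al2 s u : S s -> S u -> simp s ∘ simp u = simp (al2 s u) ∘ simp (om2 s u).
Proof.
move=> Ss Su; have [h1 h2 _] := meetP Su (S_dl Ss).
have [h3 h4] := dlP Ss h2.
rewrite /al2 (simpM h3 Ss (S_left h1 Su) h4) -mulMA.
by rewrite (simp_split h1 Su).
Qed.

Lemma al_om x : x = simp (al x) ∘ om x.
Proof.
rewrite -(mkM_rep x) al_mkM om_mkM; elim: (rep x) => [|r w IH].
  by rewrite /= simp1 mul1M.
rewrite mkM_cons {1}IH -simp_at mulMA simp_al2 ?S_at ?alw_S //=.
by rewrite mulMA.
Qed.

(** The head and remainder of [simp s ∘ z] determine [z]: dividing the head by [s] gives back the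
    part of [al z] that [s] had absorbed. *)
Lemma simp_cancel s x y : S s -> simp s ∘ x = simp s ∘ y -> x = y.
Proof.
move=> Ss e.
have key z : z = simp (s^-1 * al (simp s ∘ z)) ∘ om (simp s ∘ z).
  rewrite al_simpM // om_simpM // /al2 mulKg.
  have [h1 _ _] := meetP (al_S z) (S_dl Ss).
  by rewrite mulMA -simp_split ?al_S // -al_om.
by rewrite (key x) (key y) e.
Qed.

Lemma mulM_cancel (z x y : M) : z ∘ x = z ∘ y -> x = y.
Proof.
rewrite -(mkM_rep z); elim: (rep z) => [|r w IH].
  by rewrite -[mkM [::]]/(eM P) !mul1M.
by rewrite mkM_cons -!mulMA -simp_at => /(simp_cancel (S_at r)); apply: IH.
Qed.

Lemma ldiv_simp s x : S s -> ldiv (simp s) x <-> s ⊑ al x.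
Proof.
move=> Ss; split=> [[z ->]|h].
  by rewrite al_simpM //; have [] := al2_S Ss (al_S z).
rewrite (al_om x) (simp_split h (al_S x)) -mulMA; exact: ldiv_mulr.
Qed.

Lemma al_mulr x y : al x ⊑ al (x ∘ y).
Proof.
apply/ldiv_simp; first exact: al_S.
by rewrite {2}(al_om x) -mulMA; apply: ldiv_mulr.
Qed.

(** The head of a common multiple of the atoms lies above all atoms, so [g_del] identifies it with
    [δ]. *)
Lemma Delta_simp : Delta P = simp δ.
Proof.
pose Q := fun d => (forall r, ldiv (genM r) d) /\
  (forall d', (forall r, ldiv (genM r) d') -> ldiv d d').
have top d : (forall r, ldiv (genM r) d) -> ldiv (simp δ) d.
  move=> h; apply/ldiv_simp; first exact: Sd.
  have -> : al d = δ; last exact: gle_refl.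
  apply: g_del (al_S d) _ => r; apply/ldiv_simp; first exact: S_at.
  by rewrite simp_at.
have Qd : Q (simp δ).
  split=> // r; rewrite -simp_at; apply/ldiv_simp; first exact: S_at.
  by rewrite al_simp ?Sd ?S_at.
have [h1 h2] : Q (Delta P) by apply: xgetI Qd.
by apply: ldiv_anti; [apply: h2; case: Qd|apply: top].
Qed.

(** Along a factorisation of [simp δ], word lengths add up to [l δ]; subadditivity of [l] then
    leaves no slack, so the representative of [x] is a reduced word of [gval x]. *)
Lemma simple_gval x : simple x -> S (gval x) /\ x = simp (gval x).
Proof.
rewrite /simple Delta_simp => -[y e].
have el : (l δ = len x + len y)%N by rewrite -len_mulM -e len_simp ?Sd.
have eg : δ = gval x * gval y by rewrite -gvalM -e gval_simp ?Sd.
have h1 := gval_len x; have h2 := gval_len y; have h3 := glenM (gval x) (gval y).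
rewrite -eg in h3.
have Sx : S (gval x) by apply/gleP; rewrite {2}eg mulKg; lia.
split=> //; apply/esym; rewrite -{2}(mkM_rep x); apply: simpE => //.
by split; rewrite // -/(len x); lia.
Qed.

Lemma simpleP x : simple x <-> exists2 s, S s & x = simp s.
Proof.
split=> [/simple_gval [h e]|[s Ss ->]]; first by exists (gval x).
by rewrite /simple Delta_simp; apply/ldiv_simp; rewrite ?al_simp ?Sd.
Qed.

Lemma simple_al x : simple x -> x = simp (al x).
Proof. by move=> /simpleP [s Ss ->]; rewrite al_simp. Qed.

Definition arr (s t : gT) : bool := [forall r, (a r ⊑ t) ==> ~~ (a r ⊑ dl s)].

Lemma Rset_simp s r : S s -> Rset (simp s) r <-> ~ (a r ⊑ dl s).
Proof.
move=> Ss; rewrite /Rset /= -simp_at; split=> h k; apply: h.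
  by have [h1 h2] := dlP Ss k; apply/simpleP; exists (s * a r) => //;
    rewrite simpM // S_at.
have [h1 h2] := simple_gval k.
rewrite gvalM !gval_simp ?S_at // in h1 h2.
apply: le_dl => //; rewrite gle_mull -(len_simp h1) -h2 len_mulM.
by rewrite !len_simp ?S_at.
Qed.

Lemma arrow_simp s t : S s -> S t -> arrow (simp s) (simp t) <-> arr s t.
Proof.
move=> Ss St; rewrite /arr; split=> [h|/forallP h r].
  apply/forallP => r; apply/implyP => rt; apply/negP.
  by apply/(Rset_simp r Ss); apply: h; rewrite /Lset /= -simp_at ldiv_simp ?S_at ?al_simp.
rewrite /Lset /= -simp_at ldiv_simp ?S_at ?al_simp // => rt.
by apply/Rset_simp => //; apply/negP; have := h r; rewrite rt.
Qed.

Lemma arrP s t : S s -> S t -> arr s t <-> meet t (dl s) = 1.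
Proof.
move=> Ss St; have [h1 h2 h3] := meetP St (S_dl Ss); split=> [/forallP h|e].
  apply: contrapT => ne.
  have [r hr] := g_atom (S_left h1 St) ne.
  by have := h r; rewrite (gle_trans hr h1) (gle_trans hr h2).
apply/forallP => r; apply/implyP => k1; apply/negP => k2.
have := h3 _ k1 k2; rewrite e => /gle_x1 /eqP.
by rewrite (negbTE (gat_neq1 G _)).
Qed.

Lemma arr_al s x : S s -> arr s (al x) ->
  al (simp s ∘ x) = s /\ om (simp s ∘ x) = x.
Proof.
move=> Ss /(arrP Ss (al_S x)) e.
by rewrite al_simpM // om_simpM // /al2 /om2 e mulg1 invg1 mul1g -al_om.
Qed.

Lemma arr_om x : arr (al x) (al (om x)).
Proof.
apply/arrP; rewrite ?al_S //.
have := congr1 al (al_om x); rewrite al_simpM ?al_S // /al2 => /esym h.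
by apply: (mulgI (al x)); rewrite mulg1.
Qed.

Lemma al_eq1 x : al x = 1 -> x = eM P.
Proof.
rewrite -(mkM_rep x); case: (rep x) => [//|r w].
rewrite mkM_cons -simp_at al_simpM ?S_at // => e.
have [_] := al2_S (S_at r) (al_S (mkM w)); rewrite e => /gle_x1 /eqP.
by rewrite (negbTE (gat_neq1 G _)).
Qed.

End GarsideMonoid.

(** * Garside normal forms and their truncations *)

Section NormalForms.
Variables (P : pres) (G : germ P).
Local Open Scope group_scope.
Local Notation gT := (ggT G).
Local Notation l := (@glen P G).
Local Notation δ := (@gdel P G).
Local Notation M := (mon P).
Local Notation "x ⊑ y" := (gle l x y) (at level 70).
Local Notation S x := (x ⊑ δ).
Local Notation "x ∘ y" := (mulM x y) (at level 40, left associativity).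
Local Notation simp := (@simp P G).
Local Notation al := (@al P G).
Local Notation om := (@om P G).
Implicit Types (x y z : M) (f g : nat -> M).

Fixpoint hd (k : nat) x : M :=
  if k is k'.+1 then simp (al x) ∘ hd k' (om x) else eM P.

Lemma hd_iter k x : x = hd k x ∘ iter k om x.
Proof.
elim: k x => [|k IH] x; first by rewrite mul1M.
by rewrite iterSr /= -mulMA -IH -al_om.
Qed.

Lemma len_om x : x <> eM P -> (len (om x) < len x)%N.
Proof.
move=> x0; rewrite {2}(al_om G x) len_mulM len_simp ?al_S //.
have : l (al x) <> 0%N by move=> /glen_eq0 /al_eq1.
lia.
Qed.

Lemma iter_om_e k : iter k om (eM P) = eM P.
Proof. by elim: k => // k IH; rewrite iterS IH om_e. Qed.

Lemma iter_om_len k x : (len x <= k)%N -> iter k om x = eM P.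
Proof.
elim: k x => [|k IH] x h; first by apply/len_eq0/eqP; rewrite -leqn0.
have [->|x0] := pselect (x = eM P); first exact: iter_om_e.
by rewrite iterSr; apply: IH; rewrite -ltnS; apply: leq_trans (len_om x0) h.
Qed.

Lemma hd_id k x : (len x <= k)%N -> hd k x = x.
Proof. by move=> h; rewrite {2}(hd_iter k x) iter_om_len // mulM1. Qed.

(** Multiplying by [s] changes the first factor and pushes [om2 s (al x)] to the right. This is
    again simple, so the induction hypothesis applies to it and the remaining factors. *)
Lemma hd_simpM k s x : S s -> ldiv (hd k (simp s ∘ x)) (simp s ∘ hd k x).
Proof.
elim: k s x => [|k IH] s x Ss /=; first by exists (simp s ∘ eM P); rewrite mul1M.
rewrite al_simpM // om_simpM // mulMA simp_al2 ?al_S // -mulMA.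
by apply: ldiv_mul2l; apply: IH; apply: om2_S => //; apply: al_S.
Qed.

(** Monotonicity of truncation is what makes divisibility by [x] visible on finitely many factors of
    a sequence. After removing [al x], the claim reduces to [hd_simpM]. *)
Lemma ldiv_hd k x y : ldiv x y -> ldiv (hd k x) (hd k y).
Proof.
elim: k x y => [|k IH] x y /= xy; first exact: ldiv_refl.
case: xy => z e; have h : al x ⊑ al y by rewrite e; apply: al_mulr.
have Sr : S ((al x)^-1 * al y) by apply: S_right h (al_S _ _).
rewrite (simp_split h (al_S G y)) -mulMA; apply: ldiv_mul2l.
apply: ldiv_trans (hd_simpM k _ Sr); apply: IH; exists z.
apply: (@simp_cancel P G (al x)); first exact: al_S.
by rewrite !mulMA -(simp_split h (al_S G y)) -!al_om.
Qed.

Lemma hd_ldiv k x : ldiv (hd k x) x.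
Proof. by rewrite {2}(hd_iter k x); apply: ldiv_mulr. Qed.

Definition nfseq x : Xsp P := fun k => simp (al (iter k om x)).
Definition pi (k : nat) f : M := prodM (mkseq f k).
Definition shift f : nat -> M := fun k => f k.+1.

Lemma piS k f : pi k.+1 f = f 0%N ∘ pi k (shift f).
Proof.
rewrite /pi /mkseq /= -(addn0 1%N) iotaDl -map_comp /=.
by congr (_ ∘ prodM _); apply: eq_map => i.
Qed.

Lemma eq_pi k f g : (forall i, (i < k)%N -> f i = g i) -> pi k f = pi k g.
Proof.
move=> h; rewrite /pi; congr prodM; apply/eq_in_map => i.
by rewrite mem_iota => /andP [_ hi]; apply: h.
Qed.

Lemma hd_pi k x : hd k x = pi k (nfseq x).
Proof.
elim: k x => [//|k IH] x; rewrite /= piS IH; congr (_ ∘ _).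
by apply: eq_pi => i _; rewrite /shift /nfseq iterSr.
Qed.

Lemma Mbar_nfseq x : Mbar_set (nfseq x).
Proof.
split=> k; first by apply/(simpleP G); exists (al (iter k om x)); rewrite ?al_S.
by apply/arrow_simp; rewrite ?al_S // iterS; apply: arr_om.
Qed.

Lemma Mbar_shift f : @Mbar_set P f -> @Mbar_set P (shift f).
Proof. by move=> [h1 h2]; split=> k; [apply: h1|apply: h2]. Qed.

Lemma Mbar_simp f k : @Mbar_set P f -> f k = simp (al (f k)).
Proof. by move=> [h1 _]; apply: simple_al. Qed.

Lemma Mbar_arr f k : @Mbar_set P f -> arr (al (f k)) (al (f k.+1)).
Proof.
move=> h; have [h1 h2] := h; apply/(arrow_simp (al_S G _) (al_S G _)).
by rewrite -!Mbar_simp.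
Qed.

Lemma arr1 (s : gT) : arr s 1.
Proof.
apply/forallP => r; apply/implyP => /gle_x1 h.
by have := gat_neq1 G r; rewrite h eqxx.
Qed.

(** The arrow from [f 0] to the next factor keeps the greedy head of the product equal to [f 0], and
    cancelling it leaves the shifted sequence. Uniqueness of normal forms follows. *)
Lemma nfseq_pi k f i : @Mbar_set P f ->
  nfseq (pi k f) i = if (i < k)%N then f i else eM P.
Proof.
elim: k f i => [|k IH] f i hf; first by rewrite /nfseq iter_om_e al_e simp1.
have hs := Mbar_shift hf.
have h0 : arr (al (f 0%N)) (al (pi k (shift f))).
  have := IH _ 0%N hs; rewrite /nfseq /= => h.
  case: k h {IH} => [|k] h; first by rewrite al_e; apply: arr1.
  have -> : al (pi k.+1 (shift f)) = al (f 1%N).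
    apply: (@simp_inj P G); rewrite ?al_S //.
    by rewrite h /= /shift; apply: Mbar_simp.
  exact: Mbar_arr.
rewrite piS {1}(Mbar_simp 0 hf).
have [e1 e2] := arr_al (al_S _ _) h0.
case: i => [|i]; first by rewrite /nfseq /= e1 -Mbar_simp.
by rewrite /nfseq iterSr e2 [LHS](IH _ i hs).
Qed.

Lemma hd_pi_le k m f : @Mbar_set P f -> (k <= m)%N -> hd k (pi m f) = pi k f.
Proof.
move=> hf km; rewrite hd_pi; apply: eq_pi => i ik.
by rewrite nfseq_pi // (leq_trans ik km).
Qed.

Lemma pi_inj k f g : @Mbar_set P f -> @Mbar_set P g -> pi k f = pi k g ->
  forall i, (i < k)%N -> f i = g i.
Proof.
move=> hf hg e i ik; have := nfseq_pi k i hf; rewrite e nfseq_pi // ik.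
by [].
Qed.

Lemma is_nf_nfseq x : is_nf x (nfseq x).
Proof.
split; first exact: Mbar_nfseq.
have [m /eqP hm min] := ex_minnP (ex_intro (fun k => iter k om x == eM P) (len x)
   (introT eqP (iter_om_len (leqnn _)))).
exists m; split=> [k km e|]; last split=> [k mk|].
- move: e; rewrite /nfseq -(@simp1 P G) => /(simp_inj (al_S _ _) (@S1 _ G)) /al_eq1 e.
  by have := min k; rewrite e eqxx => /(_ isT); rewrite leqNgt km.
- by rewrite /nfseq -(subnK mk) iterD hm iter_om_e al_e simp1.
- by rewrite -/(pi m _) -hd_pi {1}(hd_iter m x) hm mulM1.
Qed.

Lemma is_nf_uniq x f : @is_nf P x f -> f = nfseq x.
Proof.
move=> [hf [m [_ [h2 ->]]]]; apply/funext => i.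
by rewrite -/(pi m f) nfseq_pi //; case: ltnP => // /h2.
Qed.

Lemma val_nf x : val (nf x) = nfseq x.
Proof.
have h : is_nf x (val (exist _ (nfseq x) (mem_set (Mbar_nfseq x)) : Mbar P)).
  exact: is_nf_nfseq.
by apply: is_nf_uniq; exact: (@xgetI _ (ebar P) (fun xi : Mbar P => is_nf x (val xi)) _ h).
Qed.

Lemma Mbar_val (xi : Mbar P) : Mbar_set (val xi).
Proof. exact: set_mem (valP xi). Qed.

Definition pfx (k : nat) (xi : Mbar P) : M := pi k (val xi).

Lemma prefix_nf k x : pfx k (nf x) = hd k x.
Proof. by rewrite /pfx val_nf hd_pi. Qed.

Lemma hd_prefix k m (xi : Mbar P) : (k <= m)%N -> hd k (pfx m xi) = pfx k xi.
Proof. exact/hd_pi_le/Mbar_val. Qed.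

Lemma nf_prefix k (xi : Mbar P) i : (i < k)%N -> val (nf (pfx k xi)) i = val xi i.
Proof. by move=> h; rewrite val_nf nfseq_pi ?h //; apply: Mbar_val. Qed.

Lemma prefix_eq k (xi eta : Mbar P) : pfx k xi = pfx k eta <->
  (forall i, (i < k)%N -> val xi i = val eta i).
Proof. by split; [apply: pi_inj; apply: Mbar_val|apply: eq_pi]. Qed.

Lemma len_prefix k (xi : Mbar P) : (len (pfx k xi) <= k * l δ)%N.
Proof.
rewrite -(hd_prefix _ (leqnn k)); elim: k (pfx k xi) => [|k IH] x; first by rewrite len_eM.
rewrite /= len_mulM len_simp ?al_S // mulSn leq_add ?IH //.
by apply: gle_len; apply: al_S.
Qed.

End NormalForms.

(** * A ratio limit theorem for positive linear recurrences *)

Section RatioLimit.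
Import Order.TTheory GRing.Theory Num.Theory numFieldNormedType.Exports.
Local Open Scope classical_set_scope.
Local Open Scope ring_scope.
Variables (R : realType) (T : finType) (V : pred T) (w : T -> nat) (D : nat).
Variables (arr : rel T) (t0 : T).
Hypothesis w_pos : forall s, V s -> (0 < w s)%N.
Hypothesis w_le : forall s, V s -> (w s <= D)%N.

(** Nonnegativity is asked on one window of length [D] only. All delays lie between 1 and [D], so
    the recurrence carries it to every later index. *)
Definition sol (p : nat) (Y : T -> nat -> R) : Prop :=
  (forall s k, V s -> (p + D <= k)%N ->
     Y s k = \sum_(t | V t && arr s t) Y t (k - w s)%N) /\
  (forall s k, V s -> (p <= k < p + D)%N -> 0 <= Y s k).

Lemma sol_ge0 p Y : sol p Y -> forall s k, V s -> (p <= k)%N -> 0 <= Y s k.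
Proof.
move=> [rec ge0] s k; have [n] := ubnP k; elim: n k s => // n IH k s kn Vs pk.
have [kd|kd] := ltnP k (p + D); first by apply: ge0; rewrite ?pk.
rewrite rec //; apply: sumr_ge0 => t /andP [Vt _].
by have := w_pos Vs; have := w_le Vs; move=> h1 h2; apply: IH => //; lia.
Qed.

(* [reach s t n] is the analytic content of a path of weight n from s to t. *)
Definition reach (s t : T) (n : nat) : Prop := forall p Y, sol p Y ->
  forall k, (p + D + n <= k)%N -> Y t (k - n)%N <= Y s k.

Definition edge : rel T := [rel s t | [&& V s, V t & arr s t]].

Lemma reach_refl s : reach s s 0.
Proof. by move=> p Y _ k _; rewrite subn0. Qed.

Lemma reach_edge s t : edge s t -> reach s t (w s).
Proof.
move=> /and3P [Vs Vt st] p Y hY k hk; have [rec _] := hY.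
rewrite (rec s k) //; last by lia.
rewrite (bigD1 t) ?Vt //= lerDl; apply: sumr_ge0 => u /andP [/andP [Vu _] _].
by apply: (sol_ge0 hY) => //; lia.
Qed.

Lemma reach_trans s t u m n : reach s t m -> reach t u n -> reach s u (m + n).
Proof.
move=> h1 h2 p Y hY k hk; apply: le_trans (h1 p Y hY k _); last by lia.
by rewrite subnDA; apply: (h2 p Y hY); lia.
Qed.

Lemma connect_reach s t : connect edge s t -> exists n, reach s t n.
Proof.
move=> /connectP [q]; elim: q s => [|u q IH] s /= => [_ ->|/andP [su pq] e].
  by exists 0%N; apply: reach_refl.
have [n hn] := IH u pq e; exists (w s + n)%N.
exact: reach_trans (reach_edge su) hn.
Qed.

Hypothesis Vt0 : V t0.
Hypothesis t0t0 : arr t0 t0.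
Hypothesis wt0 : w t0 = 1%N.
Hypothesis conn : forall s, V s -> connect edge s t0 /\ connect edge t0 s.

Lemma reach_loop n : reach t0 t0 n.
Proof.
elim: n => [|n IH]; first exact: reach_refl.
rewrite -add1n; apply: (reach_trans _ IH); rewrite -wt0; apply: reach_edge.
by rewrite /edge /= Vt0 t0t0.
Qed.

(** The loop at [t0] has weight one and may be repeated at will, so all weights from some [m] on are
    realised: this is aperiodicity, uniform over the finite graph. *)
Lemma reach_unif : exists m, forall s n, V s -> (m <= n)%N ->
  reach s t0 n /\ reach t0 s n.
Proof.
have [f hf] : exists f : T -> nat, forall s, V s ->
    forall n, (f s <= n)%N -> reach s t0 n /\ reach t0 s n.
  have /choice [f hf] : forall s, exists m, V s -> forall n, (m <= n)%N ->
      reach s t0 n /\ reach t0 s n.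
    move=> s; have [Vs|nVs] := boolP (V s); last by exists 0%N.
    have [/connect_reach [m1 h1] /connect_reach [m2 h2]] := conn Vs.
    exists (m1 + m2)%N => _ n hn; split.
      have -> : n = (m1 + (n - m1))%N by lia.
      exact: reach_trans h1 (@reach_loop _).
    have -> : n = ((n - m2) + m2)%N by lia.
    exact: reach_trans (@reach_loop _) h2.
  by exists f.
exists (\max_s f s)%N => s n Vs hn; apply: hf => //.
exact: leq_trans (leq_bigmax s) hn.
Qed.

Variable E : T -> nat -> R.
Hypothesis solE : sol 0 E.
Hypothesis Et0 : forall k, (0 < k)%N -> 0 < E t0 k.

(** Each use of the recurrence sums at most [#|T|] earlier values, so advancing the index by one
    costs at most a factor [#|T|]. *)
Lemma E_growth p B : 0 <= B -> (forall s j, V s -> (p <= j < p + D)%N -> E s j <= B) ->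
  forall n s j, V s -> (p <= j < p + D + n)%N -> E s j <= #|T|%:R ^+ n * B.
Proof.
move=> B0 hB; have cT : 1 <= #|T|%:R :> R.
  by rewrite ler1n; apply/card_gt0P; exists t0.
elim=> [|n IH] s j Vs hj; first by rewrite mul1r; apply: hB => //; lia.
have h1 : #|T|%:R ^+ n * B <= #|T|%:R ^+ n.+1 * B.
  by rewrite ler_wpM2r // exprS ler_peMl // exprn_ge0.
have [jl|jl] := ltnP j (p + D + n).
  by apply: le_trans (IH s j Vs _) h1; lia.
have ws := w_pos Vs; have wd := w_le Vs.
have -> : E s j = \sum_(t | V t && arr s t) E t (j - w s)%N.
  by have [rec _] := solE; apply: rec => //; lia.
apply: (@le_trans _ _ (\sum_(t : T) #|T|%:R ^+ n * B)).
  rewrite [leRHS](bigID (fun t => V t && arr s t)) /= -[leLHS]addr0; apply: lerD.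
    by apply: ler_sum => t /andP [Vt _]; apply: IH => //; lia.
  by apply: sumr_ge0 => t _; rewrite mulr_ge0 // exprn_ge0.
by rewrite sumr_const exprS -mulrA mulr_natl.
Qed.

Definition bounded (p : nat) (a b : R) := forall s j, V s -> (p <= j)%N ->
  a * E s j <= E s j.+1 <= b * E s j.

Lemma E_ge0 s j : V s -> 0 <= E s j.
Proof. by move=> Vs; apply: (sol_ge0 solE). Qed.

Lemma solE_slack p (c d : R) :
  (forall s j, V s -> (p <= j)%N -> 0 <= c * E s j + d * E s j.+1) ->
  sol p (fun s j => c * E s j + d * E s j.+1).
Proof.
move=> h; split=> s k Vs hk; last by apply: h => //; lia.
have [rec _] := solE; have wd := w_le Vs.
rewrite (rec s k) ?(rec s k.+1) //; [|lia|lia].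
rewrite !mulr_sumr -big_split /=; apply: eq_bigr => t _.
by have -> : (k.+1 - w s = (k - w s).+1)%N by lia.
Qed.

(** The slacks b E(j) - E(j+1) and E(j+1) - a E(j) solve the same recurrence as E and add up to (b -
    a) E(j). At [t0] one of them is at least half of this sum; connectivity spreads it to every
    vertex, which improves the corresponding bound by a fixed proportion of b - a. *)
Lemma contraction : exists2 eps : R, 0 < eps <= 1 & exists p0 L, forall p a b,
  (p0 <= p)%N -> a <= b -> bounded p a b -> exists a' b',
  [/\ a <= a', b' <= b, b' - a' = (1 - eps) * (b - a) & bounded (p + L) a' b'].
Proof.
have [m hm] := reach_unif.
(* After the delay [L], every vertex is reached from [t0] at time [p + D]. The exponent [m + L]
   counts the growth steps from the window at [p - m] to the end of the window at [p + L]. *)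
pose L := (D + m)%N; pose C : R := #|T|%:R ^+ (m + L).
have cT : 1 <= #|T|%:R :> R.
  by rewrite ler1n; apply/card_gt0P; exists t0.
have C1 : 1 <= C by rewrite exprn_ege1.
have C0 : 0 < C by lra.
pose e : R := (2 * C)^-1.
have e0 : 0 < e by rewrite invr_gt0; lra.
have e1 : e <= 1 by rewrite invf_le1; lra.
exists e; first by rewrite e0.
(* The window at [p - m] then stays beyond [D], where [reach] applies to [E] as a solution started
   at 0. *)
exists (m + D + D)%N, L => p a b hp ab hb.
have bnd s j : V s -> (p + L <= j)%N -> (j < p + L + D)%N -> E s j <= C * E t0 (p + D)%N.
  move=> Vs h1 h2; apply: (@E_growth (p - m)%N) => //; last by clear -h1 h2 hp; lia.
    exact: E_ge0.
  move=> t i Vt hi.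
  have [_ r] := hm t (p + D - i)%N Vt ltac:(clear -hi hp; lia).
  have iD : (D <= i)%N by clear -hi hp; lia.
  have := r 0%N E solE (p + D)%N ltac:(clear -iD hi hp; lia).
  by have -> : (p + D - (p + D - i) = i)%N by clear -hi hp; lia.
pose x := (b - a) * E t0 (p + D)%N.
(* A slack that is large at [t0] dominates e (b - a) E on one window; their difference is a solution
   too, so the domination persists at all later times. *)
have half (Y : T -> nat -> R) : sol p Y -> x / 2 <= Y t0 (p + D)%N ->
    forall s j, V s -> (p + L <= j)%N -> e * (b - a) * E s j <= Y s j.
  move=> hY hx.
  have win s j : V s -> (p + L <= j)%N -> (j < p + L + D)%N -> e * (b - a) * E s j <= Y s j.
    move=> Vs h1 h2; have [r _] := hm s (j - (p + D))%N Vs ltac:(rewrite /L in h1; clear -h1; lia).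
    have := r p Y hY j ltac:(rewrite /L in h1; clear -h1 hp; lia).
    have -> : (j - (j - (p + D)) = p + D)%N by rewrite /L in h1; clear -h1; lia.
    apply: le_trans; apply: le_trans hx.
    have eb : 0 <= e * (b - a) by rewrite mulr_ge0 ?subr_ge0 // ltW.
    apply: le_trans (ler_wpM2l eb (bnd s j Vs h1 h2)) _.
    have eC : e * C = 1 / 2 by rewrite /e; field; lra.
    have -> : e * (b - a) * (C * E t0 (p + D)%N) = (e * C) * x by rewrite /x; ring.
    by rewrite eC; lra.
  have hs : sol (p + L) (fun s j => Y s j - e * (b - a) * E s j).
    split=> s k Vs hk; last by case/andP: hk => *; rewrite subr_ge0; apply: win.
    have [recE _] := solE; have [recY _] := hY.
    rewrite (recE s k) ?(recY s k) //; try (clear -hk; lia).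
    by rewrite mulr_sumr -sumrB.
  by move=> s j Vs hj; have := sol_ge0 hs Vs hj; rewrite subr_ge0.
have sY : sol p (fun s j => b * E s j + (-1) * E s j.+1).
  by apply: solE_slack => s j Vs hj; have /andP [] := hb s j Vs hj; lra.
have sZ : sol p (fun s j => (- a) * E s j + 1 * E s j.+1).
  by apply: solE_slack => s j Vs hj; have /andP [] := hb s j Vs hj; lra.
have [hY|hY] := leP (x / 2) (b * E t0 (p + D)%N + (-1) * E t0 (p + D).+1).
  exists a, (b - e * (b - a)); split=> //.
  - by rewrite gerBl mulr_ge0 ?subr_ge0 // ltW.
  - by ring.
  - move=> s j Vs hj; have := half _ sY hY s j Vs hj => /= h3.
    have /andP [h4 h5] := hb s j Vs (leq_trans (leq_addr L p) hj).
    by rewrite h4 /=; lra.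
have hZ : x / 2 <= (- a) * E t0 (p + D)%N + 1 * E t0 (p + D).+1.
  by rewrite /x in hY *; lra.
exists (a + e * (b - a)), b; split=> //.
- by rewrite lerDl mulr_ge0 ?subr_ge0 // ltW.
- by ring.
- move=> s j Vs hj; have := half _ sZ hZ s j Vs hj => /= h3.
  have /andP [h4 h5] := hb s j Vs (leq_trans (leq_addr L p) hj).
  by rewrite h5 andbT; lra.
Qed.

(** [b] is the sum of all ratios E(j+1)/E(j) over one window and thus exceeds each of them. Then b
    E(j) - E(j+1) is a solution that is nonnegative on that window, hence ever after. *)
Lemma bounded_init q : exists p b, [/\ (q <= p)%N, 0 <= b & bounded p 0 b].
Proof.
have [m hm] := reach_unif.
pose p := (q + m + D + 1)%N.
have pos s j : V s -> (p <= j)%N -> 0 < E s j.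
  move=> Vs hj; have [r _] := hm s m Vs (leqnn _).
  apply: lt_le_trans (r 0%N E solE j _); last by rewrite /p in hj; lia.
  by apply: Et0; rewrite /p in hj; lia.
pose b := \sum_(s | V s) \sum_(i < D) E s (p + i).+1 / E s (p + i)%N.
have t_ge0 s j : V s -> 0 <= E s j.+1 / E s j by move=> Vs; rewrite divr_ge0 ?E_ge0.
have b0 : 0 <= b by apply: sumr_ge0 => s Vs; apply: sumr_ge0 => i _; apply: t_ge0.
have hw s j : V s -> (p <= j)%N -> (j < p + D)%N -> E s j.+1 <= b * E s j.
  move=> Vs h1 h2; rewrite -ler_pdivrMr ?pos //.
  have hi : (j - p < D)%N by lia.
  rewrite /b (bigD1 s) //= (bigD1 (Ordinal hi)) //= subnKC // -!addrA lerDl addr_ge0 //.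
    by apply: sumr_ge0 => i _; apply: t_ge0.
  by apply: sumr_ge0 => t /andP [Vt _]; apply: sumr_ge0 => i _; apply: t_ge0.
have hs : sol p (fun s j => b * E s j + (-1) * E s j.+1).
  split=> s k Vs hk; last by have := hw s k Vs ltac:(lia) ltac:(lia); lra.
  have [recE _] := solE; have wd := w_le Vs.
  rewrite (recE s k) ?(recE s k.+1) //; [|lia|lia].
  rewrite !mulr_sumr -big_split /=; apply: eq_bigr => t _.
  by have -> : (k.+1 - w s = (k - w s).+1)%N by lia.
exists p, b; split=> //; first by rewrite /p; lia.
move=> s j Vs hj; rewrite mul0r E_ge0 //=.
by have := sol_ge0 hs Vs hj; lra.
Qed.

Lemma bounded_tight (eta : R) : 0 < eta -> exists p a b,
  [/\ 0 <= a, a <= b, b - a <= eta & bounded p a b].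
Proof.
move=> eta0; have [e /andP [e0 e1] [p0 [L hc]]] := contraction.
have [p [b [hp b0 hb]]] := bounded_init p0.
have iter n : exists q a' b', [/\ (p0 <= q)%N, 0 <= a', a' <= b',
    b' - a' = (1 - e) ^+ n * b & bounded q a' b'].
  elim: n => [|n [q [a' [b' [h1 h2 h3 h4 h5]]]]].
    by exists p, 0, b; split=> //; rewrite subr0 mul1r.
  have [a2 [b2 [k1 k2 k3 k4]]] := hc q a' b' h1 h3 h5.
  exists (q + L)%N, a2, b2; split=> //; first exact: leq_trans h1 (leq_addr L q).
  - exact: le_trans h2 k1.
  - by rewrite -subr_ge0 k3 mulr_ge0 ?subr_ge0.
  - by rewrite k3 h4 exprS mulrA.
have [n hn] : exists n, (1 - e) ^+ n * b <= eta.
  have cv : (fun n => (1 - e) ^+ n * b) @ \oo --> 0 * b.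
    by apply: cvgMl; apply: cvg_expr; rewrite ger0_norm; lra.
  rewrite mul0r in cv.
  have /cvgrPdist_le /(_ _ eta0) [n _ hn] := cv.
  exists n; have := hn n (leqnn _) => /=; rewrite sub0r normrN; apply: le_trans.
  exact: ler_norm.
have [q [a' [b' [h1 h2 h3 h4 h5]]]] := iter n.
by exists q, a', b'; split=> //; rewrite h4.
Qed.

Lemma ratio_limit : exists rho : R, forall eta, 0 < eta -> exists K,
  forall s k, V s -> (K <= k)%N -> `|E s k.+1 - rho * E s k| <= eta * E s k.
Proof.
pose A := [set a : R | exists b p, bounded p a b]%classic.
have ubA a b p : bounded p a b -> ubound A b.
  move=> h x [b' [q h']].
  have /andP [h1 _] := h' t0 (p + q + 1)%N Vt0 ltac:(lia).
  have /andP [_ h2] := h t0 (p + q + 1)%N Vt0 ltac:(lia).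
  have := le_trans h1 h2; rewrite ler_pM2r //; apply: Et0; lia.
exists (sup A) => eta eta0.
have [p [a [b [a0 ab hab hb]]]] := bounded_tight eta0.
have Aa : A a by exists b, p.
have h1 : a <= sup A by apply: ub_le_sup => //; exists b; apply: ubA hb.
have h2 : sup A <= b by apply: ge_sup; [exists a|apply: ubA hb].
exists p => s k Vs pk; have /andP [k1 k2] := hb s k Vs pk.
have E0 := E_ge0 k Vs.
have k3 := ler_wpM2r E0 h1; have k4 := ler_wpM2r E0 h2.
have k5 : b * E s k <= eta * E s k + a * E s k by rewrite -mulrDl ler_wpM2r //; lra.
by rewrite ler_norml; apply/andP; split; lra.
Qed.

End RatioLimit.

(** * Counting elements by length and first normal form factor *)

Lemma sum_count_fiber (T : finType) (X : Type) (f : X -> T) (Q : pred T) (s : seq X) :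
  (\sum_(t | Q t) count (fun x => f x == t) s = count (fun x => Q (f x)) s)%N.
Proof.
elim: s => [|x s IH] /=; first by rewrite big1.
rewrite big_split /= IH; congr addn.
rewrite big_mkcond (bigD1 (f x)) //= eqxx big1 ?addn0; first by case: (Q (f x)).
by move=> t tx; rewrite eq_sym (negbTE tx) if_same.
Qed.

Section EnumMk.
Variable P : pres.

Definition Mlist (k : nat) : seq (mon P) := enum_fin (@Mk P k).

Lemma MlistP k : uniq (Mlist k) /\ forall x, (x \in Mlist k) = (len x == k).
Proof.
pose s := undup [seq mkM (tval t) | t : k.-tuple (pgen P)].
have hs : uniq s /\ forall x, x \in s <-> @Mk P k x.
  split=> [|x]; first exact: undup_uniq.
  rewrite mem_undup; split=> [/mapP [t _ ->]|hx].
    by rewrite /Mk /= len_mkM size_tuple.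
  have hw : size (rep x) == k by apply/eqP.
  by apply/mapP; exists (Tuple hw); rewrite ?mem_enum //= mkM_rep.
have [h1 h2] : uniq (Mlist k) /\ forall x, x \in Mlist k <-> @Mk P k x.
  exact: (@xgetI _ [::] (fun s : seq (mon P) => uniq s /\ forall x, x \in s <-> @Mk P k x) s).
by split=> // x; apply/idP/eqP => /h2.
Qed.

Lemma Mlist_uniq k : uniq (Mlist k). Proof. by case: (MlistP k). Qed.
Lemma mem_Mlist k x : (x \in Mlist k) = (len x == k). Proof. by case: (MlistP k). Qed.

Lemma Mlist0 : Mlist 0 = [:: eM P].
Proof.
apply: perm_small_eq => //; apply: uniq_perm => //; first exact: Mlist_uniq.
move=> x; rewrite mem_Mlist inE; apply/eqP/eqP => [/len_eq0 //|->].
exact: len_eM.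
Qed.

Lemma cardM_size k : cardM P k = size (Mlist k). Proof. by []. Qed.

End EnumMk.

Section Counting.
Variables (P : pres) (G : germ P).
Local Open Scope group_scope.
Local Notation gT := (ggT G).
Local Notation a := (@gat P G).
Local Notation l := (@glen P G).
Local Notation δ := (@gdel P G).
Local Notation M := (mon P).
Local Notation "x ⊑ y" := (gle l x y) (at level 70).
Local Notation S x := (x ⊑ δ).
Local Notation simp := (@simp P G).
Local Notation al := (@al P G).
Local Notation om := (@om P G).
Local Notation Mlist := (@Mlist P).
Implicit Types (x y z : M) (s t : gT) (r : pgen P).

Definition Ecnt s (k : nat) : nat := count (fun x => al x == s) (Mlist k).

Lemma Ecnt_rec s k : S s -> (l s <= k)%N ->
  Ecnt s k = (\sum_(t | arr s t) Ecnt t (k - l s))%N.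
Proof.
move=> Ss sk; rewrite /Ecnt sum_count_fiber -!size_filter.
rewrite -[RHS](size_map (mulM (simp s))); apply: perm_size; apply: uniq_perm.
- by apply: filter_uniq; apply: Mlist_uniq.
- rewrite map_inj_uniq; first by apply: filter_uniq; apply: Mlist_uniq.
  by move=> x y; apply: mulM_cancel.
move=> x; rewrite mem_filter mem_Mlist; apply/andP/mapP => [[/eqP e /eqP lx]|[y]].
  exists (om x); last by rewrite -e; apply: al_om.
  rewrite mem_filter mem_Mlist -{1}e arr_om /=.
  by apply/eqP; have := congr1 (@len P) (al_om G x); rewrite len_mulM e len_simp //; lia.
rewrite mem_filter mem_Mlist => /andP [sy /eqP ly] ->.
have [-> _] := arr_al Ss sy; rewrite eqxx len_mulM len_simp // ly.
by split=> //; apply/eqP; lia.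
Qed.

Lemma Ecnt1 k : Ecnt 1 k = (k == 0%N).
Proof.
rewrite /Ecnt; case: k => [|k]; first by rewrite Mlist0 /= al_e eqxx.
transitivity 0%N => //; apply/eqP; rewrite -leqn0 leqNgt -has_count; apply/hasPn => x.
rewrite mem_Mlist => /eqP lx; apply/eqP => /al_eq1 e.
by rewrite e len_eM in lx.
Qed.

Lemma Ecnt_notS s k : ~~ S s -> Ecnt s k = 0%N.
Proof.
move=> Ss; apply/eqP; rewrite -leqn0 leqNgt -has_count; apply/hasPn => x _.
by apply: contraNneq Ss => <-; apply: al_S.
Qed.

Lemma cardM_sum k : cardM P k = (\sum_s Ecnt s k)%N.
Proof. by rewrite sum_count_fiber count_predT. Qed.

Definition nontriv (s : gT) : bool := [&& S s, s != 1 & s != δ].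

Lemma nontriv_len s : nontriv s -> (0 < l s < l δ)%N.
Proof.
move=> /and3P [Ss /eqP s1 /eqP sd]; apply/andP; split.
  by rewrite lt0n; apply/eqP => /glen_eq0.
rewrite ltn_neqAle (gle_len Ss) andbT; apply/eqP => e; apply: sd.
by apply: gle_len_eq Ss _; rewrite e.
Qed.

Lemma arr_to_del s : S s -> arr s δ = (s == δ).
Proof.
move=> Ss; apply/idP/eqP => [/(arrP Ss (@Sd _ G)) h|->].
  have [_ _ /(_ (dl s) (S_dl Ss) (gle_refl _))] := meetP (@Sd _ G) (S_dl Ss).
  rewrite h => /gle_x1; rewrite /dl => e.
  by apply/esym; rewrite -(mulKVg s δ) e mulg1.
apply/forallP => r; apply/implyP => _; rewrite /dl mulVg; apply/negP => /gle_x1 h.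
by have := gat_neq1 G r; rewrite h eqxx.
Qed.

Lemma arr_del t : arr δ t.
Proof.
apply/forallP => r; apply/implyP => _; rewrite /dl mulVg; apply/negP => /gle_x1 h.
by have := gat_neq1 G r; rewrite h eqxx.
Qed.

(** For k at least [l δ] the remainder has positive length, so its head is not 1; and its head is
    not [δ], because only [δ] may precede [δ]. *)
Lemma Ecnt_proper_rec s k : nontriv s -> (l δ <= k)%N ->
  Ecnt s k = (\sum_(t | nontriv t && arr s t) Ecnt t (k - l s))%N.
Proof.
move=> Vs dk; have /andP [l0 ld] := nontriv_len Vs.
have /and3P [Ss _ sd] := Vs.
rewrite Ecnt_rec //; last by lia.
rewrite [LHS]big_mkcond [RHS]big_mkcond; apply: eq_bigr => t _.
have [st|] := boolP (arr s t); last by rewrite andbF.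
rewrite andbT /nontriv; have [St|nSt] := boolP (S t); last first.
  by rewrite /= Ecnt_notS.
have [->|t1] /= := eqVneq t 1; first by rewrite Ecnt1; lia.
by have [td|//] := eqVneq t δ; move: st; rewrite td arr_to_del // (negbTE sd).
Qed.

Lemma Ecnt_at_gt0 r k : arr (a r) (a r) -> (0 < k)%N -> (0 < Ecnt (a r) k)%N.
Proof.
move=> rr; elim: k => // k IH _.
rewrite (Ecnt_rec (S_at G r)) gat_len // subn1 /=; case: k IH => [_|k IH].
  by rewrite (bigD1 1) ?arr1 //= Ecnt1.
by rewrite (bigD1 (a r)) //= addn_gt0 IH.
Qed.

Lemma del_neq1 r : δ != 1.
Proof.
apply/eqP => e; have := gat_del G r; rewrite e => /gle_x1 h.
by have := gat_neq1 G r; rewrite h eqxx.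
Qed.

(** Anything may follow [δ], so the elements with first factor [δ] correspond to all elements of
    length [k - l δ]. *)
Lemma cardM_rec k : (0 < k)%N -> (l δ <= k)%N ->
  cardM P k = (\sum_(s | nontriv s) Ecnt s k + cardM P (k - l δ))%N.
Proof.
move=> k0 dk; rewrite cardM_sum.
have -> : cardM P (k - l δ) = Ecnt δ k.
  rewrite (Ecnt_rec (@Sd _ G) dk) cardM_sum; apply: eq_bigl => t.
  by rewrite arr_del.
have [d1|d1] := eqVneq (δ : gT) 1.
  rewrite (bigD1 δ) //= addnC; congr addn.
  have e s : nontriv s = false.
    apply/negbTE/negP => /and3P [h /eqP h1 _].
    by rewrite d1 in h; apply: h1; apply: gle_x1.
  rewrite [RHS]big1 ?[LHS]big1 //.
    by move=> s sd; apply: Ecnt_notS; apply: contra_neqN sd; rewrite d1 => /gle_x1.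
  by move=> s; rewrite e.
rewrite (bigD1 δ) //= addnC; congr addn.
rewrite [LHS]big_mkcond [RHS]big_mkcond; apply: eq_bigr => s _.
rewrite /nontriv; have [Ss|nSs] := boolP (S s); last by rewrite Ecnt_notS // if_same.
have [->|s1] /= := eqVneq s 1; last by case: eqVneq.
by rewrite Ecnt1 eq_sym d1; lia.
Qed.

Lemma cardM_mono r k : (cardM P k <= cardM P k.+1)%N.
Proof.
rewrite !cardM_size -(size_map (mulM (genM r))); apply: uniq_leq_size.
  rewrite map_inj_uniq ?Mlist_uniq // => x y; rewrite -(@simp_at P G).
  by apply: mulM_cancel.
move=> x /mapP [y]; rewrite !mem_Mlist => /eqP <- ->.
by rewrite len_mulM /genM len_mkM.
Qed.

Lemma cardM_gt0 r k : (0 < cardM P k)%N.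
Proof.
elim: k => [|k IH]; first by rewrite cardM_size Mlist0.
exact: leq_trans IH (cardM_mono r k).
Qed.

(* The simple elements other than 1 and delta form a strongly connected graph
   through an atom which carries a loop; this makes it aperiodic. *)
Definition germ_connected : Prop := (l δ = 1)%N \/ exists r,
  [/\ nontriv (a r), arr (a r) (a r) & forall s, nontriv s ->
   connect (edge nontriv (@arr P G)) s (a r) /\ connect (edge nontriv (@arr P G)) (a r) s].

Section Ratio.
Import Order.TTheory GRing.Theory Num.Theory.
Local Open Scope ring_scope.
Variable R : realType.

Lemma Ecnt_ratio r : nontriv (a r) -> arr (a r) (a r) -> (forall s, nontriv s ->
    connect (edge nontriv (@arr P G)) s (a r) /\ connect (edge nontriv (@arr P G)) (a r) s) ->
  exists rho : R, forall eta, 0 < eta -> exists K,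
  forall s k, nontriv s -> (K <= k)%N ->
  `|(Ecnt s k.+1)%:R - rho * (Ecnt s k)%:R| <= eta * (Ecnt s k)%:R.
Proof.
move=> Vr rr conn.
apply: (@ratio_limit R _ nontriv l (l δ) (@arr P G) (a r)) => //.
- by move=> s /nontriv_len /andP [].
- by move=> s /nontriv_len /andP [_ /ltnW].
- exact: gat_len.
- split=> [s k Vs|s k _ _]; last exact: ler0n.
  by rewrite add0n => dk; rewrite Ecnt_proper_rec // natr_sum.
by move=> k k0; rewrite ltr0n; apply: Ecnt_at_gt0.
Qed.

(** Transfers the ratio limit from the nontrivial heads to all of M. The limit is at least 1 since
    left multiplication by an atom is injective. *)
Lemma cardM_ratio : germ_connected -> exists2 rho : R, 1 <= rho &
  forall eta, 0 < eta -> exists K, forall k, (K <= k)%N ->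
  `|(cardM P k.+1)%:R - rho * (cardM P k)%:R| <= eta * (cardM P k)%:R.
Proof.
move=> hconn.
have [r _] : exists r : pgen P, True.
  case: hconn => [d1|[r _]]; last by exists r.
  have /(g_atom (@Sd _ G)) [r _] : δ <> 1%g by move=> e; move: d1; rewrite e glen1.
  by exists r.
have cge k : 1 <= (cardM P k)%:R :> R by rewrite ler1n (cardM_gt0 r).
suff [rho hrho] : exists rho : R, forall eta, 0 < eta -> exists K, forall k, (K <= k)%N ->
  `|(cardM P k.+1)%:R - rho * (cardM P k)%:R| <= eta * (cardM P k)%:R.
  exists rho => //; rewrite leNgt; apply/negP => r1.
  have [|K /(_ K (leqnn K))] := hrho ((1 - rho) / 2); first by lra.
  have := cge K; have : (cardM P K)%:R <= (cardM P K.+1)%:R :> R by rewrite ler_nat cardM_mono.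
  set x := _%:R; set y := _%:R => xy x1; rewrite ler_norml => /andP [_].
  have : 0 < (1 - rho) * x by rewrite mulr_gt0; lra.
  by rewrite mulrAC !mulrBl; lra.
case: hconn => [d1|[r0 [Vr rr conn]]].
  have c k : cardM P k = 1%N.
    elim: k => [|k IH]; first by rewrite cardM_size Mlist0.
    rewrite cardM_rec // d1 // subn1 IH big1 // => s /nontriv_len.
    by rewrite d1; case: (l s) => [|[]].
  exists 1 => eta eta0; exists 0%N => k _.
  by rewrite !c mulr1 subrr normr0 mulr1 ltW.
have [rho hrho] := Ecnt_ratio Vr rr conn.
exists rho => eta eta0.
have eta20 : 0 < eta / 2 by lra.
have [K hK] := hrho _ eta20.
pose D := l δ; have D0 : (0 < D)%N.
  by rewrite lt0n; apply/eqP => /glen_eq0 /eqP; rewrite (negbTE (del_neq1 r0)).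
pose N k : nat := (\sum_(s | nontriv s) Ecnt s k)%N.
have hN k : (K <= k)%N -> `|(N k.+1)%:R - rho * (N k)%:R| <= eta / 2 * (N k)%:R.
  move=> Kk; rewrite /N !natr_sum !mulr_sumr -sumrB.
  by apply: le_trans (ler_norm_sum _ _ _) _; apply: ler_sum => s Vs; apply: hK.
have N1 k : (0 < k)%N -> (0 < N k)%N.
  by move=> k0; rewrite /N (bigD1 (a r0)) //= addn_gt0 Ecnt_at_gt0.
pose d k : R := `|(cardM P k.+1)%:R - rho * (cardM P k)%:R|.
pose C := \sum_(i < K + D) d i.
(* Induction by steps of [D]: each block contributes a defect proportional to its [N], and the
   descent ends among the finitely many initial defects summed in [C]. *)
have dC k : d k <= eta / 2 * (cardM P k)%:R + C.
  have [n] := ubnP k; elim: n k => // n IH k kn.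
  have [kK|kK] := ltnP k (K + D).
    rewrite /C (bigD1 (Ordinal kK)) //= addrCA lerDl addr_ge0 //.
      by rewrite mulr_ge0 // ltW.
    by apply: sumr_ge0 => i _; apply: normr_ge0.
  have e1 : cardM P k = (N k + cardM P (k - D))%N by apply: cardM_rec; lia.
  have e2 : cardM P k.+1 = (N k.+1 + cardM P (k - D).+1)%N.
    by rewrite cardM_rec -?/D -?subSn //; lia.
  have h1 := hN k ltac:(lia); have h2 := IH (k - D)%N ltac:(lia).
  rewrite {1}/d e1 e2 !natrD.
  set A := (N k.+1)%:R in h1 *; set B := (N k)%:R in h1 *.
  rewrite /d in h2; set A' := (cardM P (k - D).+1)%:R in h2 *.
  set B' := (cardM P (k - D))%:R in h2 *.
  have -> : A + A' - rho * (B + B') = (A - rho * B) + (A' - rho * B') by ring.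
  by apply: le_trans (ler_normD _ _) _; lra.
(* Every positive length has an element with nontrivial head, so the counts grow at least linearly
   and finally absorb [C]. *)
have cD k : (k <= D * cardM P k)%N.
  have [n] := ubnP k; elim: n k => // n IH k kn.
  have [kD|kD] := leqP k D.
    by apply: leq_trans kD _; rewrite leq_pmulr // (cardM_gt0 r0).
  rewrite cardM_rec -/D; [|lia|lia].
  have := IH (k - D)%N ltac:(lia); have := N1 k ltac:(lia); rewrite -/(N k) mulnDr.
  by move=> h1 h2; have : (D <= D * N k)%N; [rewrite leq_pmulr|lia].
have [m hm] : exists m : nat, C / (eta / 2) < m%:R.
  exists (Num.bound (C / (eta / 2))); apply: archi_boundP.
  apply: divr_ge0; last exact: ltW.
  by apply: sumr_ge0 => i _; apply: normr_ge0.
exists (D * m)%N => k hk; apply: le_trans (dC k) _.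
have : m%:R <= (cardM P k)%:R :> R.
  by rewrite ler_nat -(leq_pmul2l D0); apply: leq_trans hk (cD k).
have := hm; rewrite ltr_pdivrMr // => h1 h2.
have : m%:R * (eta / 2) <= (cardM P k)%:R * (eta / 2) by rewrite ler_wpM2r // ltW.
by move=> h3; lra.
Qed.

End Ratio.
End Counting.

(** * The symmetric group as germ of the braid monoid *)

Section Inversions.
Import mathcomp.boot.fintype mathcomp.boot.finset.
Variable n : nat.
Local Open Scope group_scope.
Implicit Types (x y u : 'S_n) (p : 'I_n * 'I_n).

Definition blen u : nat := #|[set p : 'I_n * 'I_n | (p.1 < p.2)%N & (u p.2 < u p.1)%N]|.
(** Each inverted pair is kept in both orders, whence the doubling in [card_inv]. Without
    orientation, the inversions of a product are a plain symmetric difference, as [invM] states. *)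
Definition inv u : {set 'I_n * 'I_n} := [set p : 'I_n * 'I_n | (p.1 < p.2)%N (+) (u p.1 < u p.2)%N].

Lemma inv_lt u p : (p.1 < p.2)%N -> (p \in inv u) = (u p.2 < u p.1)%N.
Proof.
move=> h; rewrite inE h /=; case: (ltngtP (u p.1) (u p.2)) => //.
by move/ord_inj/perm_inj => e; rewrite e ltnn in h.
Qed.

Lemma inv_diag u p : p.1 = p.2 -> (p \in inv u) = false.
Proof. by move=> h; rewrite inE h !ltnn. Qed.

Lemma inv_swap u p : ((p.2, p.1) \in inv u) = (p \in inv u).
Proof.
rewrite !inE /=; have [e|e] := eqVneq p.1 p.2; first by rewrite e.
have := e; rewrite -(inj_eq (@perm_inj _ u)) => e'.
rewrite -!val_eqE /= in e e'.
by case: (ltngtP p.1 p.2) e => // _ _; case: (ltngtP (u p.1) (u p.2)) e'.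
Qed.

Lemma card_inv u : #|inv u| = (blen u).*2.
Proof.
pose N := [set p : 'I_n * 'I_n | (p.1 < p.2)%N & (u p.2 < u p.1)%N].
pose sw (p : 'I_n * 'I_n) := (p.2, p.1).
have swK : involutive sw by case.
have e : inv u = N :|: sw @^-1: N.
  apply/setP => p; rewrite in_setU [in RHS]inE [X in _ || X]inE [in X in _ || X]inE /=.
  have [h|h|h] := ltngtP p.1 p.2.
  - by rewrite inv_lt ?orbF.
  - by rewrite -inv_swap inv_lt.
  - by rewrite inv_diag //; apply: ord_inj.
have d : [disjoint N & sw @^-1: N].
  rewrite -setI_eq0; apply/eqP/setP => p; rewrite !inE /=.
  by case: (ltngtP p.1 p.2); rewrite ?andbF.
rewrite e cardsU (disjoint_setI0 d) cards0 subn0 card_preimset; last exact: inv_inj.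
by rewrite addnn.
Qed.

Lemma invM x y p : (p \in inv (x * y)) = (p \in inv x) (+) ((x p.1, x p.2) \in inv y).
Proof. by rewrite !inE /= !permM; case: (p.1 < p.2)%N; case: (x p.1 < x p.2)%N; case: (_ < _)%N. Qed.

Lemma card_inv_shift x y : #|[set p : 'I_n * 'I_n | (x p.1, x p.2) \in inv y]| = #|inv y|.
Proof.
pose f (p : 'I_n * 'I_n) := (x p.1, x p.2).
have fi : injective f by move=> [p1 p2] [q1 q2] [/perm_inj -> /perm_inj ->].
have -> : [set p : 'I_n * 'I_n | (x p.1, x p.2) \in inv y] = f @^-1: inv y.
  by apply/setP => p; rewrite in_set.
exact: card_preimset.
Qed.

Lemma blen1 : blen 1 = 0%N.
Proof.
by apply/eqP; rewrite cards_eq0; apply/eqP/setP => p; rewrite !inE !perm1; case: ltngtP.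
Qed.

Lemma blenM x y : (blen (x * y) <= blen x + blen y)%N.
Proof.
rewrite -leq_double doubleD -!card_inv -(card_inv_shift x y).
apply: leq_trans (leq_card_setU _ _); apply: subset_leq_card.
apply/subsetP => p; rewrite invM in_setU [X in _ || X]inE.
by case: (_ \in inv x); case: (_ \in inv y).
Qed.

(** The prefix order is the weak order. [inv y] is the symmetric difference of [inv x] and a shift
    [B] of the inversions of [x^-1 * y]; lengths add up exactly when these are disjoint, that is,
    when [inv x] is contained in [inv y]. *)
Lemma gle_inv x y : gle blen x y = (inv x \subset inv y).
Proof.
pose B := [set p : 'I_n * 'I_n | (x p.1, x p.2) \in inv (x^-1 * y)].
have hy p : (p \in inv y) = (p \in inv x) (+) (p \in B).
  by rewrite [p \in B]inE -invM mulKVg.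
have cB : #|B| = (blen (x^-1 * y)).*2 by rewrite card_inv_shift card_inv.
have c : (#|inv y| + #|inv x :&: B|.*2 = #|inv x| + #|B|)%N.
  have -> : inv y = (inv x :\: B) :|: (B :\: inv x).
    by apply/setP => p; rewrite hy !in_setU !in_setD; case: (p \in inv x); case: (p \in B).
  have d : (inv x :\: B) :&: (B :\: inv x) = set0.
    by apply/setP => p; rewrite !in_setI !in_setD in_set0; case: (p \in inv x); case: (p \in B).
  rewrite cardsU d cards0 subn0.
  have := cardsID B (inv x); have := cardsID (inv x) B; rewrite (setIC B (inv x)).
  by move: #|inv x| #|B| #|inv x :&: B| #|B :\: inv x| #|inv x :\: B|; lia.
have -> : gle blen x y = (#|inv x :&: B| == 0%N).
  have -> : gle blen x y = (blen x + blen (x^-1 * y) == blen y)%N by [].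
  move: c; rewrite !card_inv cB.
  move: (blen y) (blen x) (blen (x^-1 * y)) #|inv x :&: B| => p q r s c.
  by apply/eqP/eqP; lia.
rewrite cards_eq0; apply/eqP/subsetP => [h p px|h].
  rewrite hy px /=; have := in_set0 p; rewrite -h in_setI px /= => /negbT.
  by [].
apply/setP => p; rewrite in_setI in_set0; apply/negP => /andP [h1 h2].
by have := h p h1; rewrite hy h1 h2.
Qed.

End Inversions.

(** Only tests whose left side contains no conditional are split, so nested conditionals are
    resolved from the inside out. *)
Ltac case_eqs := repeat match goal with
  | |- context [@eq_op ?T ?x ?y] =>
    lazymatch x with context [if _ then _ else _] => fail | _ =>
      case: (@eqVneq T x y) => ? /=; try (exfalso; lia)
    end
  end.

Section BraidGerm.
Import mathcomp.boot.fintype mathcomp.boot.finset.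
Variable m : nat.
Local Open Scope group_scope.
Notation n := m.+1.
Implicit Types (x y u : 'S_n) (i j k : 'I_m).

Definition lo i : 'I_n := widen_ord (leqnSn m) i.
Definition hi i : 'I_n := lift ord0 i.
Definition sg i : 'S_n := tperm (lo i) (hi i).
Definition w0 : 'S_n := perm (@rev_ord_inj n).
Definition desc i u : bool := (u (hi i) < u (lo i))%N.
Local Notation "x ⊑ y" := (gle (@blen n) x y) (at level 70).

Lemma val_lo i : lo i = i :> nat. Proof. by []. Qed.
Lemma val_hi i : hi i = i.+1 :> nat. Proof. by rewrite lift0. Qed.

Lemma lo_hi i : (lo i < hi i)%N. Proof. by rewrite val_hi. Qed.

Lemma val_sg i (p : 'I_n) : sg i p =
  (if p == i :> nat then i.+1 else if p == i.+1 :> nat then i : nat else p) :> nat.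
Proof.
rewrite /sg; case: tpermP => [->|->|h1 h2].
- by rewrite val_lo eqxx val_hi.
- by rewrite val_hi eqxx eqn_leq ltnn.
- rewrite ifF; last by apply/negP => /eqP e; apply: h1; apply: ord_inj.
  by rewrite ifF //; apply/negP => /eqP e; apply: h2; apply: ord_inj; rewrite val_hi.
Qed.

Lemma desc_inv i u : desc i u = ((lo i, hi i) \in inv u).
Proof. by rewrite inv_lt //= lo_hi. Qed.

Lemma inv_sg i : inv (sg i) = [set (lo i, hi i); (hi i, lo i)].
Proof.
apply/setP => -[p q]; rewrite in_set2 inE /= !xpair_eqE -!(inj_eq (@ord_inj n)).
rewrite !val_sg !val_hi val_lo.
move: (nat_of_ord p) (nat_of_ord q) (nat_of_ord i) => {p q i} p q i.
by case: (eqVneq p i) => h1; case: (eqVneq p i.+1) => h2;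
  case: (eqVneq q i) => h3; case: (eqVneq q i.+1) => h4 /=; lia.
Qed.

Lemma blen_sg i : blen (sg i) = 1%N.
Proof.
apply: double_inj; rewrite -card_inv inv_sg cards2 (_ : _ != _) //.
by rewrite xpair_eqE -(inj_eq (@ord_inj n)) val_hi /=; lia.
Qed.

Lemma sg_gle i u : (sg i ⊑ u) = desc i u.
Proof.
rewrite gle_inv inv_sg desc_inv subUset !sub1set.
by have /= -> := inv_swap u (lo i, hi i); rewrite andbb.
Qed.

Lemma desc_sgM i j u : desc j ((sg i)^-1 * u) = (u (sg i (hi j)) < u (sg i (lo j)))%N.
Proof. by rewrite /desc tpermV !permM. Qed.

Lemma homo_steps (f : 'I_n -> nat) : (forall i, (f (lo i) < f (hi i))%N) ->
  forall p q : 'I_n, (p < q)%N -> (f p < f q)%N.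
Proof.
move=> h p [q hq] /=; elim: q hq => // q IH hq pq.
have hq' : (q < m)%N by [].
have := h (Ordinal hq').
have -> : hi (Ordinal hq') = Ordinal hq by apply: ord_inj; rewrite val_hi.
apply: leq_trans; rewrite ltnS.
have hqn : (q < n)%N by apply: ltnW.
have -> : lo (Ordinal hq') = Ordinal hqn by apply: ord_inj.
move: pq; rewrite ltnS leq_eqVlt => /orP [/eqP e|/(IH hqn) /ltnW //].
by have -> : p = Ordinal hqn by apply: ord_inj.
Qed.

Lemma mono_perm1 u : (forall i, ~~ desc i u) -> u = 1.
Proof.
move=> h; have mono := @homo_steps (fun p => u p).
have {}mono : forall p q : 'I_n, (p < q)%N -> (u p < u q)%N.
  apply: mono => i; have := h i; rewrite /desc -leqNgt leq_eqVlt => /orP [/eqP|//].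
  by move/ord_inj/perm_inj => /(congr1 val) /=; rewrite /bump /= => e; lia.
have e : inv u = set0.
  apply/setP => p; rewrite in_set0; have [k|k|k] := ltngtP p.1 p.2.
  - by rewrite inv_lt // ltnNge ltnW // mono.
  - by rewrite -inv_swap inv_lt //= ltnNge ltnW // mono.
  - by rewrite inv_diag //; apply: ord_inj.
have b0 : blen u = 0%N by apply: double_inj; rewrite -card_inv e cards0.
have ge (p : 'I_n) : (p <= u p)%N.
  case: p => p hp /=; elim: p hp => // p IH hp.
  have hp' : (p < n)%N by apply: ltnW.
  by apply: leq_ltn_trans (IH hp') _; apply: mono.
have le (p : 'I_n) : (u p <= p)%N.
  have [k] := ubnP (m - p); elim: k p => // k IH p hk.
  have [pm|pm] := leqP m p; first by have := ltn_ord (u p); lia.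
  have hp : (p.+1 < n)%N by [].
  have := IH (Ordinal hp) ltac:(simpl; lia).
  by have := mono p (Ordinal hp) (ltnSn p) => /=; lia.
by apply/permP => p; rewrite perm1; apply: ord_inj; apply/eqP; rewrite eqn_leq ge le.
Qed.

Lemma blen_eq0 u : blen u = 0%N -> u = 1.
Proof.
move=> b0; apply: mono_perm1 => i; rewrite desc_inv.
have /eqP := card_inv u; rewrite b0 cards_eq0 => /eqP ->.
by rewrite in_set0.
Qed.

Lemma val_w0 (p : 'I_n) : w0 p = (m - p)%N :> nat.
Proof. by rewrite permE /= subSS. Qed.

Lemma gle_w0 u : u ⊑ w0.
Proof.
rewrite gle_inv; apply/subsetP => p; have [k|k|k] := ltngtP p.1 p.2.
- move=> _; rewrite inv_lt // !val_w0; move: k (ltn_ord p.2).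
  by move: (nat_of_ord p.1) (nat_of_ord p.2) => b c; lia.
- move=> _; rewrite -inv_swap inv_lt //= !val_w0; move: k (ltn_ord p.1).
  by move: (nat_of_ord p.1) (nat_of_ord p.2) => b c; lia.
- by rewrite inv_diag //; apply: ord_inj.
Qed.

Lemma desc_exists u : u <> 1 -> exists i, desc i u.
Proof.
move=> u1; apply: contrapT => no; apply: u1; apply: mono_perm1 => i.
by apply/negP => h; apply: no; exists i.
Qed.

Lemma all_desc u : (forall i, desc i u) -> u = w0.
Proof.
move=> h; have h2 : w0 ⊑ u.
  have dec (p q : 'I_n) : (p < q)%N -> (u q < u p)%N.
    move=> pq; have := @homo_steps (fun p => m - u p)%N _ p q pq.
    move=> /(_ _) k; have : (m - u p < m - u q)%N.
      apply: k => i; have := h i; rewrite /desc; have := ltn_ord (u (lo i)); lia.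
    by have := ltn_ord (u p); lia.
  rewrite gle_inv; apply/subsetP => p hp; have [k|k|k] := ltngtP p.1 p.2.
  - by rewrite inv_lt // dec.
  - by rewrite -inv_swap inv_lt //= dec.
  - by rewrite inv_diag // in hp; apply: ord_inj.
have h1 : inv u = inv w0.
  by apply/eqP; rewrite eqEsubset -!gle_inv h2 gle_w0.
have e : blen u = blen w0 by apply: double_inj; rewrite -!card_inv h1.
have /eqP h3 : (blen w0 + blen (w0^-1 * u) == blen u)%N := h2.
have : blen (w0^-1 * u) = 0%N by apply/eqP; rewrite -(eqn_add2l (blen w0)) h3 e addn0.
by move/blen_eq0 => k; rewrite -[u](mulKVg w0) k mulg1.
Qed.

Local Notation chain := (gchain sg (@blen n)).
Local Notation red := (reduced sg (@blen n)).

Ltac sg_lia := do ?rewrite val_sg; do ?rewrite val_hi; do ?rewrite val_lo; case_eqs; lia.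

Lemma braid_chain_word u w : chain u w -> gle (@blen n) (gprod sg w) u /\ red (gprod sg w) w.
Proof. by move=> /(gchainP (@blenM n) (@blen1 n) blen_sg) []. Qed.

(** This lemma and [chain_adj] serve twice: at [w0] they show that the word is reduced and simple,
    and at an arbitrary [u] with both descents they show that its product lies below [u], so that it
    is the join. *)
Lemma chain_far i j u : (i.+1 < j)%N \/ (j.+1 < i)%N -> desc i u -> desc j u ->
  chain u [:: i; j].
Proof.
move=> ij di dj; rewrite /= !sg_gle di andbT desc_sgM.
have f (p : 'I_n) : (p == j :> nat) || (p == j.+1 :> nat) -> sg i p = p.
  by move=> hp; apply: ord_inj; sg_lia.
by rewrite !f ?val_lo ?val_hi ?eqxx ?orbT.
Qed.

Lemma chain_adj i j u : (j = i.+1 :> nat) \/ (i = j.+1 :> nat) -> desc i u -> desc j u ->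
  chain u [:: i; j; i].
Proof.
rewrite /desc => ij di dj; rewrite /= !sg_gle /desc !andbT !tpermV !permM -/(sg _).
rewrite di /=; case: ij => ij.
- have e1 : sg i (hi j) = hi j by apply: ord_inj; sg_lia.
  have e2 : sg i (lo j) = lo i by apply: ord_inj; sg_lia.
  have e3 : sg j (hi i) = hi j by apply: ord_inj; sg_lia.
  have e4 : sg j (lo i) = lo i by apply: ord_inj; sg_lia.
  have e5 : sg i (lo i) = hi i by apply: tpermL.
  have e6 : hi i = lo j by apply: ord_inj; rewrite val_hi val_lo ij.
  rewrite e1 e2 e3 e4 e1 e5; rewrite e6 in di *; rewrite dj andbT.
  exact: ltn_trans dj di.
- have e1 : sg i (hi j) = hi i by apply: ord_inj; sg_lia.
  have e2 : sg i (lo j) = lo j by apply: ord_inj; sg_lia.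
  have e3 : sg j (lo i) = lo j by apply: ord_inj; sg_lia.
  have e4 : sg j (hi i) = hi i by apply: ord_inj; sg_lia.
  have e5 : sg i (hi i) = lo i by apply: tpermR.
  have e6 : lo i = hi j by apply: ord_inj; rewrite val_hi val_lo ij.
  rewrite e1 e2 e3 e4 e2 e5; rewrite e6 in di *; rewrite dj andbT.
  exact: ltn_trans di dj.
Qed.

Lemma gprod_far i j : (i.+1 < j)%N -> gprod sg [:: i; j] = gprod sg [:: j; i].
Proof.
move=> ij; apply/permP => p; rewrite /= !mulg1 !permM; apply: ord_inj.
by sg_lia.
Qed.

Lemma gprod_adj i j : j = i.+1 :> nat -> gprod sg [:: i; j; i] = gprod sg [:: j; i; j].
Proof.
move=> ij; apply/permP => p; rewrite /= !mulg1 !permM; apply: ord_inj.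
by sg_lia.
Qed.

Lemma desc_w0 i : desc i w0.
Proof. by rewrite -sg_gle gle_w0. Qed.

Lemma braid_g_rel (u v : seq 'I_m) : @braid_rel m.+1 u v -> exists x,
  [/\ x ⊑ w0, red x u & red x v].
Proof.
move=> [i [j [[ij [-> ->]]|[ij [-> ->]]]]].
- exists (gprod sg [:: i; j]).
  have [h1 h2] := braid_chain_word (chain_far (or_introl ij) (desc_w0 i) (desc_w0 j)).
  have [_ h3] := braid_chain_word (chain_far (or_intror ij) (desc_w0 j) (desc_w0 i)).
  by split=> //; rewrite gprod_far.
- exists (gprod sg [:: i; j; i]).
  have [h1 h2] := braid_chain_word (chain_adj (or_introl ij) (desc_w0 i) (desc_w0 j)).
  have [_ h3] := braid_chain_word (chain_adj (or_intror ij) (desc_w0 j) (desc_w0 i)).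
  by split=> //; rewrite gprod_adj.
Qed.

Lemma braid_g_join_lt i j : (i < j)%N -> exists (u v : seq 'I_m) x,
    [/\ x ⊑ w0, red x (i :: u), red x (j :: v),
        cong (@braid_rel m.+1) (i :: u) (j :: v) &
        forall y, y ⊑ w0 -> sg i ⊑ y -> sg j ⊑ y -> x ⊑ y].
Proof.
move=> ij; have [ij'|ij'] := ltnP i.+1 j.
- exists [:: j], [:: i], (gprod sg [:: i; j]).
  have [h1 h2] := braid_chain_word (chain_far (or_introl ij') (desc_w0 i) (desc_w0 j)).
  have [_ h3] := braid_chain_word (chain_far (or_intror ij') (desc_w0 j) (desc_w0 i)).
  split=> //; first by rewrite gprod_far.
    by apply: cong_rel; exists i, j; left.
  move=> y _; rewrite !sg_gle => di dj.
  by have [] := braid_chain_word (chain_far (or_introl ij') di dj).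
have e : j = i.+1 :> nat by lia.
exists [:: j; i], [:: i; j], (gprod sg [:: i; j; i]).
have [h1 h2] := braid_chain_word (chain_adj (or_introl e) (desc_w0 i) (desc_w0 j)).
have [_ h3] := braid_chain_word (chain_adj (or_intror e) (desc_w0 j) (desc_w0 i)).
split=> //; first by rewrite gprod_adj.
  by apply: cong_rel; exists i, j; right.
move=> y _; rewrite !sg_gle => di dj.
by have [] := braid_chain_word (chain_adj (or_introl e) di dj).
Qed.

Lemma braid_g_join i j : i <> j -> exists (u v : seq 'I_m) x,
    [/\ x ⊑ w0, red x (i :: u), red x (j :: v),
        cong (@braid_rel m.+1) (i :: u) (j :: v) &
        forall y, y ⊑ w0 -> sg i ⊑ y -> sg j ⊑ y -> x ⊑ y].
Proof.
move=> ij; have [k|k|k] := ltngtP i j.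
- exact: braid_g_join_lt.
- have [u [v [x [h1 h2 h3 h4 h5]]]] := braid_g_join_lt k.
  exists v, u, x; split=> //; first exact: cong_sym.
  by move=> y h6 h7 h8; apply: h5.
- by case: ij; apply: ord_inj.
Qed.

Lemma braid_g_atom x : x ⊑ w0 -> x <> 1 -> exists i, sg i ⊑ x.
Proof. by move=> _ /desc_exists [i h]; exists i; rewrite sg_gle. Qed.

Lemma braid_g_del x : x ⊑ w0 -> (forall i, sg i ⊑ x) -> x = w0.
Proof. by move=> _ h; apply: all_desc => i; rewrite -sg_gle. Qed.

Definition braid_germ : germ (braid_pres m.+1) := @Germ (braid_pres m.+1) ('S_n) sg (@blen n) w0
  (@blen1 n) blen_eq0 (@blenM n) blen_sg (fun i => gle_w0 (sg i)) braid_g_atom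
  (fun x y _ _ => gle_w0 (x^-1 * y)) braid_g_rel braid_g_join braid_g_del.

End BraidGerm.

(** * Strong connectivity for the braid monoid *)

Section RankPermutation.
Import mathcomp.boot.fintype mathcomp.boot.finset.
Variable m : nat.
Local Open Scope group_scope.
Notation n := m.+1.
Variables (f : 'I_n -> nat) (finj : injective f).

Definition rank_of (p : 'I_n) : 'I_n := inord #|[set q | (f q < f p)%N]|.
Arguments rank_of : simpl never.

Lemma val_rank_of p : rank_of p = #|[set q | (f q < f p)%N]| :> nat.
Proof.
rewrite inordK //; apply: (@leq_ltn_trans #|[set~ p]|).
  by apply: subset_leq_card; apply/subsetP => q; rewrite !inE; apply: contraTneq => ->; rewrite ltnn.
by have := cardsC1 p; rewrite card_ord => ->.
Qed.

Lemma rank_of_lt p q : (f p < f q)%N -> (rank_of p < rank_of q)%N.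
Proof.
move=> h; rewrite !val_rank_of; apply: proper_card; apply/properP; split.
  by apply/subsetP => r; rewrite !inE => h2; apply: ltn_trans h.
by exists p; rewrite !inE ?ltnn.
Qed.

Lemma rank_of_inj : injective rank_of.
Proof.
move=> p q e; apply: finj; case: (ltngtP (f p) (f q)) => // /rank_of_lt.
  by rewrite e ltnn.
by rewrite e ltnn.
Qed.

Definition rankp : 'S_n := perm rank_of_inj.

Lemma rankp_lt p q : (rankp p < rankp q)%N = (f p < f q)%N.
Proof.
rewrite !permE; apply/idP/idP; last exact: rank_of_lt.
rewrite ltnNge => h; rewrite ltnNge; apply: contra h; rewrite leq_eqVlt.
by case/orP => [/eqP /finj ->//|/rank_of_lt /ltnW].
Qed.

Lemma rankp_split (A : {set 'I_n}) p :
  (forall q r, q \in A -> r \notin A -> (f q < f r)%N) -> (rankp p < #|A|)%N = (p \in A).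
Proof.
move=> h; rewrite permE val_rank_of; have [pA|pA] := boolP (p \in A).
  apply: proper_card; apply/properP; split; last by exists p => //; rewrite inE ltnn.
  apply/subsetP => q; rewrite inE; apply: contraLR => qA.
  by rewrite -leqNgt ltnW // h.
apply/negbTE; rewrite -leqNgt; apply: subset_leq_card; apply/subsetP => q qA.
by rewrite inE h.
Qed.

End RankPermutation.

Section BraidConnected.
Import mathcomp.boot.fintype mathcomp.boot.finset.
Variable m : nat.
Local Open Scope group_scope.
Notation n := m.+1.
Implicit Types (x y z s t : 'S_n) (i j k v : 'I_m) (A : {set 'I_n}).
Local Notation sg := (@sg m).
Local Notation desc := (@desc m).
Local Notation G := (braid_germ m).
Local Notation nontriv := (@nontriv (braid_pres n) G).
Local Notation arr := (@arr (braid_pres n) G).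
Local Notation reach := (connect (edge nontriv arr)).

(** Products act from left to right, so descents of [t] are its left divisors among the atoms, and
    descents of [s^-1] are the right divisors of [s]. Passing to the complement in [w0] reverses
    values, so a right divisor of [s] can no longer be appended to it. *)
Lemma arr_desc s t : (forall i, desc i t -> desc i s^-1) -> arr s t.
Proof.
move=> h; apply/forallP => i; apply/implyP => /=; rewrite !sg_gle => /h.
rewrite /desc !permM !val_w0.
move: (s^-1 (hi i)) (s^-1 (lo i)) => b c; move: (ltn_ord b) (ltn_ord c).
by move: (nat_of_ord b) (nat_of_ord c); lia.
Qed.

Lemma proper_braid s : s <> 1 -> (exists j, ~~ desc j s) -> nontriv s.
Proof.
move=> s1 [j hj]; apply/and3P; split; [exact: gle_w0|exact/eqP|].
by apply/eqP => e; move: hj; rewrite e desc_w0.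
Qed.

Lemma proper_desc s : nontriv s -> (exists i, desc i s^-1) /\ exists j, ~~ desc j s.
Proof.
move=> /and3P [_ /eqP s1 /eqP sd]; split.
  by apply: desc_exists => e; apply: s1; rewrite -[s]invgK e invg1.
apply: contrapT => no; apply: sd; apply: all_desc => i; apply: contrapT => /negP h.
by apply: no; exists i.
Qed.

Lemma desc_neq1 i s : desc i s -> s <> 1.
Proof. by move=> h e; move: h; rewrite e /desc !perm1 val_lo val_hi; lia. Qed.

Lemma braid_reach_step s t : nontriv s -> nontriv t -> (forall i, desc i t -> desc i s^-1) -> reach s t.
Proof. by move=> h1 h2 h3; apply: connect1; rewrite /edge /= h1 h2 arr_desc. Qed.

Lemma desc_sg i j : desc i (sg j) = (i == j).
Proof.
rewrite /desc -(inj_eq (@ord_inj m)); do ?rewrite val_sg; rewrite !val_hi !val_lo.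
by case_eqs; lia.
Qed.

Hypothesis m2 : (1 < m)%N.

Lemma other_index j : exists i, i != j.
Proof.
have m0 : (0 < m)%N by apply: ltnW.
have [e|e] := eqVneq (Ordinal m0) j; last by exists (Ordinal m0).
by exists (Ordinal m2); rewrite -e.
Qed.

Lemma proper_sg i : nontriv (sg i).
Proof.
apply: proper_braid; first by apply: (@desc_neq1 i); rewrite desc_sg.
by have [j ji] := other_index i; exists j; rewrite desc_sg.
Qed.

(** The intermediate vertex [sg i * sg j] has [i] as only left descent and [j] among its right
    descents. *)
Lemma reach_adj i j : (j = i.+1 :> nat) \/ (i = j.+1 :> nat) -> reach (sg i) (sg j).
Proof.
move=> ij; pose w := sg i * sg j.
have d1 k : desc k w -> k = i.
  move=> h; apply: ord_inj; move: h; rewrite /desc /w !permM.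
  do ?rewrite val_sg; rewrite !val_hi !val_lo.
  by case: ij => ->; case_eqs; lia.
have d2 : desc j w^-1.
  rewrite /desc /w invMg !tpermV !permM; do ?rewrite val_sg; rewrite !val_hi !val_lo.
  by case: ij => ->; case_eqs; lia.
have pw : nontriv w.
  apply: proper_braid.
    by move=> e; have := desc_neq1 d2; rewrite e invg1.
  exists j; apply/negP => /d1 e; rewrite e in ij; lia.
apply: (connect_trans (y := w)).
  apply: braid_reach_step => //; first exact: proper_sg.
  by move=> k /d1 ->; rewrite tpermV desc_sg.
apply: braid_reach_step => //; first exact: proper_sg.
by move=> k; rewrite desc_sg => /eqP ->.
Qed.

Definition i0 : 'I_m := Ordinal (ltnW m2).

Lemma reach_atoms i : reach (sg i) (sg i0) /\ reach (sg i0) (sg i).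
Proof.
case: i => i hi; elim: i hi => [|i IH] hi.
  have -> : Ordinal hi = i0 by apply: ord_inj.
  by split; apply: connect0.
have hi' : (i < m)%N by apply: ltnW.
have [h1 h2] := IH hi'; split.
  by apply: connect_trans h1; apply: reach_adj; right.
by apply: (connect_trans h2); apply: reach_adj; left.
Qed.

Definition key_dec A (p : 'I_n) : nat := (if p \in A then 0 else n) + (m - p).
Definition key_inc A (p : 'I_n) : nat := (if p \in A then 0 else n) + p.

Lemma key_dec_inj A : injective (key_dec A).
Proof.
move=> p q; rewrite /key_dec => e; apply: ord_inj; move: e (ltn_ord p) (ltn_ord q).
by case: ifP => _; case: ifP => _; lia.
Qed.

Lemma key_inc_inj A : injective (key_inc A).
Proof.
move=> p q; rewrite /key_inc => e; apply: ord_inj; move: e (ltn_ord p) (ltn_ord q).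
by case: ifP => _; case: ifP => _; lia.
Qed.

(** Both send [A] onto the lowest values. [zdec A] reverses each of the two blocks, so its right
    descents are all indices except the one at [#|A|]; [zinc A] keeps each block increasing, a
    Grassmannian permutation whose only possible right descent is there. *)
Definition zdec A : 'S_n := rankp (@key_dec_inj A).
Definition zinc A : 'S_n := rankp (@key_inc_inj A).

Lemma zdec_split A p : (zdec A p < #|A|)%N = (p \in A).
Proof.
by apply: rankp_split => q r qA rA; rewrite /key_dec qA (negbTE rA); have := ltn_ord q; lia.
Qed.

Lemma zinc_split A p : (zinc A p < #|A|)%N = (p \in A).
Proof.
by apply: rankp_split => q r qA rA; rewrite /key_inc qA (negbTE rA); have := ltn_ord q; lia.
Qed.

Lemma zdec_desc A i : lo i \in A -> hi i \notin A -> ~~ desc i (zdec A).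
Proof.
move=> h1 h2; rewrite /desc rankp_lt /key_dec h1 (negbTE h2) -leqNgt.
by have := ltn_ord (lo i); lia.
Qed.

Lemma zdec_invdesc A v : v.+1 != #|A| -> desc v (zdec A)^-1.
Proof.
move=> hv; rewrite /desc; set p := _ (hi v); set p' := _ (lo v).
have e : zdec A p = hi v by rewrite permKV.
have e' : zdec A p' = lo v by rewrite permKV.
have : (zdec A p' < zdec A p)%N by rewrite e e' lo_hi.
have : (p \in A) = (p' \in A).
  by rewrite -!zdec_split e e' val_hi val_lo; apply/idP/idP; lia.
rewrite rankp_lt /key_dec => ->; case: ifP => _; lia.
Qed.

Lemma zinc_desc A i : lo i \notin A -> hi i \in A -> desc i (zinc A).
Proof.
move=> h1 h2; rewrite /desc rankp_lt /key_inc h2 (negbTE h1).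
by have := ltn_ord (hi i); lia.
Qed.

Lemma zinc_invdesc A v : desc v (zinc A)^-1 -> v.+1 = #|A|.
Proof.
move=> h; apply/eqP; apply: contraLR h => hv; rewrite /desc -leqNgt.
set p := _ (hi v); set p' := _ (lo v).
have e : zinc A p = hi v by rewrite permKV.
have e' : zinc A p' = lo v by rewrite permKV.
have : (zinc A p' < zinc A p)%N by rewrite e e' lo_hi.
have : (p \in A) = (p' \in A).
  by rewrite -!zinc_split e e' val_hi val_lo; apply/idP/idP; lia.
rewrite rankp_lt /key_inc => ->; case: ifP => _; lia.
Qed.

Lemma set_between (p q : 'I_n) (k : nat) : p != q -> (0 < k <= m)%N ->
  exists A, [/\ #|A| = k, p \in A & q \notin A].
Proof.
move=> pq; elim: k => // k IH /andP [_ km]; have [k0|k0] := posnP k.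
  by exists [set p]; rewrite cards1 k0 !inE eqxx eq_sym.
have [|A [cA pA qA]] := IH; first by rewrite k0 ltnW.
have : (#|q |: A| < #|[set: 'I_n]|)%N by rewrite cardsU1 qA cA cardsT card_ord; lia.
move=> h; have [r _ hr] : exists2 r, r \in [set: 'I_n] & r \notin q |: A.
  by apply/subsetPn; apply/negP => /subset_leq_card; rewrite leqNgt h.
move: hr; rewrite !inE negb_or => /andP [rq rA].
by exists (r |: A); rewrite cardsU1 rA cA !inE pA orbT negb_or eq_sym rq qA.
Qed.

Lemma card_index A (p q : 'I_n) : p \in A -> q \notin A -> exists v, v.+1 = #|A|.
Proof.
move=> pA qA; have c0 : (0 < #|A|)%N by apply/card_gt0P; exists p.
have cm : (#|A| <= m)%N.
  rewrite -ltnS -[X in (_ < X)%N](card_ord n) -cardsT; apply: proper_card.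
  by apply/properP; split; [exact: subsetT|exists q].
have h : (#|A|.-1 < m)%N by rewrite prednK.
by exists (Ordinal h); rewrite /= prednK.
Qed.

Lemma zdec_proper A i : lo i \in A -> hi i \notin A -> nontriv (zdec A).
Proof.
move=> h1 h2; apply: proper_braid; last by exists i; apply: zdec_desc.
have [v hv] := card_index h1 h2; have [u uv] := other_index v.
have /zdec_invdesc /desc_neq1 h : u.+1 != #|A|.
  by rewrite -hv eqSS -(inj_eq (@ord_inj m)) in uv *.
by move=> e; apply: h; rewrite e invg1.
Qed.

Definition evens (k : nat) : {set 'I_n} := [set p : 'I_n | ~~ odd p & (p < k)%N].

Lemma evens_mem (k : nat) (p : 'I_n) : (p \in evens k) = ~~ odd p && (p < k)%N.
Proof. by rewrite inE. Qed.

Lemma lo_evens (k : nat) i : (i < k)%N -> (lo i \in evens k) = ~~ odd i.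
Proof. by rewrite evens_mem val_lo => ->; rewrite andbT. Qed.

Lemma hi_evens (k : nat) i : (i.+1 < k)%N -> (hi i \in evens k) = odd i.
Proof. by rewrite evens_mem val_hi => ->; rewrite andbT /= negbK. Qed.

Lemma hi_evens_even (k : nat) i : ~~ odd i -> hi i \notin evens k.
Proof. by move=> h; rewrite evens_mem val_hi /= h. Qed.

(** The path is found from its end. [y] lacks a left descent [j], so [zdec A1] with [#|A1|] equal to
    [j.+1] may precede it. [A1] is chosen to lack the left descent [v] given by [#|A2|], so
    [zdec A2] may precede [zdec A1]. As [A2] consists of even points, its left descents are odd; the
    inverse Grassmannian [z3] has all odd right descents and [b] as only left descent, so [sg b] may
    precede it. *)
Lemma braid_reach_to y : nontriv y -> reach (sg i0) y.
Proof.
move=> hy; have [_ [j hj]] := proper_desc hy.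
pose A2 := evens m; pose L := evens n.
have e1 : lo i0 \in A2 by rewrite lo_evens // ltnW.
have e2 : hi i0 \notin A2 by apply: hi_evens_even.
have f1 : lo i0 \in L by rewrite lo_evens // ltnW // ltnW.
have f2 : hi i0 \notin L by apply: hi_evens_even.
have [v hv] := card_index e1 e2; have [b hb] := card_index f1 f2.
have [|A1 [c1 a1 a2]] := @set_between (lo v) (hi v) j.+1 _ (ltn_ord j).
  by rewrite -(inj_eq (@ord_inj n)) val_hi val_lo; lia.
have p1 := zdec_proper a1 a2; have p2 := zdec_proper e1 e2.
pose z3 := (zinc L)^-1.
have d3 k : desc k z3 -> k = b.
  by move=> /zinc_invdesc; rewrite -hb => -[] /ord_inj.
have p3 : nontriv z3.
  apply: proper_braid; last first.
    by have [u ub] := other_index b; exists u; apply/negP => /d3 e; rewrite e eqxx in ub.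
  have h : desc (Ordinal m2) (zinc L) by apply: zinc_desc; rewrite ?lo_evens ?hi_evens //= ltnW.
  by move=> e; apply: (desc_neq1 h); rewrite -[zinc L]invgK -/z3 e invg1.
apply: (connect_trans (y := sg b)); first by have [_] := reach_atoms b.
apply: (connect_trans (y := z3)).
  by apply: braid_reach_step => //; [exact: proper_sg|move=> i /d3 ->; rewrite tpermV desc_sg].
apply: (connect_trans (y := zdec A2)).
  apply: braid_reach_step => // i hi2; rewrite /z3 invgK.
  have oi : odd i.
    apply: contraLR hi2 => ei; apply: zdec_desc; first by rewrite lo_evens.
    exact: hi_evens_even.
  apply: zinc_desc; last by rewrite hi_evens ?oi // ltnS.
  by rewrite lo_evens ?oi //; apply: ltn_trans (ltn_ord i) _.
apply: (connect_trans (y := zdec A1)).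
  apply: braid_reach_step => // i hi1; apply: zdec_invdesc; apply: contraLR hi1.
  rewrite negbK -hv eqSS => /eqP /ord_inj ->; exact: zdec_desc.
apply: braid_reach_step => // i hi0; apply: zdec_invdesc; rewrite c1 eqSS.
by apply: contraTneq hi0 => /ord_inj ->.
Qed.

Lemma braid_reach_from x : nontriv x -> reach x (sg i0).
Proof.
move=> hx; have [[i hi] _] := proper_desc hx.
apply: (connect_trans (y := sg i)); last by have [] := reach_atoms i.
by apply: braid_reach_step => //; [exact: proper_sg|move=> k; rewrite desc_sg => /eqP ->].
Qed.

End BraidConnected.

Lemma braid_connected m : (0 < m)%N -> germ_connected (braid_germ m).
Proof.
case: m => // m _; case: m => [|m]; last first.
  have m2 : (1 < m.+2)%N by [].
  right; exists (i0 m2); split; first exact: proper_sg.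
    by apply: arr_desc => i; rewrite tpermV.
  by move=> s hs; split; [apply: braid_reach_from|apply: braid_reach_to].
left; have -> : gdel (braid_germ 1) = sg ord0; last exact: blen_sg.
by apply/esym/all_desc => i; rewrite desc_sg ord1.
Qed.

(** * Noncrossing permutations as germ of the dual braid monoid *)

Section Orbits.
Import mathcomp.boot.fintype mathcomp.boot.finset.
Variable m : nat.
Local Open Scope group_scope.
Notation n := m.+1.
Implicit Types (x y z u : 'S_n) (a b c i j k : 'I_n).

Definition orb u a b : bool := a \in porbit u b.

Lemma orb_refl u a : orb u a a. Proof. exact: porbit_id. Qed.
Lemma orb_sym u a b : orb u a b = orb u b a. Proof. exact: porbit_sym. Qed.

Lemma orb_eq u a b c : orb u a b -> orb u a c = orb u b c.
Proof. by rewrite /orb -!eq_porbit_mem => /eqP ->. Qed.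

Lemma orb_step u a b : orb u (u a) b = orb u a b.
Proof. by apply: orb_eq; have := mem_porbit u 1 a; rewrite expg1. Qed.

Lemma orb_invariant (T : Type) (f : 'I_n -> T) u a b :
  (forall c, f (u c) = f c) -> orb u a b -> f a = f b.
Proof.
move=> h /porbitP [e ->]; elim: e => [|e IH]; first by rewrite perm1.
by rewrite expgSr permM h.
Qed.

(** The conclusion, read as a function of [a], is invariant under [tperm i j * u]: a transposition
    can merge only the orbits of [i] and [j]. *)
Lemma orb_merge u i j a b : orb (tperm i j * u) a b ->
  orb u a b || ((orb u a i || orb u a j) && (orb u b i || orb u b j)).
Proof.
move=> h; pose f c := orb u c b || ((orb u c i || orb u c j) && (orb u b i || orb u b j)).
suff e : f a = f b by rewrite -/(f a) e /f orb_refl.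
apply: orb_invariant h => c; rewrite permM /f !orb_step.
case: tpermP => [->|->|//]; rewrite !orb_refl (orb_sym u i b) (orb_sym u j b) ?orbT /=;
  by case: (orb u b i); case: (orb u b j); rewrite ?orbT ?andbF.
Qed.

Lemma orb_split u i j a b : orb u i j -> orb (tperm i j * u) a b -> orb u a b.
Proof.
move=> ij /orb_merge /orP [//|/andP [h1 h2]].
have h c : orb u c i || orb u c j -> orb u i c.
  by case/orP; rewrite orb_sym // -(orb_eq _ ij).
by rewrite -(orb_eq _ (h _ h1)) h.
Qed.

Definition dlen u : nat := n - #|porbits u|.

Lemma card_porbits u : (#|porbits u| <= n)%N.
Proof. by rewrite -[X in (_ <= X)%N](card_ord n); exact: leq_imset_card. Qed.

Lemma card_porbits_gt0 u : (0 < #|porbits u|)%N.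
Proof. by apply/card_gt0P; exists (porbit u ord0); apply: imset_f. Qed.

Lemma dlen_tpermM i j u : i != j -> orb u i j -> dlen u = (dlen (tperm i j * u)).+1.
Proof.
move=> ij h; have := porbits_mul_tperm u i j; rewrite /= ij.
have -> : (i \in porbit u j) by [].
have := card_porbits (tperm i j * u); have := card_porbits u; rewrite /dlen.
by move: #|porbits u| #|porbits (tperm i j * u)|; lia.
Qed.

Lemma dlen_tpermM_out i j u : ~~ orb u i j -> dlen (tperm i j * u) = (dlen u).+1.
Proof.
move=> h; have ij : i != j by apply: contraNneq h => ->; apply: orb_refl.
have := porbits_mul_tperm u i j; rewrite /= ij.
have -> : (i \in porbit u j) = false by apply: negbTE.
have := card_porbits_gt0 (tperm i j * u); have := card_porbits u; rewrite /dlen.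
by move: #|porbits u| #|porbits (tperm i j * u)|; lia.
Qed.

Lemma dlen_tpermM_le i j u : (dlen (tperm i j * u) <= (dlen u).+1)%N.
Proof.
have [->|ij] := eqVneq i j; first by rewrite tperm1 mul1g.
case: (boolP (orb u i j)) => h; last by rewrite dlen_tpermM_out.
by rewrite (dlen_tpermM ij h); lia.
Qed.

Lemma moved_point u : u <> 1 -> exists i, i != u i.
Proof.
move=> h; apply: contrapT => no; apply: h; apply/permP => i; rewrite perm1.
by apply/eqP; rewrite eq_sym; apply: contrapT => /negP e; apply: no; exists i.
Qed.

Lemma orb_image u i : orb u i (u i).
Proof. by rewrite orb_sym orb_step orb_refl. Qed.

Lemma dlen_eq0 u : dlen u = 0%N -> u = 1.
Proof.
move=> h; apply: contrapT => /moved_point [i hi].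
by have := dlen_tpermM hi (orb_image u i); rewrite h.
Qed.

Lemma dlen1 : dlen 1 = 0%N.
Proof.
suff : #|porbits (1 : 'S_n)| = n by rewrite /dlen => ->; rewrite subnn.
rewrite card_imset ?card_ord // => a b /eqP; rewrite eq_porbit_mem => /porbitP [k ->].
by rewrite expg1n perm1.
Qed.

Lemma dlen_ind (Q : 'S_n -> Prop) : Q 1 ->
  (forall i j u, i != j -> orb u i j -> Q (tperm i j * u) -> Q u) -> forall u, Q u.
Proof.
move=> Q1 Qs u; have [k] := ubnP (dlen u); elim: k u => // k IH u hk.
have [->//|/eqP /moved_point [i hi]] := eqVneq u 1.
have h := orb_image u i; apply: (Qs _ _ _ hi h); apply: IH.
by move: hk; rewrite (dlen_tpermM hi h).
Qed.

Lemma dlenM x y : (dlen (x * y) <= dlen x + dlen y)%N.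
Proof.
elim/dlen_ind: x => [|i j x ij h IH]; first by rewrite mul1g dlen1.
rewrite (dlen_tpermM ij h) addSn; apply: leq_trans (_ : _ <= (dlen (tperm i j * x * y)).+1)%N _; last by [].
by have := dlen_tpermM_le i j (tperm i j * x * y); rewrite -!mulgA tpermKg.
Qed.

Lemma dlenJ x y : (dlen (x ^ y) <= dlen x)%N.
Proof.
elim/dlen_ind: x => [|i j x ij h IH]; first by rewrite conj1g dlen1.
rewrite (dlen_tpermM ij h); apply: leq_trans (_ : _ <= (dlen ((tperm i j * x) ^ y)).+1)%N _; last by [].
have := dlen_tpermM_le (y i) (y j) ((tperm i j * x) ^ y).
by rewrite -tpermJ -conjMg tpermKg.
Qed.

Lemma dlen_tperm i j : i != j -> dlen (tperm i j) = 1%N.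
Proof.
move=> ij; rewrite -[tperm i j]mulg1 dlen_tpermM_out ?dlen1 //.
by apply: contra ij => /porbitP [k ->]; rewrite expg1n perm1.
Qed.

Local Notation "x ⊑ y" := (gle dlen x y) (at level 70).

Lemma tperm_gle i j u : i != j -> (tperm i j ⊑ u) = orb u i j.
Proof.
move=> ij; rewrite /gle tpermV dlen_tperm //; case: (boolP (orb u i j)) => h.
  by rewrite (dlen_tpermM ij h) add1n eqxx.
by rewrite dlen_tpermM_out //; lia.
Qed.

Lemma orb_gle x y a b : x ⊑ y -> orb x a b -> orb y a b.
Proof.
move=> xy; have [->|ab] := eqVneq a b; first by rewrite !orb_refl.
by rewrite -!tperm_gle // => h; have [] := gle_sub_gen dlenM h xy.
Qed.

(* If [z = x y w] then [y^-1 z = x^y w]: the germ is balanced. *)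
Lemma gle_right x y z : x ⊑ y -> y ⊑ z -> x^-1 * y ⊑ z.
Proof.
move=> /eqP h1 /eqP h2; set p := x^-1 * y in h1 *.
have e : p^-1 * z = x ^ p * (y^-1 * z) by rewrite /p conjgE invMg invgK -!mulgA !mulKVg.
have h3 := dlenM (x ^ p) (y^-1 * z); rewrite -e in h3.
have h4 := dlenJ x p; have h5 := dlenM p (p^-1 * z); rewrite mulKVg in h5.
rewrite /gle; move: h1 h2 h3 h4 h5.
move: (dlen (p^-1 * z)) (dlen (y^-1 * z)) (dlen (x ^ p)) (dlen x) (dlen y) (dlen z) (dlen p).
by move=> d1 d2 d3 d4 d5 d6 d7 h1 h2 h3 h4 h5; apply/eqP; lia.
Qed.

Lemma card_porbits1 u : (forall a b, orb u a b) -> dlen u = m.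
Proof.
move=> h; suff : #|porbits u| = 1%N by rewrite /dlen => ->; rewrite subn1.
apply/eqP/cards1P; exists (porbit u ord0); apply/setP => A; rewrite in_set1.
apply/imsetP/eqP => [[a _ ->]|->]; last by exists ord0.
by apply/eqP; rewrite eq_porbit_mem; exact: h.
Qed.

(** A point moved downwards is the upper end of a 2-cycle; undoing that cycle lowers both sides by
    one. *)
Lemma dlen_involution u : (forall a, u (u a) = a) ->
  (dlen u <= #|[set a | (u a < a)%N]|)%N.
Proof.
have [k] := ubnP #|[set a | (u a < a)%N]|; elim: k u => // k IH u hk uK.
have [/existsP [a ha]|/existsPn no] := boolP [exists a, (u a < a)%N]; last first.
  have -> : u = 1; last by rewrite dlen1.
  apply/permP => a; rewrite perm1; apply: ord_inj.
  by have := no a; have := no (u a); rewrite uK; lia.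
have e c : (tperm a (u a) * u) c = if (c == a) || (c == u a) then c else u c.
  rewrite permM; case: tpermP => [->|->|/eqP h1 /eqP h2]; rewrite ?uK ?eqxx ?orbT //.
  by rewrite (negbTE h1) (negbTE h2).
have cE : [set c | (u c < c)%N] = a |: [set c | ((tperm a (u a) * u)%g c < c)%N].
  apply/setP => c; rewrite !inE e; have [->|ca] := eqVneq c a; first by rewrite ha.
  have [->|//] := eqVneq c (u a); rewrite uK /= ltnn.
  by apply/negbTE; rewrite -leqNgt ltnW.
have aN : a \notin [set c | ((tperm a (u a) * u)%g c < c)%N] by rewrite inE e eqxx ltnn.
move: hk; rewrite cE cardsU1 aN /= ltnS => hk.
have := IH (tperm a (u a) * u) hk _.
have -> : dlen u = (dlen (tperm a (u a) * u)).+1.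
  by apply: dlen_tpermM (orb_image u a); apply: contraTneq ha => <-; rewrite ltnn.
move=> h; rewrite add1n ltnS; apply: h => c; rewrite [in LHS]e e.
have [->|ca] /= := eqVneq c a; first by rewrite eqxx.
have [->|cu] /= := eqVneq c (u a); first by rewrite eqxx orbT.
by rewrite uK -(inj_eq (@perm_inj _ u)) uK (negbTE cu) (inj_eq (@perm_inj _ u)) (negbTE ca).
Qed.

End Orbits.

Section DualGerm.
Import mathcomp.boot.fintype mathcomp.boot.finset.
Variable m : nat.
Local Open Scope group_scope.
Notation n := m.+1.
Implicit Types (x y z u : 'S_n) (a b c i j k l : 'I_n) (g h : dgen n).
Local Notation dlen := (@dlen m).
Local Notation "x ⊑ y" := (gle dlen x y) (at level 70).

(** The cycle runs downwards because products act from left to right: for i < j < k, the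
    transposition (i j) followed by (j k) sends k to j, j to i and i to k. *)
Definition cyc : 'S_n := perm (@ord_pred_inj n).
Definition tau g : 'S_n := tperm (val g).1 (val g).2.
Definition mkg i j (ij : (i < j)%N) : dgen n := exist _ (i, j) ij.

Lemma val_cyc a : cyc a = (if a == 0 :> nat then m else a.-1) :> nat.
Proof.
rewrite permE /=; case: a => a ha /=; case: eqVneq => [->|a0] /=.
  by rewrite modn_small.
have -> : (a + m.+1).-1 = (a.-1 + m.+1)%N by lia.
by rewrite modnDr modn_small //; lia.
Qed.

Lemma orb_cyc a b : orb cyc a b.
Proof.
have h c : orb cyc c ord0.
  case: c => c hc; elim: c hc => [|c IH] hc.
    by have -> : Ordinal hc = ord0 by [apply: ord_inj]; apply: orb_refl.
  rewrite -orb_step (_ : cyc _ = Ordinal (ltnW hc)) ?IH //.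
  by apply: ord_inj; rewrite val_cyc.
by rewrite (orb_eq _ (h a)) orb_sym.
Qed.

Lemma tau_neq g : (val g).1 != (val g).2.
Proof. by rewrite -(inj_eq (@ord_inj n)) neq_ltn (valP g). Qed.

Lemma tau_gle g u : (tau g ⊑ u) = orb u (val g).1 (val g).2.
Proof. by rewrite tperm_gle // tau_neq. Qed.

Lemma dlen_tau g : dlen (tau g) = 1%N.
Proof. by rewrite dlen_tperm // tau_neq. Qed.

Lemma tau_del g : tau g ⊑ cyc.
Proof. by rewrite tau_gle orb_cyc. Qed.

Lemma dlen_cyc : dlen cyc = m.
Proof. by apply: card_porbits1 => a b; apply: orb_cyc. Qed.

Lemma orb_atom u a b : a != b -> orb u a b ->
  exists g, [/\ tau g ⊑ u & tau g = tperm a b].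
Proof.
rewrite -(inj_eq (@ord_inj n)) neq_ltn => /orP [] ab h.
  by exists (mkg ab); rewrite tau_gle.
by exists (mkg ab); rewrite tau_gle orb_sym tpermC.
Qed.

Lemma dual_g_atom x : x ⊑ cyc -> x <> 1 -> exists g, tau g ⊑ x.
Proof.
move=> _ /moved_point [i hi].
by have [g [h _]] := orb_atom hi (orb_image x i); exists g.
Qed.

Lemma dual_g_right x y : x ⊑ y -> y ⊑ cyc -> x^-1 * y ⊑ cyc.
Proof. exact: gle_right. Qed.

Lemma dual_g_del x : x ⊑ cyc -> (forall g, tau g ⊑ x) -> x = cyc.
Proof.
move=> xd h; have o a b : orb x a b.
  have [->|] := eqVneq a b; first exact: orb_refl.
  rewrite -(inj_eq (@ord_inj n)) neq_ltn => /orP [] ab; have := h (mkg ab).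
    by rewrite tau_gle.
  by rewrite tau_gle orb_sym.
have /eqP := xd; rewrite dlen_cyc (card_porbits1 o) => e.
have /dlen_eq0 e' : dlen (x^-1 * cyc) = 0%N by apply/eqP; rewrite -(eqn_add2l m) e addn0.
by rewrite -(mulKVg x cyc) e' mulg1.
Qed.

(* [tau g * cyc] and [cyc * tau g] preserve the arcs [i, j) and (i, j]. *)
Definition in_arc g a : bool := ((val g).1 <= a < (val g).2)%N.
Definition in_arc' g a : bool := ((val g).1 < a <= (val g).2)%N.

Lemma val_tperm i j a : tperm i j a =
  (if a == i :> nat then j : nat else if a == j :> nat then i : nat else a) :> nat.
Proof.
case: tpermP => [->|->|/eqP h1 /eqP h2]; rewrite ?eqxx //; first by case: eqVneq => // ->.
by rewrite !(inj_eq (@ord_inj n)) (negbTE h1) (negbTE h2).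
Qed.

Lemma arc_cyc g a : in_arc g ((tau g * cyc) a) = in_arc g a.
Proof.
case: g => -[i j] /= ij; rewrite /in_arc /tau permM val_cyc val_tperm /=.
move: ij (ltn_ord j); move: (nat_of_ord i) (nat_of_ord j) (nat_of_ord a) => p q r.
by case_eqs; lia.
Qed.

Lemma arc'_cyc g a : in_arc' g ((cyc * tau g) a) = in_arc' g a.
Proof.
case: g => -[i j] /= ij; rewrite /in_arc' /tau permM val_tperm val_cyc /=.
move: ij (ltn_ord j) (ltn_ord a); move: (nat_of_ord i) (nat_of_ord j) (nat_of_ord a) => p q r.
by case_eqs; lia.
Qed.

Lemma arc_orb g x k l : tau g ⊑ x -> x ⊑ cyc -> orb (tau g * x) k l -> in_arc g k = in_arc g l.
Proof.
move=> h1 h2 h; apply: orb_invariant (@arc_cyc g) _.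
by apply: orb_gle h; have [] := gle_sub_gen (@dlenM m) h1 h2; rewrite tpermV.
Qed.

(** Multiplication by [tau g] cuts the orbit through the ends of [g] along the arc of [g]: what is
    joined to one end lies inside the arc, what is joined to the other lies outside. *)
Lemma same_arc g x k l : tau g ⊑ x -> x ⊑ cyc -> orb x k l -> in_arc g k = in_arc g l ->
  orb (tau g * x) k l.
Proof.
move=> h1 h2 kl e; set y := tau g * x.
have xE : x = tau g * y by rewrite /y /tau tpermKg.
have hk a : orb y a (val g).1 || orb y a (val g).2 -> orb y a (if in_arc g a then (val g).1 else (val g).2).
  case/orP => h; rewrite (arc_orb h1 h2 h).
    by rewrite /in_arc leqnn (valP g).
  by rewrite /in_arc ltnn andbF.
rewrite xE in kl; case/orb_merge/orP: kl => [//|/andP [/hk k1 /hk l1]].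
by rewrite -e in l1; rewrite (orb_eq _ k1) orb_sym.
Qed.

(* The orbits of an element below [cyc] do not cross. *)
Lemma crossing g x k l : tau g ⊑ x -> x ⊑ cyc -> orb x k l -> in_arc g k != in_arc g l ->
  orb x (val g).1 k.
Proof.
move=> h1 h2 kl ne; set y := tau g * x.
have ij := h1; rewrite tau_gle in ij.
have xE : x = tau g * y by rewrite /y /tau tpermKg.
have yx a b : orb y a b -> orb x a b by apply: orb_split.
rewrite xE in kl; case/orb_merge/orP: kl => [h|/andP [/orP [] h _]].
- by rewrite (arc_orb h1 h2 h) eqxx in ne.
- by rewrite orb_sym yx.
- by rewrite (orb_eq _ ij) orb_sym yx.
Qed.

Local Notation chain := (gchain tau dlen).
Local Notation red := (reduced tau dlen).

Lemma chain1 x g : chain x [:: g] = orb x (val g).1 (val g).2.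
Proof. by rewrite /= tau_gle andbT. Qed.

Lemma chain_cons x g w : chain x (g :: w) = orb x (val g).1 (val g).2 && chain (tau g * x) w.
Proof. by rewrite /= tau_gle tpermV. Qed.

Lemma chain2 x g h : x ⊑ cyc -> orb x (val g).1 (val g).2 -> orb x (val h).1 (val h).2 ->
  in_arc g (val h).1 = in_arc g (val h).2 -> chain x [:: g; h].
Proof.
by move=> xd hg hh e; rewrite chain_cons hg chain1 same_arc // tau_gle.
Qed.

Lemma gprod_tri g h f : (val g).1 = (val f).1 -> (val g).2 = (val h).1 ->
  (val h).2 = (val f).2 -> tau g * tau h = tau h * tau f /\ tau h * tau f = tau f * tau g.
Proof.
case: g h f => [[i j] /= ij] [[j' k] /= jk] [[i' k'] /= ik] e1 e2 e3.
subst i' j' k'; rewrite /tau /=.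
by split; apply/permP => a; apply: ord_inj; rewrite !permM; do ?rewrite val_tperm;
  move: ij jk; move: (nat_of_ord i) (nat_of_ord j) (nat_of_ord k) (nat_of_ord a) => p q r s;
  case_eqs; lia.
Qed.

Definition apart g h : bool :=
  ((val g).1 < (val g).2)%N && ((val g).2 < (val h).1)%N && ((val h).1 < (val h).2)%N ||
  ((val g).1 < (val h).1)%N && ((val h).1 < (val h).2)%N && ((val h).2 < (val g).2)%N.

Lemma gprod_apart g h : apart g h -> tau g * tau h = tau h * tau g.
Proof.
case: g h => [[i j] /= ij] [[k l] /= kl]; rewrite /apart /tau /= => hgh.
apply/permP => a; apply: ord_inj; rewrite !permM; do ?rewrite val_tperm.
by move: hgh; move: (nat_of_ord i) (nat_of_ord j) (nat_of_ord k) (nat_of_ord l) (nat_of_ord a) => p q r s t;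
  case_eqs; lia.
Qed.

Lemma dual_rel_gprod (u v : seq (dgen n)) : dual_rel u v -> gprod tau u = gprod tau v.
Proof.
case=> [[g [h [f [e1 [e2 [e3 e4]]]]]]|[g [h [e [-> ->]]]]] /=; rewrite ?mulg1.
  by have [h1 h2] := gprod_tri e1 e2 e3; case: e4 => -[-> ->] /=; rewrite !mulg1.
by apply: gprod_apart; apply/orP.
Qed.

Lemma dual_cong_gprod (u v : seq (dgen n)) : cong (@dual_rel n) u v -> gprod tau u = gprod tau v.
Proof.
elim=> {u v} [u v /dual_rel_gprod //|//|u v _ -> //|u v w _ -> _ -> //|w u v w' _ e].
by rewrite !gprod_cat e.
Qed.

Lemma dual_chain_word x w : chain x w -> red (gprod tau w) w /\ gprod tau w ⊑ x.
Proof. by move=> /(gchainP (@dlenM m) (@dlen1 m) dlen_tau) []. Qed.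

Lemma red_cong x (u v : seq (dgen n)) : red x u -> cong (@dual_rel n) u v -> red x v.
Proof.
move=> [h1 h2] uv; split; first by rewrite -(dual_cong_gprod uv).
by rewrite h2; exact: (@cong_size (dual_pres n)) uv.
Qed.

Lemma dual_rel_chain (u v : seq (dgen n)) : dual_rel u v -> chain cyc u.
Proof.
case=> [[g [h [f [e1 [e2 [e3 e4]]]]]]|[g [h [e [-> _]]]]].
  case: g h f e1 e2 e3 e4 => [[i j] /= ij] [[j' k] /= jk] [[i' k'] /= ik] e1 e2 e3.
  subst i' j' k' => -[] [-> _]; apply: chain2; rewrite ?orb_cyc // /in_arc /=; try lia;
    by rewrite /gle mulVg dlen1 addn0.
apply: chain2; rewrite ?orb_cyc //; first by rewrite /gle mulVg dlen1 addn0.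
by move: e; case: g h => [[i j] /= ij] [[k l] /= kl]; rewrite /in_arc /=; lia.
Qed.

Lemma dual_g_rel (u v : seq (dgen n)) : dual_rel u v -> exists x,
  [/\ x ⊑ cyc, red x u & red x v].
Proof.
move=> uv; have [h1 h2] := dual_chain_word (dual_rel_chain uv).
by exists (gprod tau u); split=> //; apply: red_cong h1 _; apply: cong_rel.
Qed.

(** The words must work below every [y] at once; taking [cyc] for [y] gives reducedness and
    simplicity, and the other [y] give the universal property of the join. *)
Definition joinable g h : Prop := exists u v : seq (dgen n),
  cong (@dual_rel n) (g :: u) (h :: v) /\
  forall y, y ⊑ cyc -> tau g ⊑ y -> tau h ⊑ y ->
    red (gprod tau (g :: u)) (g :: u) /\ gprod tau (g :: u) ⊑ y.

Lemma joinable_sym g h : joinable g h -> joinable h g.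
Proof.
move=> [u [v [uv uP]]]; exists v, u; split=> [|y yd hy gy]; first exact: cong_sym.
have [h1 h2] := uP y yd gy hy; rewrite -(dual_cong_gprod uv); split=> //.
exact: red_cong h1 uv.
Qed.

Lemma joinable_chain g h (u v : seq (dgen n)) : cong (@dual_rel n) (g :: u) (h :: v) ->
  (forall y, y ⊑ cyc -> orb y (val g).1 (val g).2 -> orb y (val h).1 (val h).2 ->
    chain y (g :: u)) -> joinable g h.
Proof.
move=> uv c; exists u, v; split=> // y yd; rewrite !tau_gle => gy hy.
exact: dual_chain_word (c y yd gy hy).
Qed.

Lemma rel_tri i j k (ij : (i < j)%N) (jk : (j < k)%N) (ik : (i < k)%N) :
  dual_rel [:: mkg ij; mkg jk] [:: mkg jk; mkg ik] /\
  dual_rel [:: mkg jk; mkg ik] [:: mkg ik; mkg ij].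
Proof.
by split; left; exists (mkg ij), (mkg jk), (mkg ik); do 3!split=> //; [left|right].
Qed.

Lemma joinable_apart g h : apart g h -> joinable g h.
Proof.
move=> gh; apply: (@joinable_chain g h [:: h] [:: g]).
  by apply: cong_rel; right; exists g, h; split; [apply/orP|].
move=> y yd gy hy; apply: chain2 => //.
by move: gh; rewrite /apart /in_arc; case: g h {gy hy} => [[i j] /= ij] [[k l] /= kl]; lia.
Qed.

Lemma joinable_tri i j k (ij : (i < j)%N) (jk : (j < k)%N) (ik : (i < k)%N) :
  [/\ joinable (mkg ij) (mkg jk), joinable (mkg jk) (mkg ik) & joinable (mkg ij) (mkg ik)].
Proof.
have [r1 r2] := rel_tri ij jk ik.
have c1 := @cong_rel _ (@dual_rel n) _ _ r1; have c2 := @cong_rel _ (@dual_rel n) _ _ r2.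
have all y : orb y i j -> orb y i k -> orb y j k by move=> h1; rewrite (orb_eq _ h1).
split.
- apply: (joinable_chain c1) => y yd /= h1 h2.
  by apply: chain2 => //=; rewrite /in_arc /=; lia.
- apply: (joinable_chain c2) => y yd /= h1 h2.
  by apply: chain2 => //=; rewrite /in_arc /=; lia.
- apply: (joinable_chain (cong_trans c1 c2)) => y yd /= h1 h2.
  by apply: chain2 => //=; [exact: all|rewrite /in_arc /=; lia].
Qed.

(** Orbits below [cyc] do not cross, so i, k, j, l lie in one orbit and the join is a 4-cycle. The
    words are linked by ij.ik.jl = ik.kj.jl = ik.kl.kj = kl.il.kj, each step being a triangle
    relation or a composite of two. *)
Lemma joinable_cross i j k l (ij : (i < j)%N) (kl : (k < l)%N) :
  (i < k)%N -> (k < j)%N -> (j < l)%N -> joinable (mkg ij) (mkg kl).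
Proof.
move=> ik kj jl; have il : (i < l)%N by lia.
apply: (@joinable_chain _ _ [:: mkg ik; mkg jl] [:: mkg il; mkg kj]).
  have [_ s1] := rel_tri ik kj ij; have [r1 _] := rel_tri ik kj ij.
  have [r2 s2] := rel_tri kj jl kl; have [r3 _] := rel_tri ik kl il.
  have c1 : cong (@dual_rel n) [:: mkg ij; mkg ik] [:: mkg ik; mkg kj].
    by apply: cong_sym; apply: cong_trans (cong_rel r1) (cong_rel s1).
  have c2 : cong (@dual_rel n) [:: mkg kj; mkg jl] [:: mkg kl; mkg kj].
    by apply: cong_trans (cong_rel r2) (cong_rel s2).
  apply: (cong_trans (v := [:: mkg ik; mkg kj; mkg jl])).
    exact: (cong_ctx [::] [:: mkg jl] c1).
  apply: (cong_trans (v := [:: mkg ik; mkg kl; mkg kj])).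
    by have := cong_ctx [:: mkg ik] [::] c2.
  exact: (cong_ctx [::] [:: mkg kj] (cong_rel r3)).
move=> y yd h1 h2; rewrite /= in h1 h2.
have gy : tau (mkg ij) ⊑ y by rewrite tau_gle.
have h3 : orb y i k.
  by apply: (@crossing (mkg ij) y k l) => //; rewrite /in_arc /=; lia.
have h4 : orb y j l by rewrite -(orb_eq _ h1) (orb_eq _ h3).
rewrite chain_cons /= h1 /=; apply: chain2.
- by have := dual_g_right gy yd; rewrite tpermV.
- by apply: same_arc => //; rewrite /in_arc /=; lia.
- by apply: same_arc => //; rewrite /in_arc /=; lia.
- by rewrite /in_arc /=; lia.
Qed.

Lemma joinable_lt g h : g <> h ->
  ((val g).1 < (val h).1)%N || (((val g).1 == (val h).1) && ((val g).2 < (val h).2)%N) ->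
  joinable g h.
Proof.
case: g h => [[i j] ij] [[k l] kl] _ /= o; simpl in ij, kl.
have [e|ik] := eqVneq i k.
  subst k; rewrite ltnn eqxx /= in o.
  by have [_ _] := joinable_tri ij o kl.
have {ik o} ik : (i < k)%N by move: o; rewrite (negbTE ik) orbF.
have [jk|kj|ejk] := ltngtP j k.
- by apply: joinable_apart; rewrite /apart /= ij jk kl.
- have [jl|lj|ejl] := ltngtP j l.
  + exact: joinable_cross.
  + by apply: joinable_apart; rewrite /apart /= ik kl lj orbT.
  + have e := ord_inj ejl; subst l.
    by have [_ /joinable_sym] := joinable_tri ik kl ij.
- have e := ord_inj ejk; subst k.
  by have [] := joinable_tri ij kl (ltn_trans ij kl).
Qed.

Lemma dual_g_join g h : g <> h -> exists (u v : seq (dgen n)) x,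
  [/\ x ⊑ cyc, red x (g :: u), red x (h :: v), cong (@dual_rel n) (g :: u) (h :: v) &
    forall y, y ⊑ cyc -> tau g ⊑ y -> tau h ⊑ y -> x ⊑ y].
Proof.
move=> gh; suff [u [v [uv uP]]] : joinable g h.
  have cc : cyc ⊑ cyc by rewrite /gle mulVg dlen1 addn0.
  have [h1 h2] := uP cyc cc (tau_del g) (tau_del h).
  exists u, v, (gprod tau (g :: u)); split=> //; first exact: red_cong h1 uv.
  by move=> y yd gy hy; have [] := uP y yd gy hy.
have [h1|h1|h1] := ltngtP (val g).1 (val h).1.
- by apply: joinable_lt; rewrite ?h1.
- by apply: joinable_sym; apply: joinable_lt; rewrite ?h1 //; apply/nesym.
have [h2|h2|h2] := ltngtP (val g).2 (val h).2.
- by apply: joinable_lt => //; rewrite (ord_inj h1) eqxx h2 orbT.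
- by apply: joinable_sym; apply: joinable_lt; rewrite ?(ord_inj h1) ?eqxx ?h2 ?orbT //; apply/nesym.
by case: gh; apply: val_inj; case: (val g) (val h) h1 h2 => [i j] [k l] /= /ord_inj -> /ord_inj ->.
Qed.

Definition dual_germ : germ (dual_pres n) := @Germ (dual_pres n) ('S_n) tau dlen cyc
  (@dlen1 m) (@dlen_eq0 m) (@dlenM m) dlen_tau tau_del dual_g_atom dual_g_right
  dual_g_rel dual_g_join dual_g_del.

End DualGerm.

(** * Strong connectivity for the dual braid monoid *)

Section DualConnected.
Import mathcomp.boot.fintype mathcomp.boot.finset.
Variable m : nat.
Local Open Scope group_scope.
Notation n := m.+1.
Implicit Types (x y z s t u : 'S_n) (a b c i j k l : 'I_n) (g h f : dgen n).
Local Notation G := (dual_germ m).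
Local Notation dlen := (@dlen m).
Local Notation cyc := (cyc m).
Local Notation tau := (@tau m).
Local Notation "x ⊑ y" := (gle dlen x y) (at level 70).
Local Notation nontriv := (@nontriv (dual_pres n) G).
Local Notation arr := (@arr (dual_pres n) G).
Local Notation reach := (connect (edge nontriv arr)).

Lemma arr_orb s t : (forall g, orb t (val g).1 (val g).2 ->
  ~~ orb (s^-1 * cyc) (val g).1 (val g).2) -> arr s t.
Proof.
by move=> h; apply/forallP => g; apply/implyP => /=; rewrite /dl /= !tau_gle => /h.
Qed.

Lemma dual_reach_step s t : nontriv s -> nontriv t -> (forall g, orb t (val g).1 (val g).2 ->
  ~~ orb (s^-1 * cyc) (val g).1 (val g).2) -> reach s t.
Proof. by move=> h1 h2 h3; apply: connect1; rewrite /edge /= h1 h2 arr_orb. Qed.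

Lemma nontriv_dlen s : s ⊑ cyc -> (0 < dlen s < m)%N -> nontriv s.
Proof.
move=> h /andP [h1 h2]; apply/and3P; split=> //; apply/eqP => e.
  by rewrite e dlen1 in h1.
by rewrite e dlen_cyc ltnn in h2.
Qed.

Lemma orb_tperm i j a b : a != b -> orb (tperm i j) a b ->
  (a == i) && (b == j) || (a == j) && (b == i).
Proof.
move=> ab /(orb_invariant (f := fun c => if c == i then j else c)) h.
have {}h : (if a == i then j else a) = (if b == i then j else b).
  by apply: h => c; case: tpermP => [->|->|]; rewrite ?eqxx //; case: eqP => // ->.
move: h ab; case: (a =P i) => [->|_]; case: (b =P i) => [->|_].
- by rewrite eqxx.
- by move=> <-; rewrite eqxx.
- by move=> ->; rewrite eqxx orbT.
- by move=> ->; rewrite eqxx.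
Qed.

Lemma orb_tau f g : orb (tau f) (val g).1 (val g).2 -> g = f.
Proof.
move=> /(orb_tperm (tau_neq g)) /orP [] /andP [/eqP e1 /eqP e2].
  by apply: val_inj; move: e1 e2; case: (val g) (val f) => [i j] [k l] /= -> ->.
have h1 := valP g; have h2 := valP f; rewrite /= e1 e2 in h1.
by have := ltn_trans h1 h2; rewrite ltnn.
Qed.

Hypothesis m2 : (1 < m)%N.

Lemma nontriv_tau g : nontriv (tau g).
Proof. by apply: nontriv_dlen; rewrite ?tau_del // dlen_tau. Qed.

(* The coatom attached to [g], the complement of [tau g]. *)
Definition cotau g : 'S_n := cyc * tau g.

Lemma cotauK g : (cotau g)^-1 * cyc = tau g.
Proof. by rewrite /cotau invMg tpermV mulgKV. Qed.

(** Conjugation by [cyc] turns the left complement of an atom into the right complement of another,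
    and right complements are simple by [dual_g_right]. *)
Lemma cotau_tau g : exists f, cotau g = (tau f)^-1 * cyc.
Proof.
pose i := cyc^-1 (val g).1; pose j := cyc^-1 (val g).2.
have ij : i != j by rewrite (inj_eq (@perm_inj _ _)) tau_neq.
have [f [_ e]] := orb_atom ij (orb_cyc i j).
exists f; rewrite e tpermV /cotau /tau; apply: (mulIg cyc^-1).
rewrite mulgK -[in RHS](tpermJ _ _ cyc^-1) conjgE invgK.
by rewrite mulgA.
Qed.

Lemma nontriv_cotau g : nontriv (cotau g).
Proof.
have [f e] := cotau_tau g.
apply: nontriv_dlen; first by rewrite e; apply: dual_g_right (tau_del f) _; rewrite /gle mulVg dlen1 addn0.
have /eqP := tau_del f; rewrite -e dlen_tau dlen_cyc add1n => h.
by rewrite -ltnS h m2 leqnn.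
Qed.

(** The complement of [tau f] preserves the arc of [f], so no atom whose ends are separated by this
    arc lies below it. *)
Lemma reach_tau_tau f g : in_arc f (val g).1 != in_arc f (val g).2 -> reach (tau f) (tau g).
Proof.
move=> h; apply: dual_reach_step; try exact: nontriv_tau.
move=> k /orb_tau ->; apply: contra h => h; rewrite tpermV in h; apply/eqP.
exact: orb_invariant (@arc_cyc m f) h.
Qed.

Lemma reach_cotau y g : nontriv y -> ~~ orb y (val g).1 (val g).2 -> reach (cotau g) y.
Proof.
move=> hy h; apply: dual_reach_step => //; first exact: nontriv_cotau.
by move=> k hk; rewrite cotauK; apply: contra h => /orb_tau <-.
Qed.

Lemma reach_cotau_cotau f g : in_arc' g (val f).1 != in_arc' g (val f).2 -> reach (cotau f) (cotau g).
Proof.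
move=> h; apply: reach_cotau; first exact: nontriv_cotau.
by apply: contra h => h; apply/eqP; exact: orb_invariant (@arc'_cyc m g) h.
Qed.

Lemma half0 : ((ord0 : 'I_n) < (inord (uphalf n) : 'I_n))%N.
Proof. by rewrite inordK /=; lia. Qed.

Definition g0 : dgen n := mkg half0.

Lemma val_g0 : (val g0).1 = 0 :> nat /\ (val g0).2 = uphalf n :> nat.
Proof. by rewrite /= inordK //; lia. Qed.

Lemma cohalf0 : ((inord ((n - 2)./2) : 'I_n) < (ord_max : 'I_n))%N.
Proof. by rewrite inordK /=; lia. Qed.

Definition c0 : dgen n := mkg cohalf0.

Lemma val_c0 : (val c0).1 = (n - 2)./2 :> nat /\ (val c0).2 = m :> nat.
Proof. by rewrite /= inordK //; lia. Qed.

Lemma mkg_exists (p q : nat) : (p < q)%N -> (q < n)%N ->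
  exists g, (val g).1 = p :> nat /\ (val g).2 = q :> nat.
Proof.
move=> pq qn; have pn : (p < n)%N by apply: ltn_trans qn.
by have pq' : (Ordinal pn < Ordinal qn)%N by []; exists (mkg pq').
Qed.

Lemma reach_tau_via g (p q : nat) : (p < q)%N -> (q < n)%N ->
  ((val g).1 <= p < (val g).2)%N != ((val g).1 <= q < (val g).2)%N ->
  (p <= 0 < q)%N != (p <= uphalf n < q)%N -> reach (tau g) (tau g0).
Proof.
move=> pq qn; have [f [<- <-]] := mkg_exists pq qn; have [e1 e2] := val_g0.
by rewrite -e2 -e1 => h1 h2; apply: connect_trans (reach_tau_tau h1) (reach_tau_tau h2).
Qed.

(** Either the arc of [g] already separates the ends of [g0], or one intermediate atom is enough;
    its ends are taken among 0, [uphalf n] and the ends of [g]. *)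
Lemma reach_tau_g0 g : reach (tau g) (tau g0).
Proof.
have := @reach_tau_via g; have d := @reach_tau_tau g g0.
have [e1 e2] := val_g0; rewrite /in_arc e1 e2 in d.
have := valP g; rewrite /=; have := ltn_ord (val g).2.
move: (nat_of_ord (val g).1) (nat_of_ord (val g).2) d => p r d rn pr via.
have [p0|p0] := posnP p; have [r1|r1] := leqP r (uphalf n).
- by apply: d; lia.
- by apply: (via (uphalf n) r); lia.
- by apply: (via 0%N p); lia.
- have [p1|p1] := leqP p (uphalf n); first by apply: d; lia.
  by apply: (via (uphalf n) p); lia.
Qed.

Lemma reach_cotau_via g (p q : nat) : (p < q)%N -> (q < n)%N ->
  (p < (n - 2)./2 <= q)%N != (p < m <= q)%N ->
  ((val g).1 < p <= (val g).2)%N != ((val g).1 < q <= (val g).2)%N ->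
  reach (cotau c0) (cotau g).
Proof.
move=> pq qn; have [f [<- <-]] := mkg_exists pq qn; have [e1 e2] := val_c0 => h1 h2.
apply: connect_trans (reach_cotau_cotau (f := c0) (g := f) _) (reach_cotau_cotau h2).
by rewrite /in_arc' e1 e2.
Qed.

Lemma reach_c0_cotau g : reach (cotau c0) (cotau g).
Proof.
have := @reach_cotau_via g; have d := @reach_cotau_cotau c0 g.
have [e1 e2] := val_c0; rewrite /in_arc' e1 e2 in d.
have := valP g; rewrite /=; have := ltn_ord (val g).2.
move: (nat_of_ord (val g).1) (nat_of_ord (val g).2) d => i j d jn ij via.
have [jm|jm] := eqVneq j m; have [i1|i1] := leqP ((n - 2)./2) i.
- by apply: d; lia.
- by apply: (via i (n - 2)./2); lia.
- by apply: (via j m); lia.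
- have [j1|j1] := leqP (n - 2)./2 j; first by apply: d; lia.
  by apply: (via j (n - 2)./2); lia.
Qed.

(* The bridge from atoms to coatoms: the arc of [g0] separates the points of each
   2-cycle of [refl'], and that of [c0] those of its complement [refl]. *)
Definition refl : 'S_n := perm (@rev_ord_inj n).
Definition refl' : 'S_n := cyc * refl.

Lemma val_refl a : refl a = (m - a)%N :> nat.
Proof. by rewrite permE /= subSS. Qed.

Lemma val_refl' a : refl' a = (if a == 0 :> nat then 0 else n - a)%N :> nat.
Proof.
rewrite permM val_refl val_cyc; have := ltn_ord a.
by move: (nat_of_ord a) => p; case_eqs; lia.
Qed.

Lemma reflK a : refl (refl a) = a.
Proof. by apply: ord_inj; rewrite !val_refl; have := ltn_ord a; lia. Qed.

Lemma refl'K a : refl' (refl' a) = a.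
Proof.
apply: ord_inj; do ?rewrite val_refl'; have := ltn_ord a.
by move: (nat_of_ord a) => p; case_eqs; lia.
Qed.

(** The points that [refl] moves down and those that [refl'] moves up are disjoint sets avoiding 0.
    As the product of [refl'] and [refl] is [cyc], of length [m], the bound is an equality and
    [refl'] lies below [cyc]. *)
Lemma dlen_refls : (dlen refl + dlen refl' <= m)%N.
Proof.
apply: leq_trans (leq_add (dlen_involution reflK) (dlen_involution refl'K)) _.
rewrite -(card_preimset [set a | (refl' a < a)%N] (@perm_inj _ refl')).
set A := [set a | _]; set B := preimset _ _.
have d : A :&: B = set0.
  apply/setP => a; rewrite !inE refl'K val_refl val_refl'; have := ltn_ord a.
  by move: (nat_of_ord a) => p; case_eqs; lia.
have e : #|[set~ (ord0 : 'I_n)]| = m by rewrite cardsC1 card_ord.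
rewrite -[X in (_ <= X)%N]e; have := cardsU A B; rewrite d cards0 subn0 => <-.
apply: subset_leq_card; apply/subsetP => a; rewrite !inE -(inj_eq (@ord_inj n)) refl'K val_refl val_refl' /=.
by move: (nat_of_ord a) => p; case_eqs; lia.
Qed.

Lemma refl'_dl : refl'^-1 * cyc = refl.
Proof.
apply/permP => a; rewrite permM; apply: ord_inj.
have -> : refl'^-1 a = refl' a by rewrite -{1}(refl'K a) permK.
rewrite val_cyc val_refl val_refl'; have := ltn_ord a.
by move: (nat_of_ord a) => p; case_eqs; lia.
Qed.

Lemma nontriv_refl' : nontriv refl'.
Proof.
have e := refl'_dl.
have h := dlenM refl' (refl'^-1 * cyc); rewrite mulKVg e dlen_cyc in h.
have h' := dlen_refls.
have r0 : dlen refl <> 0%N.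
  move=> /dlen_eq0 /permP /(_ ord0) /(congr1 val) /=; rewrite perm1 val_refl /=; lia.
have r1 : dlen refl' <> 0%N.
  have lt1 : (1 < n)%N by apply: ltnW.
  move=> /dlen_eq0 /permP /(_ (Ordinal lt1)) /(congr1 val) /=; rewrite perm1 val_refl' /=; lia.
have [hs hp] : (dlen refl' + dlen refl == m)%N /\ (0 < dlen refl' < m)%N.
  by move: h h' r0 r1; move: (dlen refl) (dlen refl') => p q; lia.
by apply: nontriv_dlen hp; rewrite /gle e dlen_cyc.
Qed.

Lemma orb_involution u a b : (forall c, u (u c) = c) -> a != b ->
  orb u a b -> a = u b.
Proof.
move=> uK ab /porbitP [e]; elim: e a b ab => [|e IH] a b ab; first
  by rewrite perm1 => h; rewrite h eqxx in ab.
rewrite expgS permM => h; have [<-|ne] := eqVneq a (u b); first by [].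
by have := IH a (u b) ne h; rewrite uK => h'; rewrite h' eqxx in ab.
Qed.

Lemma reach_g0_c0 : reach (tau g0) (cotau c0).
Proof.
apply: (connect_trans (y := refl')).
  apply: dual_reach_step (nontriv_tau g0) nontriv_refl' _ => g.
  move=> /(orb_involution refl'K (tau_neq g)) /(congr1 (@nat_of_ord n)).
  rewrite val_refl' => h; apply/negP; rewrite tpermV => /(orb_invariant (@arc_cyc m g0)).
  have [e1 e2] := val_g0; rewrite /in_arc e1 e2; move: h (valP g) => /=.
  have := ltn_ord (val g).2; move: (nat_of_ord (val g).1) (nat_of_ord (val g).2) => p q.
  by case_eqs; lia.
apply: dual_reach_step nontriv_refl' (nontriv_cotau c0) _ => g.
move=> /(orb_invariant (@arc'_cyc m c0)) h; rewrite refl'_dl; apply/negP.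
move=> /(orb_involution reflK (tau_neq g)) /(congr1 (@nat_of_ord n)).
rewrite val_refl; have [e1 e2] := val_c0; move: h; rewrite /in_arc' e1 e2; move: (valP g) => /=.
have := ltn_ord (val g).2; move: (nat_of_ord (val g).1) (nat_of_ord (val g).2) => p q.
by lia.
Qed.

Lemma dual_reach_to y : nontriv y -> reach (tau g0) y.
Proof.
move=> hy; have [_ yd] := andP hy.
have [g hg] : exists g, ~~ orb y (val g).1 (val g).2.
  apply: contrapT => no; move/and3P: hy => [Sy _ /eqP]; apply.
  apply: dual_g_del => // g; rewrite tau_gle; apply: contrapT => /negP h; apply: no.
  by exists g.
apply: connect_trans reach_g0_c0 _; apply: connect_trans (reach_c0_cotau g) _.
exact: reach_cotau.
Qed.

Lemma dual_reach_from x : nontriv x -> reach x (tau g0).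
Proof.
move=> hx; have [g hg] : exists g, ~~ orb (x^-1 * cyc) (val g).1 (val g).2.
  apply: contrapT => no; move/and3P: hx => [Sx /eqP x1 _]; apply: x1.
  have e : x^-1 * cyc = cyc.
    apply: dual_g_del => [|g]; first by apply: dual_g_right Sx _; rewrite /gle mulVg dlen1 addn0.
    by rewrite tau_gle; apply: contrapT => /negP h; apply: no; exists g.
  by apply: invg_inj; rewrite invg1; apply: (mulIg cyc); rewrite mul1g.
apply: connect_trans (reach_tau_g0 g).
by apply: dual_reach_step => //; [exact: nontriv_tau|move=> k /orb_tau ->].
Qed.

Lemma arr_g0 : arr (tau g0) (tau g0).
Proof.
apply: arr_orb => g /orb_tau ->; apply/negP; rewrite tpermV => /(orb_invariant (@arc_cyc m g0)).
by have [e1 e2] := val_g0; rewrite /in_arc e1 e2; lia.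
Qed.

End DualConnected.

Lemma dual_connected m : (0 < m)%N -> germ_connected (dual_germ m).
Proof.
case: m => // -[|m] _; first by left; exact: dlen_cyc.
have m2 : (1 < m.+2)%N by [].
right; exists (g0 m2); split; first exact: nontriv_tau; first exact: arr_g0.
by move=> s hs; split; [apply: dual_reach_from|apply: dual_reach_to].
Qed.

Import Order.TTheory GRing.Theory Num.Theory numFieldTopology.Exports numFieldNormedType.Exports.
Local Open Scope classical_set_scope.

(** * Cylinders and weak convergence *)

Section CylinderTopology.
Variable P : pres.
Implicit Types (xi eta : Mbar P).

Definition agree (k : nat) xi eta := forall i, (i < k)%N -> val eta i = val xi i.
Definition cyl (k : nat) (A : set (Mbar P)) := forall xi eta, agree k xi eta -> A xi -> A eta.

Lemma agree_refl k xi : agree k xi xi. Proof. by []. Qed.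

Lemma agree_sym k xi eta : agree k xi eta -> agree k eta xi.
Proof. by move=> h i /h. Qed.

Lemma agree_trans k xi eta zeta : agree k xi eta -> agree k eta zeta -> agree k xi zeta.
Proof. by move=> h1 h2 i ik; rewrite h2 // h1. Qed.

Lemma agree_le k m xi eta : (k <= m)%N -> agree m xi eta -> agree k xi eta.
Proof. by move=> km h i ik; apply: h; apply: leq_trans km. Qed.

Lemma cyl_le k m A : (k <= m)%N -> cyl k A -> cyl m A.
Proof. by move=> km h xi eta /(agree_le km); apply: h. Qed.

Lemma cylT k : cyl k setT. Proof. by []. Qed.

Lemma cylC k A : cyl k A -> cyl k (~` A).
Proof. by move=> h xi eta e nA /(h _ _ (agree_sym e)). Qed.

Lemma cylU k A B : cyl k A -> cyl k B -> cyl k (A `|` B).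
Proof. by move=> h1 h2 xi eta e [/(h1 _ _ e)|/(h2 _ _ e)]; [left|right]. Qed.

Lemma cylI k A B : cyl k A -> cyl k B -> cyl k (A `&` B).
Proof. by move=> h1 h2 xi eta e [/(h1 _ _ e) ? /(h2 _ _ e) ?]. Qed.

Lemma coord_open (i : nat) (c : mon P) : open [set xi : Mbar P | val xi i = c].
Proof.
have h1 : continuous (fun xi : Mbar P => (val xi : Xsp P)).
  exact: initial_continuous.
have h2 : continuous (fun xi : Mbar P => (val xi : Xsp P) i : discrete_topology (mon P)).
  move=> xi; apply: (@continuous_comp _ _ _ (fun xi : Mbar P => (val xi : Xsp P))
    (fun f : Xsp P => f i : discrete_topology (mon P))); first exact: h1.
  exact: (@proj_continuous _ (fun _ : nat => discrete_topology (mon P)) i).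
have /continuousP := h2 => /(_ [set c]); apply; exact: discrete_open.
Qed.

Lemma agree_open k xi : open (agree k xi).
Proof.
elim: k => [|k IH].
  have -> : agree 0 xi = setT by apply/seteqP; split.
  exact: openT.
have -> : agree k.+1 xi = agree k xi `&` [set eta | val eta k = val xi k].
  apply/seteqP; split=> [eta h|eta [h1 h2] i].
    by split=> [i ik|]; apply: h => //; apply: ltnW.
  by rewrite ltnS leq_eqVlt => /orP [/eqP -> //|/h1].
by apply: openI => //; apply: coord_open.
Qed.

Lemma cyl_open k A : cyl k A -> open A.
Proof.
move=> hA; rewrite openE => xi Axi; rewrite /interior nbhsE.
exists (agree k xi); first by split; [exact: agree_open|exact: agree_refl].
by move=> eta h; apply: hA h Axi.
Qed.

Lemma cyl_closed k A : cyl k A -> closed A.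
Proof. by move=> /cylC /cyl_open; rewrite openC. Qed.

(** If no [k] worked, chosen counterexamples would converge to [xi] coordinate by coordinate while
    staying outside the open set [V]. *)
Lemma nbhs_agree (U : set (Mbar P)) xi : nbhs xi U -> exists k, agree k xi `<=` U.
Proof.
move=> [_ [[V oV <-] /= Vxi] VU].
suff [k hk] : exists k, agree k xi `<=` [set eta | V (val eta)].
  by exists k; apply: subset_trans hk VU.
apply: contrapT => no.
have /choice [g hg] : forall k, exists eta, agree k xi eta /\ ~ V (val eta).
  move=> k; apply: contrapT => h; apply: no; exists k => eta he.
  by apply: contrapT => nV; apply: h; exists eta.
have gcvg : (fun k => val (g k) : Xsp P) @ \oo --> (val xi : Xsp P).
  apply/cvg_sup => N U' [V'] [[W] oW <-] WfN WU.
  apply: (filterS WU); rewrite nbhs_simpl; exists N.+1 => // i /= Ni.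
  have [h _] := hg i; rewrite /preimage /=.
  have -> : val (g i) N = val xi N by apply: h.
  exact: WfN.
have /gcvg : nbhs (val xi : Xsp P) V by apply: open_nbhs_nbhs.
rewrite nbhs_simpl => -[N _ /(_ N (leqnn N))] /=.
by have [] := hg N.
Qed.

End CylinderTopology.

Section BoundaryTopology.
Variables (P : pres) (G : germ P).
Local Open Scope group_scope.
Local Notation gT := (ggT G).
Local Notation M := (mon P).
Local Notation simp := (@simp P G).
Local Notation al := (@al P G).
Local Notation pfx := (@pfx P).
Local Notation hd := (@hd P G).
Implicit Types (x y z : M) (xi eta : Mbar P).

Lemma agree_prefix k xi eta : pfx k xi = pfx k eta <-> agree k eta xi.
Proof. exact: (prefix_eq G). Qed.

Lemma prefix_cyl k (Q : M -> Prop) : cyl k [set xi | Q (pfx k xi)].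
Proof. by move=> xi eta /agree_prefix /= ->. Qed.

Lemma agree_nf k xi : agree k xi (nf (pfx k xi)).
Proof. by move=> i ik; apply: (nf_prefix G). Qed.

Lemma ultra_coord (F : set_system (Mbar P)) (i : nat) : UltraFilter F ->
  exists c, F [set xi | val xi i = c].
Proof.
move=> FU; apply: contrapT => no.
have h (s : gT) : F [set xi | val xi i <> simp s].
  have [Fs|//] := in_ultra_setVsetC [set xi | val xi i = simp s] FU.
  by exfalso; apply: no; exists (simp s).
have [xi hxi] := filter_ex (filter_forall _ h).
by apply: (hxi (al (val xi i))); apply: Mbar_simp; apply: Mbar_val.
Qed.

(** A coordinate takes finitely many values, so an ultrafilter decides it. The sequence of decided
    values is the limit. *)
Lemma compact_Mbar : compact [set: Mbar P].
Proof.
rewrite compact_ultra => F FU _.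
have /choice [c hc] : forall i, exists c, F [set xi | val xi i = c].
  by move=> i; apply: ultra_coord.
have hk k : F [set xi | forall i, (i < k)%N -> val xi i = c i].
  elim: k => [|k IH]; first by apply: filterS filterT.
  apply: filterS (filterI IH (hc k)) => xi [h1 h2] i.
  by rewrite ltnS leq_eqVlt => /orP [/eqP -> //|/h1].
have Mc : @Mbar_set P c.
  (* [k.+2] coordinates are needed to see the arrow from coordinate [k] to [k.+1]. *)
  by split=> k; have [xi h] := filter_ex (hk k.+2); have [h1 h2] := Mbar_val xi;
    rewrite -!h // ltnW.
exists (exist _ c (mem_set Mc) : Mbar P); split=> // U /nbhs_agree [k hU].
by apply: filterS (hk k) => xi h; apply: hU.
Qed.

(** [hd m] is monotone and fixes [x], so multiples of [x] keep this divisor after truncation, and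
    the condition is closed. Conversely the longer and longer prefixes of [xi] are multiples of [x]
    that converge to [xi]. *)
Lemma Uparrow_prefix x m : (len x <= m)%N ->
  Uparrow x = [set xi | ldiv x (pfx m xi)].
Proof.
move=> xm; have cl : closed [set xi : Mbar P | ldiv x (pfx m xi)].
  by apply: (@cyl_closed _ m); exact: (@prefix_cyl m (ldiv x)).
apply/seteqP; split.
  move/closure_id: cl => ->; apply: closure_subset => _ [z _ <-] /=.
  rewrite (prefix_nf G) -{1}(hd_id G xm); apply: ldiv_hd; exact: ldiv_mulr.
move=> xi /= h U /nbhs_agree [k hU].
pose n := maxn k m.
have [z ez] : ldiv x (pfx n xi).
  apply: ldiv_trans h _; rewrite -(hd_prefix G xi (leq_maxr k m)).
  exact: hd_ldiv.
exists (nf (pfx n xi)); split; first by exists z; rewrite -?ez.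
by apply: hU; apply: agree_le (leq_maxl k m) _; apply: agree_nf.
Qed.

Lemma Uparrow_hd x k : hd k x = x -> Uparrow x = [set xi | ldiv x (pfx k xi)].
Proof.
move=> hx; rewrite (@Uparrow_prefix x (maxn k (len x))) ?leq_maxr //.
have km := leq_maxl k (len x); apply/seteqP; split=> xi /= h.
  by rewrite -(hd_prefix G xi km) -{1}hx; apply: ldiv_hd.
by apply: ldiv_trans h _; rewrite -(hd_prefix G xi km); apply: hd_ldiv.
Qed.

Lemma Uparrow_nf x z : Uparrow x (nf z) <-> ldiv x z.
Proof.
pose m := maxn (len x) (len z).
rewrite (@Uparrow_prefix x m) ?leq_maxl //= (prefix_nf G) hd_id //.
exact: leq_maxr.
Qed.

Lemma Uparrow_eM : Uparrow (eM P) = setT.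
Proof.
rewrite (@Uparrow_prefix _ 0%N) ?len_eM //; apply/seteqP; split=> // xi _ /=.
exact: ldiv_refl.
Qed.

Lemma range_nf : range (@nf P) = \bigcup_k [set xi : Mbar P | val xi k = eM P].
Proof.
apply/seteqP; split=> [_ [x _ <-]|xi [k _ /= h]].
  exists (len x) => //=; rewrite (val_nf G) /nfseq iter_om_len //.
  by rewrite al_e simp1.
(* Only the unit follows the unit: the complement of 1 is [δ], which lies above every atom. *)
have stop i : (k <= i)%N -> val xi i = eM P.
  elim: i => [|i IH]; first by rewrite leqn0 => /eqP <-.
  rewrite leq_eqVlt => /orP [/eqP <- //|]; rewrite ltnS => /IH e.
  have hxi := Mbar_val xi; have := Mbar_arr G i hxi; rewrite e al_e.
  move/forallP => hr0; rewrite (Mbar_simp G i.+1 hxi) -(@simp1 P G); congr simp.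
  apply: contrapT => ne; have [r hr] := g_atom (al_S G _) ne.
  have := hr0 r; rewrite hr /dl invg1 mul1g gat_del.
  by [].
exists (pfx k xi) => //; apply/val_inj/funext => i /=.
rewrite (val_nf G) nfseq_pi; last exact: Mbar_val.
by case: ltnP => // /stop ->.
Qed.

End BoundaryTopology.

(** * Limiting frequencies of cylinders *)

Lemma ratio_cvg_inv (R : realType) (u : nat -> R) (rho : R) : (forall k, 0 < u k)%R ->
  (1 <= rho)%R -> (forall eta : R, (0 < eta)%R -> exists K, forall k, (K <= k)%N ->
  (`|u k.+1 - rho * u k| <= eta * u k)%R) ->
  (fun k => u k / u k.+1)%R @ \oo --> rho^-1%R.
Proof.
move=> u0 rho1 h.
have h1 : (fun k => u k.+1 / u k)%R @ \oo --> rho.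
  apply/cvgrPdist_le => e e0; have [K hK] := h e e0; exists K => // k /= Kk.
  have -> : (rho - u k.+1 / u k = - ((u k.+1 - rho * u k) / u k))%R.
    by field; rewrite gt_eqF.
  by rewrite normrN normrM normfV (gtr0_norm (u0 k)) ler_pdivrMr //; apply: hK.
have -> : (fun k => u k / u k.+1)%R = (fun k => (u k.+1 / u k)^-1)%R.
  by apply/funext => k; rewrite invf_div.
exact: (cvgV (lt0r_neq0 (lt_le_trans ltr01 rho1)) h1).
Qed.

Lemma cvg_ratio_shift (R : realType) (u : nat -> R) (q : R) : (forall k, 0 < u k)%R ->
  (fun k => u k / u k.+1)%R @ \oo --> q ->
  forall m, (fun k => u k / u (k + m)%N)%R @ \oo --> (q ^+ m)%R.
Proof.
move=> u0 h; elim=> [|m IH].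
  rewrite expr0 (_ : (fun k => _) = fun=> 1%R); first exact: cvg_cst.
  by apply/funext => k; rewrite addn0 divff // gt_eqF.
have h2 : (fun k => u (k + m)%N / u (k + m).+1)%R @ \oo --> q.
  by rewrite -(cvg_shiftn m) in h.
rewrite exprSr (_ : (fun k => _) =
  (fun k => (u k / u (k + m)%N) * (u (k + m)%N / u (k + m).+1))%R); first exact: cvgM IH h2.
by apply/funext => k; rewrite addnS mulrA mulfVK // gt_eqF.
Qed.

Lemma cvg_sum_seq (R : realType) (I : eqType) (s : seq I) (f : I -> nat -> R) (l : I -> R) :
  (forall i, i \in s -> f i @ \oo --> l i) ->
  (fun j => \sum_(i <- s) f i j)%R @ \oo --> (\sum_(i <- s) l i)%R.
Proof.
elim: s => [|i s IH] h.
  rewrite big_nil; under eq_fun do rewrite big_nil; exact: cvg_cst.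
rewrite big_cons; under eq_fun do rewrite big_cons.
apply: cvgD; first by apply: h; rewrite mem_head.
by apply: IH => k ks; apply: h; rewrite inE ks orbT.
Qed.

Lemma sum_count_seq (Y : eqType) (X : Type) (f : X -> Y) (Q : pred Y) (h : seq Y) (s : seq X) :
  uniq h -> (forall x, f x \in h) ->
  (\sum_(y <- h | Q y) count (fun x => f x == y) s = count (fun x => Q (f x)) s)%N.
Proof.
move=> uh fh; elim: s => [|x s IH] /=; first by rewrite big1.
rewrite big_split /= IH; congr addn.
rewrite big_mkcond (bigD1_seq (f x)) //= eqxx big1 ?addn0; first by case: (Q (f x)).
by move=> t tx; rewrite eq_sym (negbTE tx) if_same.
Qed.

Section Frequencies.
Variables (P : pres) (G : germ P).
Local Open Scope group_scope.
Local Notation a := (@gat P G).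
Local Notation l := (@glen P G).
Local Notation δ := (@gdel P G).
Local Notation M := (mon P).
Local Notation pfx := (@pfx P).
Local Notation hd := (@hd P G).
Local Notation Mlist := (@Mlist P).
Variable R : realType.
Implicit Types (x y z : M) (xi eta : Mbar P).

Definition freq (j : nat) (A : set (Mbar P)) : R :=
  ((count (fun x => nf x \in A) (Mlist j))%:R / (cardM P j)%:R)%R.

Lemma freq_ge0 j A : (0 <= freq j A)%R.
Proof. by rewrite divr_ge0. Qed.

Lemma freq_Uparrow j x : (len x <= j)%N ->
  freq j (Uparrow x) = ((cardM P (j - len x))%:R / (cardM P j)%:R)%R.
Proof.
move=> xj; rewrite /freq; congr (_%:R / _)%R.
rewrite -size_filter cardM_size -[RHS](size_map (mulM x)); apply: perm_size.
apply: uniq_perm.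
- by apply: filter_uniq; apply: Mlist_uniq.
- by rewrite map_inj_uniq ?Mlist_uniq // => y z; apply: (@mulM_cancel P G).
move=> y; rewrite mem_filter mem_Mlist; apply/andP/mapP => [[/set_mem /(Uparrow_nf G) [z ->]]|[z]].
  rewrite len_mulM => /eqP lz; exists z => //; rewrite mem_Mlist; apply/eqP; lia.
rewrite mem_Mlist => /eqP lz ->; split; last by rewrite len_mulM; apply/eqP; lia.
by apply/mem_set/(Uparrow_nf G); apply: ldiv_mulr.
Qed.

(** The elements with at most [k] nontrivial factors, which label the cells of depth [k]. Their
    length is at most [k * l δ], so the list loses none of them. *)
Definition heads (k : nat) : seq M :=
  [seq y <- flatten [seq Mlist i | i <- iota 0 (k * l δ).+1] | hd k y == y].

Lemma heads_uniq k : uniq (heads k).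
Proof.
apply: filter_uniq.
have [n m] : {n | (k * l δ).+1 = n} by exists (k * l δ).+1.
rewrite {k}m; elim: n 0%N => // n IH i /=; rewrite cat_uniq Mlist_uniq IH /= andbT.
apply/hasPn => x /flatten_mapP [j]; rewrite mem_iota => /andP [ij _].
by rewrite !mem_Mlist => /eqP ->; apply/eqP; lia.
Qed.

Lemma headsP k y : reflect (hd k y = y) (y \in heads k).
Proof.
rewrite mem_filter; apply: (iffP andP) => [[/eqP //]|e]; split; first exact/eqP.
apply/flatten_mapP; exists (len y); last by rewrite mem_Mlist.
rewrite mem_iota /= add0n ltnS; have := len_prefix G k (nf y).
by rewrite (prefix_nf G) e.
Qed.

Lemma pfx_heads k xi : pfx k xi \in heads k.
Proof. by apply/headsP; rewrite hd_prefix. Qed.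

Definition cell (k : nat) y : set (Mbar P) := [set xi | pfx k xi = y].

Lemma cell_cyl k y : cyl k (cell k y).
Proof. exact: (@prefix_cyl P G k (fun z => z = y)). Qed.

Lemma cyl_nf k A xi : cyl k A -> A xi <-> A (nf (pfx k xi)).
Proof.
move=> hA; have h := @agree_nf P G k xi.
by split; [apply: hA h|apply: hA (agree_sym h)].
Qed.

Lemma freq_cells k A j : cyl k A ->
  freq j A = (\sum_(y <- heads k | nf y \in A) freq j (cell k y))%R.
Proof.
move=> hA; rewrite /freq -mulr_suml -natr_sum; congr (_%:R / _)%R.
transitivity (\sum_(y <- heads k | nf y \in A) count (fun x => pfx k (nf x) == y) (Mlist j))%N.
  rewrite sum_count_seq ?heads_uniq //; last by move=> x; apply: pfx_heads.
  apply: eq_count => x /=; have e := @cyl_nf k A (nf x) hA.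
  by apply/idP/idP => /set_mem h; apply/mem_set/e.
apply: eq_bigr => y _; apply: eq_count => x.
by apply/eqP/idP => [h|/set_mem //]; apply/mem_set.
Qed.

Lemma measurable_cyl k A : cyl k A -> measurable (A : set (Borel P)).
Proof. by move=> /cyl_open; apply: sub_sigma_algebra. Qed.

Lemma measure_cells (nu : probability (Borel P) R) k A : cyl k A ->
  nu A = (\sum_(y <- heads k | nf y \in A) nu (cell k y))%E.
Proof.
move=> hA.
have gen (s : seq M) : uniq s -> nu (A `&` [set xi | pfx k xi \in s]) =
    (\sum_(y <- s | nf y \in A) nu (cell k y))%E.
  elim: s => [|y s IH] /=.
    by move=> _; rewrite big_nil (_ : _ `&` _ = set0) ?measure0 //; apply/seteqP; split=> // xi [].
  move=> /andP [ys us]; rewrite big_cons.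
  have e : A `&` [set xi | pfx k xi \in y :: s] =
      (A `&` cell k y) `|` (A `&` [set xi | pfx k xi \in s]).
    apply/seteqP; split=> [xi [h1]|xi [[h1 h2]|[h1 h2]]] /=; rewrite ?inE.
    - by case/orP => [/eqP h|h]; [left|right].
    - by split=> //=; rewrite ?inE h2 eqxx.
    - by split=> //=; rewrite ?inE h2 orbT.
  have m1 : measurable (A `&` cell k y : set (Borel P)).
    by apply: (@measurable_cyl k); apply: cylI => //; apply: cell_cyl.
  have m2 : measurable (A `&` [set xi | pfx k xi \in s] : set (Borel P)).
    by apply: (@measurable_cyl k); apply: cylI => //; apply: (@prefix_cyl P G k (fun z => z \in s)).
  have dj : (A `&` cell k y) `&` (A `&` [set xi | pfx k xi \in s]) = set0.
    apply/seteqP; split=> // xi [[_ h1] [_ h2]].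
    by move: ys; rewrite -h1 h2.
  have -> : nu (A `&` [set xi | pfx k xi \in y :: s]) =
      (nu (A `&` cell k y) + nu (A `&` [set xi | pfx k xi \in s]))%E.
    by rewrite e; apply: measureU m1 m2 dj.
  rewrite IH //; case: ifPn => [/set_mem Ay|nAy].
    congr (nu _ + _)%E; apply/seteqP; split=> [xi []//|xi h]; split=> //.
    by apply/(@cyl_nf k A xi hA); rewrite h.
  rewrite (_ : A `&` cell k y = set0) ?measure0 ?add0e //.
  apply/seteqP; split=> // xi [h1 h2]; move: nAy => /negP; apply.
  by apply/mem_set; rewrite -h2; apply/(@cyl_nf k A xi hA).
rewrite -(gen _ (heads_uniq k)); congr (nu _).
by apply/seteqP; split=> [xi h|xi []//]; split=> //=; apply: pfx_heads.
Qed.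

Variables (r0 : pgen P) (q : R).
Hypothesis card_cvg : (fun k => (cardM P k)%:R / (cardM P k.+1)%:R : R)%R @ \oo --> q.

Lemma cardR_gt0 k : (0 < (cardM P k)%:R :> R)%R.
Proof. by rewrite ltr0n (cardM_gt0 G r0). Qed.

Lemma freq_Uparrow_cvg x : (fun j => freq j (Uparrow x)) @ \oo --> (q ^+ len x)%R.
Proof.
rewrite -(cvg_shiftn (len x)).
have h := @cvg_ratio_shift R _ q cardR_gt0 card_cvg (len x).
rewrite (_ : (fun k => _) =
  (fun k => (cardM P k)%:R / (cardM P (k + len x))%:R)%R) //.
by apply/funext => k; rewrite freq_Uparrow ?leq_addl // addnK.
Qed.

Definition unif (nu : probability (Borel P) R) : Prop :=
  forall x, nu (Uparrow x) = (q ^+ len x)%:E.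

Lemma Uparrow_cyl k y : y \in heads k -> cyl k (Uparrow y).
Proof.
move=> /headsP h; rewrite (Uparrow_hd h).
exact: (@prefix_cyl P G k (ldiv y)).
Qed.

(* Triangular inversion of [Uparrow y] into the cells [cell k y'], y <= y'. *)
Lemma cell_cvg k y : y \in heads k -> exists c : R,
  ((fun j => freq j (cell k y)) @ \oo --> c) /\
  (forall nu, unif nu -> nu (cell k y) = c%:E).
Proof.
have [n] := ubnP (k * l δ - len y)%N; elim: n y => // n IH y hn hy.
have hU := Uparrow_cyl hy.
pose Q z := (nf z \in Uparrow y) && (z != y).
have len_lt z : Q z -> z \in heads k -> (len y < len z <= k * l δ)%N.
  move=> /andP [/set_mem /(Uparrow_nf G) yz zy] /headsP hz; apply/andP; split.
    rewrite ltn_neqAle (ldiv_len yz) andbT; apply: contraNneq zy => e.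
    by rewrite (ldiv_eq yz e).
  by have := len_prefix G k (nf z); rewrite (prefix_nf G) hz.
have /choice [c hc] : forall z, exists c : R, z \in [seq z <- heads k | Q z] ->
    ((fun j => freq j (cell k z)) @ \oo --> c) /\
    (forall nu, unif nu -> nu (cell k z) = c%:E).
  move=> z; have [|_] := boolP (z \in [seq z <- heads k | Q z]); last by exists 0%R.
  rewrite mem_filter => /andP [Qz hz].
  have [c hc] := IH z ltac:(have := len_lt z Qz hz; lia) hz.
  by exists c.
have ynf : nf y \in Uparrow y by apply/mem_set/(Uparrow_nf G); apply: ldiv_refl.
exists (q ^+ len y - \sum_(z <- heads k | Q z) c z)%R; split.
  have e : (fun j => freq j (cell k y)) =
      (fun j => freq j (Uparrow y) - \sum_(z <- heads k | Q z) freq j (cell k z))%R.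
    apply/funext => j; rewrite (freq_cells j hU) (bigID (pred1 y)) /= -/Q.
    rewrite (eq_bigl (fun z => z == y)); last first.
      by move=> z; have [->|_] := eqVneq z y; rewrite ?ynf ?andbF.
    rewrite (big_rem y hy) /= eqxx big_seq_cond big1 ?addr0 ?addrK //.
    by move=> z /andP [zr /eqP zy]; move: zr; rewrite zy mem_rem_uniqF ?heads_uniq.
  rewrite e; apply: cvgB; first exact: freq_Uparrow_cvg.
  rewrite -big_filter; under eq_fun do rewrite -big_filter.
  by apply: cvg_sum_seq => z /hc [].
move=> nu hnu; have := measure_cells nu hU; rewrite hnu (bigID (pred1 y)) /= -/Q.
rewrite (eq_bigl (fun z => z == y)); last first.
  by move=> z; have [->|_] := eqVneq z y; rewrite ?ynf ?andbF.
rewrite (big_rem y hy) /= eqxx big_seq_cond big1 ?adde0; last first.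
  by move=> z /andP [zr /eqP zy]; move: zr; rewrite zy mem_rem_uniqF ?heads_uniq.
have -> : (\sum_(z <- heads k | Q z) nu (cell k z) = (\sum_(z <- heads k | Q z) c z)%R%:E)%E.
  rewrite -!(big_filter _ Q) -sumEFin !big_seq; apply: eq_bigr => z /hc [_].
  by move=> /(_ nu hnu).
have fn : nu (cell k y) \is a fin_num by apply: fin_num_measure; apply: measurable_cyl (@cell_cyl k y).
by move=> e; rewrite EFinB e addeK.
Qed.

(** One constant serves both as the limit of frequencies and as the value of any uniform measure;
    the first half feeds the construction of the measure, and the whole shows that its values on
    cylinders are forced. *)
Lemma cyl_cvg k A : cyl k A -> exists c : R,
  ((fun j => freq j A) @ \oo --> c) /\ (forall nu, unif nu -> nu A = c%:E).
Proof.
move=> hA.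
have /choice [c hc] : forall z, exists c : R, z \in heads k ->
    ((fun j => freq j (cell k z)) @ \oo --> c) /\
    (forall nu, unif nu -> nu (cell k z) = c%:E).
  move=> z; have [hz|_] := boolP (z \in heads k); last by exists 0%R.
  by have [c hc] := cell_cvg hz; exists c.
exists (\sum_(y <- heads k | nf y \in A) c y)%R; split.
  rewrite (_ : (fun j => freq j A) =
    fun j => \sum_(y <- [seq y <- heads k | nf y \in A]) freq j (cell k y))%R; last first.
    by apply/funext => j; rewrite (freq_cells j hA) big_filter.
  rewrite -big_filter.
  by apply: cvg_sum_seq => z; rewrite mem_filter => /andP [_ /hc []].
move=> nu hnu; rewrite (measure_cells nu hA) -!(big_filter _ (fun y => nf y \in A)) -sumEFin.
rewrite !big_seq; apply: eq_bigr => z; rewrite mem_filter => /andP [_ /hc [_]].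
by move=> /(_ nu hnu).
Qed.

End Frequencies.

(** * The radius of convergence and weak convergence *)

Lemma radius_ratio (R : realType) (u : nat -> R) (q : R) : (0 < q)%R -> (forall k, 0 < u k)%R ->
  (fun k => u k / u k.+1)%R @ \oo --> q ->
  sup [set r : R | (0 <= r)%R /\ cvgn (series (fun k => u k * r ^+ k)%R)] = q.
Proof.
move=> q0 u0 h; set A := [set r : R | _].
have ub r : A r -> (r <= q)%R.
  move=> [r_ge0 /cvg_series_cvg_0 c0]; rewrite leNgt; apply/negP => qr.
  have /cvgrPdist_lt /(_ (r - q)%R) := h.
  rewrite subr_gt0 => /(_ qr) [K _ hK].
  (* For r > q the terms eventually do not decrease, so they cannot tend to 0. *)
  have mono k : (K <= k)%N -> (u K * r ^+ K <= u k * r ^+ k)%R.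
    elim: k => [|k IH]; first by rewrite leqn0 => /eqP ->.
    rewrite leq_eqVlt => /orP [/eqP -> //|]; rewrite ltnS => Kk.
    apply: le_trans (IH Kk) _; rewrite exprS mulrA ler_wpM2r ?exprn_ge0 //.
    have := hK k Kk => /=; rewrite ltr_distlC => /andP [_].
    by rewrite [(q + _)%R]addrC subrK ltr_pdivrMr // [(r * _)%R]mulrC => /ltW.
  have pos : (0 < u K * r ^+ K)%R by rewrite mulr_gt0 ?exprn_gt0 // (lt_trans q0).
  have /cvgrPdist_lt /(_ _ pos) [K' _ hK'] := c0.
  have := hK' (maxn K K') (leq_maxr _ _) => /=; rewrite sub0r normrN.
  by apply/negP; rewrite -leNgt; apply: le_trans (mono _ (leq_maxl _ _)) (ler_norm _).
have inA r : (0 <= r)%R -> (r < q)%R -> A r.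
  move=> r_ge0 rq; split=> //.
  (* With [s] strictly between [r] and [q], the sequence [u k * s ^+ k] is bounded, and the series
     at [r] is dominated by a geometric one of ratio [r / s]. *)
  have [s rs sq] : exists2 s : R, (r < s)%R & (s < q)%R by exists ((r + q) / 2)%R; lra.
  have s0 : (0 < s)%R by lra.
  have /cvgrPdist_lt /(_ (q - s)%R) := h.
  rewrite subr_gt0 => /(_ sq) [K _ hK].
  pose C := (\sum_(i < K.+1) u i * s ^+ i)%R.
  have Ci i : (i <= K)%N -> (u i * s ^+ i <= C)%R.
    move=> iK; rewrite /C (bigD1 (inord i)) //= inordK ?ltnS // lerDl.
    by apply: sumr_ge0 => j _; rewrite mulr_ge0 ?exprn_ge0 ?ltW.
  have Cb k : (u k * s ^+ k <= C)%R.
    have [/Ci //|] := leqP k K; elim: k => // k IH.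
    rewrite ltnS leq_eqVlt => Kk.
    have hk : (u k * s ^+ k <= C)%R.
      by case/orP: Kk => [/eqP <-|/IH //]; apply: Ci.
    apply: le_trans hk; rewrite exprS mulrA ler_wpM2r ?exprn_ge0 ?(ltW s0) //.
    have Kk' : (K <= k)%N by rewrite leq_eqVlt.
    have := hK k Kk' => /=; rewrite ltr_distlC => /andP [+ _].
    by rewrite opprB [(q + _)%R]addrC subrK ltr_pdivlMr // [(s * _)%R]mulrC => /ltW.
  apply: (@series_le_cvg R _ (fun k => C * (r / s) ^+ k)%R).
  - by move=> k; rewrite mulr_ge0 ?exprn_ge0 ?(ltW (u0 _)).
  - move=> k; rewrite mulr_ge0 ?exprn_ge0 ?divr_ge0 ?(ltW s0) //.
    by apply: le_trans (Ci 0%N (leq0n _)); rewrite mulr_ge0 ?exprn_ge0 ?ltW.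
  - move=> k; rewrite expr_div_n mulrA ler_pdivlMr ?exprn_gt0 //.
    by rewrite mulrAC ler_wpM2r ?exprn_ge0.
  have /is_cvg_geometric_series : (`|r / s| < 1)%R.
    by rewrite ger0_norm ?divr_ge0 ?(ltW s0) // ltr_pdivrMr // mul1r.
  by apply.
have A0 : A 0%R by apply: inA.
have hub : has_ubound A by exists q => r /ub.
apply/eqP; rewrite eq_le; apply/andP; split; first by apply: ge_sup => //; exists 0%R.
rewrite leNgt; apply/negP => lt.
have s0 : (0 <= sup A)%R by apply: ub_le_sup.
have h2 : (((sup A + q) / 2)%R <= sup A)%R.
  by apply: ub_le_sup => //; apply: inA; lra.
by lra.
Qed.

Lemma mnormalize_dirac d (T : measurableType d) (R : realType) (x : nat -> T) (n : nat)
    (p : probability T R) (A : set T) : (0 < n)%N ->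
  mnormalize (msum (fun i => (@dirac _ T (x i) R : measure T R)) n) p A =
  ((\sum_(i < n) (x i \in A)%:R) / n%:R)%R%:E.
Proof.
move=> n0.
have msumE (B : set T) : msum (fun i => (@dirac _ T (x i) R : measure T R)) n B =
    (\sum_(i < n) (x i \in B)%:R)%R%:E.
  by rewrite /msum -sumEFin; apply: eq_bigr => i _; exact: diracE.
rewrite /mnormalize /= !msumE.
have -> : (\sum_(i < n) (x i \in [set: T])%:R = n%:R :> R)%R.
  rewrite (eq_bigr (fun=> 1%R)); last by move=> i _; rewrite in_setT.
  by rewrite sumr_const card_ord.
rewrite ifF; first by rewrite msumE.
apply/negP => /orP [/eqP [/eqP]|/eqP //].
by rewrite pnatr_eq0 -leqn0 leqNgt n0.
Qed.

Section WeakConvergence.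
Variables (P : pres) (G : germ P).
Local Open Scope group_scope.
Local Notation a := (@gat P G).
Local Notation M := (mon P).
Local Notation Mlist := (@Mlist P).
Variable R : realType.
Variables (r0 : pgen P) (q : R).
Hypothesis q_gt0 : (0 < q)%R.
Hypothesis card_cvg : (fun k => (cardM P k)%:R / (cardM P k.+1)%:R : R)%R @ \oo --> q.
Implicit Types (x y z : M) (xi eta : Mbar P).
Local Notation freq := (@freq P R).
Local Notation unif := (@unif P R q).
Local Notation cell := (@cell P).
Local Notation heads := (@heads P G).
Local Notation pfx := (@pfx P).

Lemma qn_eq : qn R P = q.
Proof.
by apply: radius_ratio => // k; apply: (cardR_gt0 G R r0).
Qed.

Lemma mu_kE j (A : set (Borel P)) : mu_k R P j A = (freq j A)%:E.
Proof.
have := @mnormalize_dirac _ (Borel P) R (fun i => nf (nth (eM P) (Mlist j) i))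
  (size (Mlist j)) (@dirac _ (Borel P) (ebar P) R) A (cardM_gt0 G r0 j).
move=> h; apply: etrans h _; congr ((_ / _)%R%:E).
rewrite -(@big_mkord _ _ _ (size (Mlist j)) xpredT
  (fun i => (nf (nth (eM P) (Mlist j) i) \in A)%:R : R)%R).
rewrite -(big_nth (eM P) xpredT (fun x => (nf x \in A)%:R : R)%R) -natr_sum.
by congr (_%:R)%R; rewrite -sum1_count [RHS]big_mkcond; apply: eq_bigr => x _; case: (_ \in _).
Qed.

Lemma measurable_range_nf : measurable (range (@nf P) : set (Borel P)).
Proof.
rewrite (range_nf G); apply: bigcup_measurable => k _.
apply: (@measurable_cyl P k.+1) => xi eta h /= <-.
exact: h.
Qed.

Lemma measurable_Uparrow x : measurable (Uparrow x : set (Borel P)).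
Proof.
rewrite (Uparrow_prefix G (leqnn _)); apply: measurable_cyl.
exact: (@prefix_cyl P G (len x) (ldiv x)).
Qed.

Lemma uparrow_full (nu : probability (Borel P) R) x : nu (range (@nf P)) = 0%E ->
  nu (uparrow x) = nu (Uparrow x).
Proof.
move=> n0; have mN := measurable_range_nf; have mU := measurable_Uparrow x.
have e : Uparrow x = uparrow x `|` (Uparrow x `&` range (@nf P)).
  by rewrite /uparrow -setIUr setUC setUv setIT.
have m1 : measurable (uparrow x : set (Borel P)).
  by apply: measurableI => //; apply: measurableC.
have m2 : measurable (Uparrow x `&` range (@nf P) : set (Borel P)) by apply: measurableI.
have -> : nu (Uparrow x) = (nu (uparrow x) + nu (Uparrow x `&` range (@nf P)))%E.
  rewrite {1}e; apply: measureU => //; rewrite /uparrow.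
  by apply/seteqP; split=> // xi [[_ h1] [_ h2]].
rewrite (_ : nu (Uparrow x `&` _) = 0%E) ?adde0 //; apply/eqP.
rewrite eq_le measure_ge0 andbT -n0; apply: le_measure; rewrite ?inE //.
Qed.

Lemma is_unif_infty_unif (nu : probability (Borel P) R) : is_unif_infty nu -> unif nu.
Proof.
move=> hnu x; have mN := measurable_range_nf.
rewrite -uparrow_full; first by rewrite hnu qn_eq.
(* At the unit the hypothesis says that the boundary has measure 1; hence M is null, and [uparrow x]
   and [Uparrow x] have the same measure. *)
have := hnu (eM P); rewrite /uparrow (Uparrow_eM G) setTI len_eM expr0 probability_setC //.
have fn : nu (range (@nf P)) \is a fin_num by apply: fin_num_measure.
move: fn; case: (nu _) => // r _; rewrite -EFinB => -[h].
by congr (_%:E); lra.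
Qed.

(** Balls of the product topology are nested or disjoint, so the largest depth in a finite subcover
    works for all pairs of points. *)
Lemma unif_cont (f : Mbar P -> R) : continuous f -> forall e : R, (0 < e)%R ->
  exists k, forall xi eta, agree k xi eta -> (`|f xi - f eta| <= e)%R.
Proof.
move=> cf e e0; have e20 : (0 < e / 2)%R by lra.
have /choice [g hg] : forall xi, exists k, agree k xi `<=` [set eta | (`|f xi - f eta| < e / 2)%R].
  move=> xi; apply: nbhs_agree.
  have /cvgrPdist_lt /(_ _ e20) := cf xi; exact.
have := @compact_Mbar P G; rewrite compact_cover => /(_ (Mbar P) setT (fun xi => agree (g xi) xi)).
case=> [xi _|xi _|D _ cD]; [exact: agree_open|by exists xi|].
exists (\max_(xi <- finmap.enum_fset D) g xi)%N => xi eta h.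
have [zeta /= zD hz] := cD xi I.
have h1 := hg zeta xi hz.
have le : (g zeta <= \max_(xi <- finmap.enum_fset D) g xi)%N by apply: leq_bigmax_seq.
have h2 := hg zeta eta (agree_trans hz (agree_le le h)).
have -> : (f xi - f eta = (f zeta - f eta) - (f zeta - f xi))%R by ring.
by apply: le_trans (ler_normB _ _) _; move: h1 h2 => /=; lra.
Qed.

Lemma continuous_measurable (f : Mbar P -> R) : continuous f ->
  measurable_fun setT (f : Borel P -> R).
Proof.
move=> /continuousP cf; apply: (measurability _ (measurable_realfun.RGenOpens.measurableE R)).
move=> _ [_ [a [b ->] <-]]; rewrite setTI; apply: sub_sigma_algebra.
exact/cf/interval_open.
Qed.

Section Approximation.
Variables (mu : probability (Borel P) R) (f : Mbar P -> R) (C : R).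
Hypothesis cf : continuous f.
Hypothesis bf : forall xi, (`|f xi| <= C)%R.

Lemma integrable_bounded (A : set (Borel P)) : measurable A -> mu.-integrable A (EFin \o f).
Proof.
move=> mA; apply: measurable_bounded_integrable => //.
- by apply: le_lt_trans (probability_le1 mu mA) _; rewrite ltry.
- by apply: measurable_funS (continuous_measurable cf).
exists C; split; first exact: num_real.
by move=> M /ltW hM xi _ /=; apply: le_trans hM.
Qed.

Lemma Rintegral_approx k (e : R) : (0 <= e)%R ->
  (forall xi eta, agree k xi eta -> (`|f xi - f eta| <= e)%R) ->
  (`|\int[mu]_x f x - \sum_(y <- heads k) f (nf y) * fine (mu (cell k y))| <= e)%R.
Proof.
move=> e0 he.
have mc y : measurable (cell k y : set (Borel P)) by apply: measurable_cyl (@cell_cyl P G k y).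
have split_int (s : seq M) : uniq s ->
    (\int[mu]_(x in [set xi | pfx k xi \in s]) f x = \sum_(y <- s) \int[mu]_(x in cell k y) f x)%R.
  elim: s => [|y s IH] /=.
    move=> _; rewrite big_nil.
    have -> : [set xi : Borel P | pfx k xi \in [::]] = set0 by apply/seteqP; split.
    exact: Rintegral_set0.
  move=> /andP [ys us]; rewrite big_cons -IH // -Rintegral_setU.
  - congr (\int[mu]_(x in _) _)%R; apply/seteqP; split=> xi /=; rewrite inE.
      by case/orP => [/eqP h|h]; [left|right].
    by case=> [<-|->]; rewrite ?eqxx ?orbT.
  - exact: mc.
  - exact: (@measurable_cyl P k _ (@prefix_cyl P G k (fun z => z \in s))).
  - apply: integrable_bounded; apply: measurableU; first exact: mc.
    exact: (@measurable_cyl P k _ (@prefix_cyl P G k (fun z => z \in s))).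
  apply/eqP/seteqP; split=> // xi [/= h1 h2]; by rewrite -h1 h2 in ys.
have -> : (\int[mu]_x f x = \sum_(y <- heads k) \int[mu]_(x in cell k y) f x)%R.
  rewrite -split_int ?heads_uniq //.
  have -> // : [set xi : Borel P | pfx k xi \in heads k] = setT.
  by apply/seteqP; split=> // xi _ /=; apply: pfx_heads.
have tot : (\sum_(y <- heads k) fine (mu (cell k y)) = 1)%R.
  have := measure_cells G mu (@cylT P k); rewrite probability_setT.
  rewrite (eq_bigl xpredT); last by move=> y; apply/mem_set.
  move=> h; apply: EFin_inj; rewrite h -sumEFin; apply: eq_bigr => y _.
  by rewrite fineK // fin_num_measure.
rewrite -sumrB; apply: le_trans (ler_norm_sum _ _ _) _.
rewrite -[leRHS]mulr1 -tot mulr_sumr !big_seq; apply: ler_sum => y /headsP hy.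
have near_y xi : cell k y xi -> (`|f xi - f (nf y)| <= e)%R.
  by move=> h; apply: he => i ik; rewrite -h (nf_prefix G).
have ic r : mu.-integrable (cell k y : set (Borel P)) (EFin \o (fun=> r)).
  by apply: finite_measure_integrable_cst.
have lo : ((f (nf y) - e) * fine (mu (cell k y)) <= \int[mu]_(x in cell k y) f x)%R.
  rewrite -Rintegral_cst //; apply: le_Rintegral => //; first exact: integrable_bounded.
  by move=> xi /near_y; rewrite ler_distl => /andP [].
have up : (\int[mu]_(x in cell k y) f x <= (f (nf y) + e) * fine (mu (cell k y)))%R.
  rewrite -Rintegral_cst //; apply: le_Rintegral => //; first exact: integrable_bounded.
  by move=> xi /near_y; rewrite ler_distl => /andP [].
by rewrite ler_norml; apply/andP; split; lra.
Qed.

End Approximation.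

Lemma unif_weak_cvg (nu : probability (Borel P) R) : unif nu -> weak_cvg (@mu_k R P) nu.
Proof.
move=> hnu f cf [C bf].
have EI (mu : probability (Borel P) R) : (\int[mu]_x (f x)%:E)%E = (\int[mu]_x f x)%R%:E.
  rewrite /Rintegral fineK //; apply: integrable_fin_num => //.
  exact: (integrable_bounded mu cf bf).
under eq_fun do rewrite EI.
rewrite EI; apply: cvg_EFin; first by apply: nearW.
(* Three errors of at most e/4 occur: replacing each of the two integrals by a sum over the cells,
   and the convergence of that finite sum. *)
apply/cvgrPdist_le => e e0; have e40 : (0 < e / 4)%R by lra.
have [k hk] := unif_cont cf e40.
have /choice [c hc] : forall z, exists c : R, z \in heads k ->
    ((fun j => freq j (cell k z)) @ \oo --> c) /\
    (forall nu, unif nu -> nu (cell k z) = c%:E).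
  move=> z; have [hz|_] := boolP (z \in heads k); last by exists 0%R.
  by have [c hc] := cell_cvg r0 card_cvg hz; exists c.
have sc : (fun j => \sum_(y <- heads k) f (nf y) * freq j (cell k y))%R @ \oo -->
    (\sum_(y <- heads k) f (nf y) * c y)%R.
  apply: cvg_sum_seq => y /hc [h _]; apply: cvgM => //; exact: cvg_cst.
have e0' := ltW e40.
have hn := Rintegral_approx nu cf bf e0' hk.
have en : (\sum_(y <- heads k) f (nf y) * fine (nu (cell k y)) = \sum_(y <- heads k) f (nf y) * c y)%R.
  by rewrite !big_seq; apply: eq_bigr => y /hc [_ /(_ nu hnu) ->].
rewrite en in hn.
have /cvgrPdist_le /(_ _ e40) [K _ hK] := sc.
exists K => // j Kj /=; have h1 := hK j Kj.
have h2 := Rintegral_approx (mu_k R P j) cf bf e0' hk.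
rewrite (eq_bigr (fun y => f (nf y) * freq j (cell k y)))%R in h2; last first.
  by move=> y _; rewrite mu_kE.
apply: le_trans (ler_distD (\sum_(y <- heads k) f (nf y) * c y)%R _ _) _.
have h3 := ler_distD (\sum_(y <- heads k) f (nf y) * freq j (cell k y))%R
  (\sum_(y <- heads k) f (nf y) * c y)%R (\int[mu_k R P j]_x f x)%R.
by rewrite distrC in h2; lra.
Qed.

End WeakConvergence.

(** * Construction of the uniform measure from its values on cylinders *)

(** A copy of [Mbar P] whose measurable sets are the cylinders, kept apart from the Borel structure
    so that the extension theorem can start from an algebra. *)
Definition cylalg (P : pres) : Type := Mbar P.

Section CylinderAlgebra.
Variable P : pres.

Definition is_cyl : set (set (cylalg P)) := [set A | exists k, @cyl P k A].

Lemma is_cyl0 : is_cyl set0. Proof. by exists 0%N. Qed.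

Lemma is_cylU : setU_closed is_cyl.
Proof.
move=> A B [k hA] [m hB]; exists (maxn k m); apply: cylU.
  exact: cyl_le (leq_maxl _ _) hA.
exact: cyl_le (leq_maxr _ _) hB.
Qed.

Lemma is_cylC : setC_closed is_cyl.
Proof. by move=> A [k hA]; exists k; apply: cylC. Qed.

HB.instance Definition _ := Pointed.copy (cylalg P) (Mbar P).
HB.instance Definition _ := @isAlgebraOfSets.Build default_measure_display (cylalg P)
  is_cyl is_cyl0 is_cylU is_cylC.

Lemma open_cylinders (U : set (Mbar P)) : open U ->
  U = \bigcup_k [set xi | agree k xi `<=` U].
Proof.
move=> oU; apply/seteqP; split=> [xi Uxi|xi [k _ h]]; last exact: h.
have [k hk] := nbhs_agree (open_nbhs_nbhs (conj oU Uxi)).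
by exists k.
Qed.

Lemma measurable_cyl_open (U : set (Mbar P)) : open U ->
  (@measurable _ (cylalg P)).-sigma.-measurable (U : set (cylalg P)).
Proof.
move=> oU; rewrite (open_cylinders oU); apply: bigcupT_measurable => k.
apply: sub_sigma_algebra; exists k => xi eta e /= h zeta hz.
by apply: h; apply: agree_trans e hz.
Qed.

End CylinderAlgebra.

Section Existence.
Variables (P : pres) (G : germ P).
Local Open Scope group_scope.
Local Notation a := (@gat P G).
Local Notation l := (@glen P G).
Local Notation δ := (@gdel P G).
Local Notation M := (mon P).
Variable R : realType.
Variables (r0 : pgen P) (q : R).
Hypothesis q_gt0 : (0 < q)%R.
Hypothesis card_cvg : (fun k => (cardM P k)%:R / (cardM P k.+1)%:R : R)%R @ \oo --> q.
Implicit Types (x y z : M) (xi eta : Mbar P).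
Local Notation freq := (@freq P R).

Definition cmass (A : set (cylalg P)) : \bar R :=
  if pselect (is_cyl A) then (limn (fun j => freq j A))%:E else 0%E.

Lemma cmass_cvg A : is_cyl A -> exists2 c : R, (fun j => freq j A) @ \oo --> c & cmass A = c%:E.
Proof.
move=> [k hA]; have [c [h _]] := cyl_cvg G r0 card_cvg hA.
exists c => //; rewrite /cmass; case: pselect => [cA|nA]; last by case: nA; exists k.
by congr (_%:E); apply: cvg_lim.
Qed.

Lemma cmass_ge0 A : (0 <= cmass A)%E.
Proof.
rewrite /cmass; case: pselect => // hA; have [c h _] := cmass_cvg hA.
rewrite lee_fin; apply: limr_ge; first by apply: cvgP h.
by apply: nearW => j; apply: freq_ge0.
Qed.

Lemma cmass0 : cmass set0 = 0%E.
Proof.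
have [c h ->] := cmass_cvg (is_cyl0 P); congr (_%:E).
have h0 : (fun j => freq j set0) @ \oo --> (0 : R)%R.
  rewrite (_ : (fun j => _) = fun=> 0%R); first exact: cvg_cst.
  apply/funext => j; rewrite /freq (eq_count (a2 := pred0)) ?count_pred0 ?mul0r //.
  by move=> x /=; apply/negbTE/negP => /set_mem.
by rewrite -(cvg_lim _ h) // (cvg_lim _ h0).
Qed.

Lemma cmass_semi_additive2 : measure_function.semi_additive2 cmass.
Proof.
move=> A B mA mB mAB dAB; have [a ha ->] := cmass_cvg mA; have [b hb ->] := cmass_cvg mB.
have [c hc ->] := cmass_cvg mAB; rewrite -EFinD; congr (_%:E).
have h : (fun j => freq j (A `|` B)) @ \oo --> (a + b)%R.
  rewrite (_ : (fun j => _) = (fun j => freq j A + freq j B)%R); first exact: cvgD.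
  apply/funext => j; rewrite /freq -mulrDl -natrD -count_predUI; congr (_%:R / _)%R.
  rewrite [X in (_ + X)%N](eq_count (a2 := pred0)) ?count_pred0 ?addn0.
    by apply: eq_count => x /=; rewrite in_setU.
  move=> x /=; apply/negbTE/negP => /andP [/set_mem h1 /set_mem h2].
  by have : (A `&` B) (nf x) by []; rewrite dAB.
by rewrite -(cvg_lim _ hc) // (cvg_lim _ h).
Qed.

Lemma cmass_semi_additive : measure_function.semi_additive cmass.
Proof. by apply/(additive2P cmass0); rewrite -semi_additive2E; apply: cmass_semi_additive2. Qed.

(* By compactness a cylinder is never an infinite disjoint union of nonempty ones. *)
Lemma cyl_finite_union (F : nat -> set (cylalg P)) : (forall i, is_cyl (F i)) ->
  trivIset setT F -> is_cyl (\bigcup_n F n) -> exists N, forall n, (N <= n)%N -> F n = set0.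
Proof.
move=> mF tF [k hk].
have oF n : open (F n : set (Mbar P)) by have [m hm] := mF n; apply: cyl_open hm.
have cU : compact (\bigcup_n F n : set (Mbar P)).
  by apply: (subclosed_compact (cyl_closed hk) (compact_Mbar G)).
move: cU; rewrite compact_cover => /(_ nat setT F) [//|//|D _ hD].
exists (\max_(i <- finmap.enum_fset D) i).+1 => n hn; apply/seteqP; split=> // xi Fn.
have [i /= iD Fi] := hD xi (ex_intro2 _ _ n I Fn).
have ni : n <> i.
  move=> e; move: hn; rewrite ltnNge => /negP; apply; rewrite e.
  by apply: (leq_bigmax_seq (F := id)).
by apply: ni; apply: tF => //; exists xi.
Qed.

Lemma cmass_semi_sigma_additive : semi_sigma_additive cmass.
Proof.
move=> F mF tF mU; have [N hN] := cyl_finite_union mF tF mU.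
have e : \bigcup_n F n = \big[setU/set0]_(i < N) F i.
  rewrite -bigcup_mkord; apply/seteqP; split=> xi [n _ Fn]; last by exists n.
  by have [nN|/hN h] := ltnP n N; [exists n|rewrite h in Fn].
apply: cvg_near_cst; exists N => // n /= Nn.
have add m : cmass (\big[setU/set0]_(i < m) F i) = (\sum_(i < m) cmass (F i))%E.
  have := cmass_semi_additive; rewrite semi_additiveE => h; exact: h.
rewrite e add -(big_mkord xpredT (fun i => cmass (F i))) (big_cat_nat (leq0n N) Nn) /=.
have -> : (\sum_(N <= i < n) cmass (F i) = 0)%E; last by rewrite adde0.
by rewrite big_nat_cond big1 // => i /andP [/andP [Ni _] _]; rewrite hN // cmass0.
Qed.

HB.instance Definition _ := @isMeasure.Build _ (cylalg P) R cmass
  cmass0 cmass_ge0 cmass_semi_sigma_additive.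

Let I := g_sigma_algebraType (@measurable _ (cylalg P)).

(** Open sets are countable unions of cylinders, so Borel sets lie in the sigma-algebra generated by
    cylinders, where the Carathéodory extension is a measure. *)
Lemma borel_sub (A : set (Borel P)) : measurable A -> measurable (A : set I).
Proof.
move: A; apply: smallest_sub; first exact: smallest_sigma_algebra.
by move=> U; apply: measurable_cyl_open.
Qed.

Definition unif_measure (A : set (Borel P)) : \bar R := measure_extension cmass (A : set I).

Lemma unif_measure0 : unif_measure set0 = 0%E. Proof. exact: measure0. Qed.

Lemma unif_measure_ge0 A : (0 <= unif_measure A)%E. Proof. exact: measure_ge0. Qed.

Lemma unif_measure_sigma : semi_sigma_additive unif_measure.
Proof.
move=> F mF tF mU.
apply: (@measure_semi_sigma_additive _ I _ (measure_extension cmass)) => //.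
  by move=> i; apply: borel_sub.
exact: borel_sub.
Qed.

HB.instance Definition _ := isMeasure.Build _ (Borel P) R unif_measure
  unif_measure0 unif_measure_ge0 unif_measure_sigma.

Lemma unif_measure_cyl (A : set (Borel P)) : is_cyl A -> unif_measure A = cmass A.
Proof. by move=> hA; rewrite /unif_measure /measure_extension measurable_mu_extE. Qed.

Lemma unif_measure_Uparrow x : unif_measure (Uparrow x) = (q ^+ len x)%:E.
Proof.
have hU : is_cyl (Uparrow x : set (cylalg P)).
  exists (len x); rewrite (Uparrow_prefix G (leqnn _)).
  exact: (@prefix_cyl P G (len x) (ldiv x)).
rewrite unif_measure_cyl //; have [c h ->] := cmass_cvg hU; congr (_%:E).
rewrite -(cvg_lim _ h) //; apply: cvg_lim => //.
exact: (freq_Uparrow_cvg G r0 card_cvg).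
Qed.

Lemma unif_measureT : unif_measure setT = 1%E.
Proof. by have := unif_measure_Uparrow (eM P); rewrite (Uparrow_eM G) len_eM expr0. Qed.

HB.instance Definition _ := Measure_isProbability.Build _ (Borel P) R unif_measure unif_measureT.

(* Only the finitely many x of length at most k |delta| have trivial k-th factor. *)
Lemma unif_measure_stop k : unif_measure [set xi | val xi k = eM P] = 0%E.
Proof.
have hA : is_cyl ([set xi | val xi k = eM P] : set (cylalg P)).
  by exists k.+1 => xi eta h /= <-; apply: h.
rewrite unif_measure_cyl //; have [c h ->] := cmass_cvg hA; congr (_%:E).
rewrite -(cvg_lim _ h) //; apply: lim_near_cst => //.
exists (k * l δ).+1 => // j /= hj.
rewrite /freq (eq_in_count (a2 := pred0)) ?count_pred0 ?mul0r //.
move=> x; rewrite mem_Mlist => /eqP lx; apply/negbTE/negP => /set_mem /=.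
rewrite (val_nf G) /nfseq -(@simp1 P G) => /(simp_inj (al_S G _) (@S1 _ G)) /al_eq1 e.
have := len_prefix G k (nf x); rewrite (prefix_nf G).
by have := hd_iter G k x; rewrite e mulM1 => <-; rewrite lx leqNgt hj.
Qed.

Lemma unif_measure_range : unif_measure (range (@nf P)) = 0%E.
Proof.
have mN := measurable_range_nf G.
have m k : measurable ([set xi | val xi k = eM P] : set (Borel P)).
  by apply: (@measurable_cyl P k.+1) => xi eta h /= <-; apply: h.
apply/(negligibleP _ mN); rewrite (range_nf G); apply: negligible_bigcup => k.
by apply/(negligibleP _ (m k)); apply: unif_measure_stop.
Qed.

Lemma unif_exists : exists nu : probability (Borel P) R, is_unif_infty nu.
Proof.
exists [the probability _ _ of unif_measure] => x.
rewrite (qn_eq G r0 q_gt0 card_cvg) -unif_measure_Uparrow.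
by apply: (uparrow_full G); apply: unif_measure_range.
Qed.

End Existence.

(** * The limit theorem for connected germs and for both braid monoids *)

Theorem germ_uniform_limit (R : realType) (P : pres) (G : germ P) : germ_connected G ->
  exists nu : probability (Borel P) R,
    is_unif_infty nu /\
    (forall nu' : probability (Borel P) R,
       is_unif_infty nu' -> weak_cvg (@mu_k R P) nu').
Proof.
move=> hG; have [rho rho1 hrho] := cardM_ratio R hG.
have [r0 _] : exists r : pgen P, True.
  case: hG => [d1|[r _]]; last by exists r.
  have /(g_atom (@Sd _ G)) [r _] : gdel G <> 1%g by move=> e; move: d1; rewrite e glen1.
  by exists r.
have cv := ratio_cvg_inv (cardR_gt0 G R r0) rho1 hrho.
have q0 : (0 < rho^-1)%R by rewrite invr_gt0 (lt_le_trans ltr01).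
have [nu hnu] := unif_exists G r0 q0 cv.
exists nu; split=> // nu' h; apply: (unif_weak_cvg G r0 cv).
exact: (is_unif_infty_unif G r0 q0 cv).
Qed.

Theorem theorem5p1 (R : realType) (n : nat) (hn : (2 <= n)%N) (P : pres)
    (hP : P = braid_pres n \/ P = dual_pres n) :
  exists nu : probability (Borel P) R,
    is_unif_infty nu /\
    (forall nu' : probability (Borel P) R,
       is_unif_infty nu' -> weak_cvg (@mu_k R P) nu').
Proof.
(* The germs are indexed by [m] with n = [m.+1], and the hypothesis on n becomes [0 < m] by
   computation. *)
case: n hn hP => // m hn [] ->.
  exact: germ_uniform_limit (braid_connected hn).
exact: germ_uniform_limit (dual_connected hn).
Qed.
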